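(* Let $\mathbb K$ be a field, let $G=([n],E(G))$ be an arbitrary simple graph with blocks $G_1,\dots,G_s$, let $\mathcal S=(S_{ij})$ be a family of gain sets on $G$ with values in $\mathbb K$, and let $\mathcal S_\nu$ be the restriction of $\mathcal S$ to $G_\nu$. Then the following conditions are equivalent: (1) The cone $c\mathcal A(G_{\mathcal S})$ is supersolvable. (2) The lattice $L(c\mathcal A(G_{\mathcal S}))$ has a maximal modular chain passing through $H_\infty$. (3) $\mathcal A(G_{\mathcal S})$ admits a nice partition. (4) $G_{\mathcal S}$ is blockwise admissible, that is, every $(G_\nu)_{\mathcal S_\nu}$ admits an $\mathcal S_\nu$-admissible ordering.
   Context: Gain sets: $\mathcal S=(S_{ij})$ is a family of finite subsets of $\mathbb K$ indexed by ordered pairs of distinct vertices of $G$, with $S_{ji}=-S_{ij}=\{-a\mid a\in S_{ij}\}$ and $S_{ij}\neq\emptyset$ if and only if $ij\in E(G)$. $G_{\mathcal S}$ denotes $G$ together with these sets. Put $H_{ij}^a=\{x\in\mathbb K^n\mid x_i-x_j=a\}$ and $\mathcal A(G_{\mathcal S})=\{H_{ij}^a\mid a\in S_{ij},\ i<j\}$. Cone: with an extra coordinate $y$, $c\mathcal A(G_{\mathcal S})=\{cH_{ij}^a\mid a\in S_{ij},\ i<j\}\cup\{H_\infty\}$ in $\mathbb K^{n+1}$, where $cH_{ij}^a=\{(x,y)\mid x_i-x_j=ay\}$ and $H_\infty=\{y=0\}$ is the hyperplane at infinity. Blocks: a block of $G$ is a maximal connected subgraph without a cut vertex (of itself); isolated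 vertices and bridges are included as blocks of orders one and two. Admissible ordering: for $A,B\subseteq\mathbb K$ put $A-B=\{a-b\mid a\in A,b\in B\}$. An ordering $v_1,\dots,v_m$ of the vertices of a graph with gain sets $\mathcal S$ is $\mathcal S$-admissible if $S_{v_kv_j}-S_{v_kv_i}\subseteq S_{v_iv_j}$ for every $k$ and all distinct $i,j>k$. Intersection poset: for a finite affine arrangement $\mathcal A$ in $V$, $L(\mathcal A)$ consists of $V$ and all nonempty intersections of hyperplanes of $\mathcal A$, ordered by reverse inclusion; $r(X)=\operatorname{codim}_V X$; the localization at $X\in L(\mathcal A)$ is $\mathcal A_X=\{H\in\mathcal A\mid X\subseteq H\}$. $\mathcal A$ is central if the intersection of all its hyperplanes is nonempty; then $L(\mathcal A)$ is a ranked lattice with maximum $\hat 1=\bigcap_{H\in\mathcal A}H$. Modularity: for central $\mathcal A$, $X\in L(\mathcal A)$ is modular if $r(X)+r(Y)=r(X\wedge Y)+r(X\vee Y)$ for all $Y\in L(\mathcal A)$. A maximal modular chain is a maximal chain $V=X_0<X_1<\cdots<X_r=\hat 1$ in $L(\mathcal A)$ all of whose elements are modular; it passes through a hyperplane $H\in\mathcal A$ if $X_1=H$. $\mathcal A$ is supersolvable if $L(\mathcal A)$ has a maximal modular chain. Nice partition: let $\pi=(\pi_1,\dots,\pi_s)$ be a partition of an affine arrangement $\mathcal A$ in $V$. A $p$-section of $\pi$ is a set $\{H_1,\dots,H_p\}\subseteq\mathcal A$ no two of whose members lie in the same part; it is independent if $H_1\cap\cdots\cap H_p$ is nonempty of codimension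 $p$. $\pi$ is independent if every section is independent. $\pi$ is nice if it is independent and, for every $X\in L(\mathcal A)\setminus\{V\}$, there is $i$ with $|\pi_i\cap\mathcal A_X|=1$. The empty partition of the empty arrangement is nice. *)

(* Defs.v *)
From HB Require Import structures.
From mathcomp Require Import all_boot all_order all_algebra.
From mathcomp Require Import finmap.
From mathcomp Require Import boolp classical_sets functions cardinality.

Set Implicit Arguments.
Unset Strict Implicit.
Unset Printing Implicit Defensive.

Import GRing.Theory.

Local Open Scope classical_set_scope.
Local Open Scope card_scope.
Local Open Scope ring_scope.

(** * Simple graphs on a subset of a finite type, and their blocks *)

Record graph (T : finType) := Graph {
  vertices : {set T};
  edge : rel T;
  edge_sym : symmetric edge;
  edge_irr : irreflexive edge;
  edge_vertices : forall x y, edge x y -> x \in vertices }.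

Definition subgraph (T : finType) (H G : graph T) : Prop :=
  {subset vertices H <= vertices G} /\ subrel (edge H) (edge G).

Definition connected_graph (T : finType) (G : graph T) : Prop :=
  (exists x, x \in vertices G) /\
  {in vertices G &, forall x y, connect (edge G) x y}.

Definition cut_vertex (T : finType) (G : graph T) (v : T) : Prop :=
  v \in vertices G /\
  exists x y, [/\ x \in vertices G, y \in vertices G, x != v, y != v &
    connect (edge G) x y /\
    ~~ connect [rel a b | [&& edge G a b, a != v & b != v]] x y].

Definition nonseparable (T : finType) (G : graph T) : Prop :=
  connected_graph G /\ forall v, ~ cut_vertex G v.

Definition is_block (T : finType) (G B : graph T) : Prop :=
  [/\ subgraph B G, nonseparable B &
      forall B', subgraph B' G -> nonseparable B' ->
        subgraph B B' -> subgraph B' B].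

(** * Gain sets *)

(* The values [S i i] are unconstrained and are never used. *)
Definition gain_sets (K : fieldType) (T : finType) (G : graph T)
    (S : T -> T -> {fset K}) : Prop :=
  forall i j, i != j ->
    S j i = [fset - a | a in S i j]%fset /\ (S i j != fset0) = edge G i j.

Definition restrict_gains (K : fieldType) (T : finType) (B : graph T)
    (S : T -> T -> {fset K}) : T -> T -> {fset K} :=
  fun i j => if edge B i j then S i j else fset0.

Definition fset_diff (K : fieldType) (A B : {fset K}) : {fset K} :=
  [fset a - b | a in A, b in B]%fset.

(* Positions are counted from 0. *)
Definition admissible_ordering (K : fieldType) (T : finType) (G : graph T)
    (S : T -> T -> {fset K}) (m : nat) (v : 'I_m -> T) : Prop :=
  [/\ injective v, (forall x, x \in vertices G <-> exists k, x = v k) &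
      forall k i j : 'I_m, (k < i)%N -> (k < j)%N -> i != j ->
        (fset_diff (S (v k) (v j)) (S (v k) (v i)) `<=` S (v i) (v j))%fset].

Definition blockwise_admissible (K : fieldType) (T : finType) (G : graph T)
    (S : T -> T -> {fset K}) : Prop :=
  forall B, is_block G B ->
    exists m (v : 'I_m -> T), admissible_ordering B (restrict_gains B S) v.

(** * Hyperplane arrangements, as sets of subsets of a vector space *)

Section Arrangement.
Variables (K : fieldType) (V : vectType K).
Implicit Types (A B : set (set V)) (X Y H : set V).

(* The intersection over [B = set0] is the whole space. *)
Definition flats A : set (set V) :=
  [set X | X !=set0 /\ exists2 B, B `<=` A & X = \bigcap_(H in B) H].

(* The subspace [U] such that [X] is a translate of [U], for [X] affine;
   [U] is then unique by [direction_translate]. *)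
Definition direction X : {vspace V} :=
  xget fullv [set U | exists p, X = [set p + u | u in [set u | u \in U]]].

Lemma direction_translate (p : V) (U : {vspace V}) :
  direction [set p + u | u in [set u | u \in U]] = U.
Proof.
rewrite /direction; case: xgetP => [W _ [q E]|/(_ U)[]]; last by exists p.
have sub (p1 p2 : V) (U1 U2 : {vspace V}) :
    [set p1 + u | u in [set u | u \in U1]] =
    [set p2 + u | u in [set u | u \in U2]] -> (U1 <= U2)%VS.
  move=> E12; apply/subvP => u uU1.
  have [v vU2 Ev] : [set p2 + v | v in [set v | v \in U2]] (p1 + u).
    by rewrite -E12; exists u.
  have [w wU2 Ew] : [set p2 + v | v in [set v | v \in U2]] p1.
    by rewrite -E12; exists 0; rewrite /= ?mem0v ?addr0.
  have -> : u = v - w by rewrite -[LHS](addKr p1) -Ev -{1}Ew opprD addrACA addNr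
    add0r addrC.
  exact: rpredB.
by apply/eqP; rewrite eqEsubv (sub _ _ _ _ (esym E)) (sub _ _ _ _ E).
Qed.

Definition codim X : nat := (\dim {: V} - \dim (direction X))%N.

Definition localization A X : set (set V) := [set H | A H /\ X `<=` H].

Definition top_flat A : set V := \bigcap_(H in A) H.

Definition central A : Prop := top_flat A !=set0.

(* Meet and join for the order by reverse inclusion; see [flat_meetP] and
   [flat_joinP]. *)
Definition flat_meet A X Y : set V :=
  \bigcap_(H in [set H | A H /\ X `|` Y `<=` H]) H.

Definition flat_join X Y : set V := X `&` Y.

Lemma flat_meetP A X Y : flats A X -> flats A Y ->
  [/\ flats A (flat_meet A X Y), X `<=` flat_meet A X Y,
      Y `<=` flat_meet A X Y &
      forall Z, flats A Z -> X `<=` Z -> Y `<=` Z -> flat_meet A X Y `<=` Z].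
Proof.
move=> [[x Xx] _] _; split.
- split; last by exists [set H | A H /\ X `|` Y `<=` H] => // H [].
  by exists x => H [_]; apply; left.
- by move=> y Xy H [_]; apply; left.
- by move=> y Yy H [_]; apply; right.
- move=> _ [_ [B BA ->]] XZ YZ z mz H BH; apply: mz; split; first exact: BA.
  by move=> y [/XZ|/YZ]; apply.
Qed.

Lemma flat_joinP A X Y : central A -> flats A X -> flats A Y ->
  [/\ flats A (flat_join X Y), flat_join X Y `<=` X, flat_join X Y `<=` Y &
      forall Z, flats A Z -> Z `<=` X -> Z `<=` Y -> Z `<=` flat_join X Y].
Proof.
move=> [p Ap] [_ [B BA ->]] [_ [C CA ->]]; split.
- split; last by exists (B `|` C); [rewrite subUset | rewrite bigcap_setU].
  by exists p; split=> H ?; apply: Ap; [apply: BA | apply: CA].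
- exact: subIsetl.
- exact: subIsetr.
- by move=> Z _ ZX ZY; rewrite subsetI.
Qed.

Definition modular A X : Prop :=
  flats A X /\ forall Y, flats A Y ->
    (codim X + codim Y = codim (flat_meet A X Y) + codim (flat_join X Y))%N.

(* Only [C 0, ..., C r] matter.  As [C r] is a flat, hence nonempty, a
   maximal chain exists only when [A] is central. *)
Definition maximal_chain A (r : nat) (C : nat -> set V) : Prop :=
  [/\ C 0%N = setT, C r = top_flat A,
      forall i, (i <= r)%N -> flats A (C i),
      forall i, (i < r)%N -> C i.+1 `<` C i &
      forall Y, flats A Y ->
        (forall i, (i <= r)%N -> Y `<=` C i \/ C i `<=` Y) ->
        exists2 i, (i <= r)%N & Y = C i].

Definition maximal_modular_chain A (r : nat) (C : nat -> set V) : Prop :=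
  maximal_chain A r C /\ forall i, (i <= r)%N -> modular A (C i).

Definition supersolvable A : Prop :=
  exists r C, maximal_modular_chain A r C.

Definition has_maximal_modular_chain_through A H : Prop :=
  exists r C, [/\ maximal_modular_chain A r C, (0 < r)%N & C 1%N = H].

Definition is_partition A (s : nat) (pi : 'I_s -> set (set V)) : Prop :=
  [/\ forall i, pi i !=set0, forall i j, i != j -> pi i `&` pi j = set0 &
      \bigcup_i pi i = A].

Definition is_section A (s : nat) (pi : 'I_s -> set (set V)) (p : nat) B :
    Prop :=
  [/\ B `<=` A, B #= `I_p &
      forall i H H', B H -> B H' -> pi i H -> pi i H' -> H = H'].

Definition independent_section (p : nat) B : Prop :=
  \bigcap_(H in B) H !=set0 /\ codim (\bigcap_(H in B) H) = p.

Definition independent_partition A (s : nat) (pi : 'I_s -> set (set V)) :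
    Prop :=
  forall p B, is_section A pi p B -> independent_section p B.

Definition nice_partition A (s : nat) (pi : 'I_s -> set (set V)) : Prop :=
  [/\ is_partition A pi, independent_partition A pi &
      forall X, flats A X -> X <> setT ->
        exists i H, pi i `&` localization A X = [set H]].

Definition has_nice_partition A : Prop :=
  exists s (pi : 'I_s -> set (set V)), nice_partition A pi.

End Arrangement.

(** * The affine arrangement of a graph with gain sets, and its cone *)

Definition gain_hyperplane (K : fieldType) (n : nat) (i j : 'I_n) (a : K) :
    set 'rV[K]_n :=
  [set x | x 0 i - x 0 j = a].

Definition gain_arrangement (K : fieldType) (n : nat)
    (S : 'I_n -> 'I_n -> {fset K}) : set (set 'rV[K]_n) :=
  [set H | exists (i j : 'I_n) (a : K),
    [/\ (i < j)%N, a \in S i j & H = gain_hyperplane i j a]].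

(* A point of K^(n+1) is [row_mx x y]: the last coordinate is the extra
   coordinate y. *)
Definition cone_gain_hyperplane (K : fieldType) (n : nat) (i j : 'I_n)
    (a : K) : set 'rV[K]_(n + 1) :=
  [set z | z 0 (lshift 1 i) - z 0 (lshift 1 j) = a * z 0 (rshift n ord0)].

Definition hyperplane_at_infinity (K : fieldType) (n : nat) :
    set 'rV[K]_(n + 1) :=
  [set z | z 0 (rshift n ord0) = 0].
Arguments hyperplane_at_infinity : clear implicits.

Definition cone_arrangement (K : fieldType) (n : nat)
    (S : 'I_n -> 'I_n -> {fset K}) : set (set 'rV[K]_(n + 1)) :=
  [set H | exists (i j : 'I_n) (a : K),
    [/\ (i < j)%N, a \in S i j & H = cone_gain_hyperplane i j a]]
  `|` [set hyperplane_at_infinity K n].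

(* Main.v *)
Require Import Defs.
From mathcomp Require Import all_boot all_order all_algebra.
From mathcomp Require Import zify.
From mathcomp Require boolp.

(** Modular chains are handled through levels. Sending a hyperplane of a central
arrangement to the step at which a maximal modular chain first enters it gives a
function rho on hyperplanes such that two hyperplanes on one level meet inside a
hyperplane of a lower level, while no hyperplane contains the intersection of the
lower ones ([chain_level_function]); conversely such a function yields a maximal
modular chain, which starts with the hyperplane of least level if there is only
one ([level_function_chain_through]). Both directions rest on one rank formula:
the codimension of an intersection is the number of levels met ([rank_levels],
[rank_level_closed]).

From (1) and from (3) to (4). Both a modular chain of the cone and a nice
partition of the affine arrangement colour the edges of G, by level or by part.
Gain hyperplanes on disjoint edges span no third one, and those on two adjacent
edges span at most the third side of the triangle. Hence disjoint edges have
different colours, and two adjacent edges of one colour are completed to a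
triangle by an edge of another colour. Counting ranks, a vertex set D spans fewer
than #|D| colours, and exactly #|D| - 1 if it is connected ([rank_colouring]). In
a block with m vertices this leaves m - 1 colours, and m - 2 after the removal of
any vertex v: exactly one colour, private to v, disappears. Every edge carries the
private colour of one of its ends ([edge_private_colour]), and directing it away
from that end gives an acyclic digraph, as a set of vertices each having an arc
inside the set would span too many colours ([arc_sinks]). Eliminating sources
first, the edges from a vertex to the later ones have a single colour, so the
later neighbours are pairwise adjacent.

For a nice partition the gains of these triangles match, which is admissibility.
For a modular chain they are sure to match only on the edges above H_infinity. The
other edges come last, since private colours do not increase along arcs
([private_colour_monotone]). The flat spanned by the hyperplanes below H_infinity
provides a potential, and after switching by it every such edge has a hyperplane
of gain zero. If it has further gains they lie at the level of H_infinity itself,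
so that the edges with further gains are pairwise adjacent and their ends form a
clique. A chordal graph can be eliminated towards any given clique
([simplicial_elim_to_clique]), and within this clique every order works in which
the centre of the star formed by these edges, if there is one, comes last
([extra_ends_simplicial]).

From (4) to (2) and (3). Order the edges of each block by the position of their
earlier end, later positions being lower, and keep different blocks on different
levels. Admissibility gives the condition on two hyperplanes of one level. For the
other condition, a vertex v is separated from the later vertices of its block by
deleting the edges of the block that leave v or earlier vertices, because two
vertices of a block are not joined outside it ([block_separates],
[level_separator]). With H_infinity below everything this gives the chain, and the
levels partition the affine arrangement nicely: a localization has only one
hyperplane on its least level ([level_nice_partition]). *)

Set Implicit Arguments.
Unset Strict Implicit.
Unset Printing Implicit Defensive.

(** * Elimination orders and edge colourings *)

Section EliminationOrders.
Local Open Scope nat_scope.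
Variable T : finType.
Implicit Types (P : T -> {set T} -> Prop) (D E F Q : {set T}).

(** Removing vertices one at a time leads from D down to E, where x may be removed
when P holds of x and of the set of vertices that remain. Working with sets rather
than with sequences lets the end of an order be replaced without touching its
beginning. *)
Inductive elim P E : {set T} -> Prop :=
| elim_refl : elim P E E
| elim_step x D : x \notin D -> E \subset D -> P x D -> elim P E D ->
    elim P E (x |: D).

Lemma elim_sub P E D : elim P E D -> E \subset D.
Proof.
case=> [|x {}D _ ED _ _]; first exact: subxx.
exact: subset_trans ED (subsetUr _ _).
Qed.

Lemma elim_trans P E D F : elim P E D -> elim P F E -> elim P F D.
Proof.
move=> ED FE; elim: ED => // x {}D xD ED' Px _ IH; apply: elim_step => //.
exact: subset_trans (elim_sub FE) ED'.
Qed.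

Lemma elim_impl P P' E D :
  (forall x D', x \notin E -> x \notin D' -> x |: D' \subset D -> P x D' -> P' x D') ->
  elim P E D -> elim P' E D.
Proof.
move=> PP' ED; elim: ED PP' => [_|x {}D xD ED' Px _ IH PP']; first exact: elim_refl.
apply: elim_step => //.
  by apply: PP' => //; apply: contra xD => /(subsetP ED').
apply: IH => y D' yE yD' sub; apply: PP' => //.
exact: subset_trans sub (subsetUr _ _).
Qed.

Lemma elim_any P D E : E \subset D ->
  (forall x D', x \in D -> x \notin E -> D' \subset D -> x \notin D' -> P x D') ->
  elim P E D.
Proof.
have [n] := ubnP #|D|; elim: n D => // n IH D; rewrite ltnS => Dn ED h.
have [->|] := eqVneq E D; first exact: elim_refl.
rewrite eqEsubset ED /= => /subsetPn[x xD xE]; rewrite -(setD1K xD).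
have sub := subD1set D x.
apply: elim_step; rewrite ?setD11 // ?subsetD1 ?ED //.
  by apply: h; rewrite ?setD11.
apply: IH; rewrite ?subsetD1 ?ED //.
  by apply: leq_trans Dn; rewrite [leqRHS](cardsD1 x) xD.
move=> y D' yD yE D'D yD'; apply: h => //; first exact: (subsetP sub).
exact: subset_trans D'D sub.
Qed.

Lemma elim_seq P D : elim P set0 D -> exists s : seq T,
  [/\ uniq s, s =i D &
      forall s1 x s2, s = s1 ++ x :: s2 -> P x [set y in s2]].
Proof.
elim=> [|x {}D xD _ Px _ [s [us sD Ps]]].
  exists [::]; split=> //; last by case.
  by move=> x; rewrite in_set0.
exists (x :: s); split.
- by rewrite /= us sD xD.
- by move=> y; rewrite inE sD in_setU1.
case=> [|z s1] y s2 /= [xE Es]; last exact: Ps Es.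
rewrite -xE.
have -> : [set y in s2] = D by apply/setP => w; rewrite inE -Es sD.
exact: Px.
Qed.

Section Sinks.
Variables (P : T -> {set T} -> Prop) (W : {set T}) (R : rel T).
Hypothesis sinks : forall D, D \subset W -> D != set0 ->
  exists2 x, x \in D & forall y, y \in D -> ~~ R x y.
Hypothesis RP : forall x D, x \in W -> D \subset W -> x \notin D ->
  (forall y, y \in D -> ~~ R y x) -> P x D.

(** An order built from its end: a sink z of D can be placed after the rest of D
and before F, and then no later vertex has an arc to an earlier one. *)
Lemma elim_of_sinks D F : D \subset W -> F \subset W -> [disjoint D & F] ->
  (forall x y, x \in F -> y \in D -> ~~ R x y) -> elim P F (D :|: F).
Proof.
have [n] := ubnP #|D|; elim: n D F => // n IH D F.
rewrite ltnS => Dn DW FW DF nR.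
have [->|D0] := eqVneq D set0; first by rewrite set0U; apply: elim_refl.
have [z zD zsink] := sinks DW D0.
have zF : z \notin F by rewrite (disjointFr DF).
have zW : z \in W by apply: (subsetP DW).
have -> : D :|: F = (D :\ z) :|: (z |: F).
  by apply/setP => x; rewrite !inE; have [->|_] := eqVneq x z; rewrite ?zD.
apply: (@elim_trans _ (z |: F)).
  apply: IH.
  - by apply: leq_trans Dn; rewrite [leqRHS](cardsD1 z) zD.
  - exact: subset_trans (subD1set _ _) DW.
  - by rewrite subUset sub1set zW.
  - apply/pred0P => x; rewrite /= !inE.
    have [//|xz] := eqVneq x z; rewrite /=.
    by case: (boolP (x \in D)) => // xD; rewrite (disjointFr DF).
  - move=> x y; rewrite !inE => /orP[/eqP->|xF] /andP[_ yD]; last exact: nR.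
    exact: zsink.
apply: elim_step => //; last exact: elim_refl.
by apply: RP => // y yF; apply: nR.
Qed.

End Sinks.

Section Simplicial.
Variable e : rel T.
Hypothesis e_sym : symmetric e.

Definition clique D := forall y z, y \in D -> z \in D -> y != z -> e y z.

Definition simplicial x D := clique [set y in D | e x y].

Lemma simplicialS x D D' : D' \subset D -> simplicial x D -> simplicial x D'.
Proof.
move=> /subsetP DD' h y z; rewrite !inE => /andP[yD xy] /andP[zD xz].
by apply: h; rewrite inE ?DD' ?xy ?xz.
Qed.

Lemma simplicial_elimS D D' : D' \subset D -> elim simplicial set0 D ->
  elim simplicial set0 D'.
Proof.
move=> sub ED; elim: ED D' sub => [|x {}D xD _ Px _ IH] D' sub.
  by have -> : D' = set0 by [apply/eqP; rewrite -subset0]; apply: elim_refl.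
have sub' : D' :\ x \subset D.
  apply/subsetP => y; rewrite !inE => /andP[yx /(subsetP sub)].
  by rewrite !inE (negPf yx).
case: (boolP (x \in D')) => xD'; last first.
  apply: IH; apply/subsetP => y yD'; apply: (subsetP sub').
  by rewrite !inE yD' andbT; apply: contraNneq xD' => <-.
rewrite -(setD1K xD'); apply: elim_step; rewrite ?sub0set ?setD11 //.
  exact: simplicialS Px.
exact: IH.
Qed.

(** Dirac's argument. If the first eliminated vertex x is in the clique, the rest of
the clique lies in the neighbourhood of x, itself a clique. By induction some vertex
outside this neighbourhood is simplicial in the graph without x, hence in the whole
graph since it is not adjacent to x. If every vertex is adjacent to x the graph is
complete. *)
Lemma simplicial_outside_clique D Q : elim simplicial set0 D -> Q \subset D ->
  clique Q -> Q != D -> exists u, [/\ u \in D, u \notin Q & simplicial u (D :\ u)].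
Proof.
move=> ED; elim: ED Q => [|x {}D xD _ Px _ IH] Q QD Qc nQD.
  by move: QD nQD; rewrite subset0 => ->.
have DxE : (x |: D) :\ x = D by rewrite setU1K.
case: (boolP (x \in Q)) => xQ; last first.
  by exists x; split=> //; rewrite ?setU11 // DxE.
set N := [set y in D | e x y].
have QN y : y \in Q -> y != x -> y \in N.
  move=> yQ yx; rewrite inE (Qc x y) // 1?eq_sym // andbT.
  by have := subsetP QD _ yQ; rewrite !inE (negPf yx).
have [NE|ND] := eqVneq N D.
  have [u uD uQ] : exists2 u, u \in x |: D & u \notin Q.
    by apply/subsetPn; apply: contra nQD => h; rewrite eqEsubset QD.
  exists u; split=> // y z; rewrite !inE.
  have full v : v \in D -> e x v by rewrite -NE inE => /andP[].
  move=> /andP[/andP[yu /orP[/eqP->|yD]] uy] /andP[/andP[zu /orP[/eqP->|zD]] uz];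
    rewrite ?eqxx // => yz; try by [apply: full | rewrite e_sym; apply: full].
  by apply: Px => //; rewrite inE ?yD ?zD full.
have ND' : N \subset D by apply/subsetP => y; rewrite inE => /andP[].
have [u [uD uN us]] := IH N ND' Px ND.
have ux : u != x by apply: contraNneq xD => <-.
exists u; split.
- by rewrite !inE uD orbT.
- by apply: contra uN => uQ; apply: QN.
have nux v : e u v -> v != x.
  by move=> uv; apply: contraNneq uN => vx; rewrite inE uD e_sym -vx.
move=> y z; rewrite !inE => /andP[/andP[yu yD] uy] /andP[/andP[zu zD] uz].
apply: us; rewrite !inE ?yu ?zu ?uy ?uz ?andbT.
  by move: yD; rewrite (negPf (nux _ uy)).
by move: zD; rewrite (negPf (nux _ uz)).
Qed.

(** A chordal graph has a perfect elimination order ending with any prescribed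
clique. *)
Lemma simplicial_elim_to_clique D Q : elim simplicial set0 D -> Q \subset D ->
  clique Q -> elim simplicial Q D.
Proof.
have [n] := ubnP #|D|; elim: n D => // n IH D.
rewrite ltnS => Dn ED QD Qc.
have [->|QD'] := eqVneq Q D; first exact: elim_refl.
have [u [uD uQ us]] := simplicial_outside_clique ED QD Qc QD'.
have QDu : Q \subset D :\ u by rewrite subsetD1 QD.
rewrite -(setD1K uD); apply: elim_step => //; first by rewrite setD11.
apply: IH => //.
  by apply: leq_trans Dn; rewrite [leqRHS](cardsD1 u) uD.
exact: simplicial_elimS (subD1set _ _) ED.
Qed.

End Simplicial.

Section Colouring.
Variables (C : finType) (e : rel T) (col : T -> T -> C) (W : {set T}).
Hypothesis e_sym : symmetric e.
Hypothesis e_irr : irreflexive e.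
Hypothesis col_sym : forall x y, col x y = col y x.

Definition colours D : {set C} :=
  [set c | [exists x, exists y, [&& x \in D, y \in D, e x y & col x y == c]]].

Lemma coloursP D c : reflect
  (exists x y, [/\ x \in D, y \in D, e x y & col x y = c]) (c \in colours D).
Proof.
rewrite inE; apply: (iffP existsP) => -[x].
  by move=> /existsP[y /and4P[xD yD xy /eqP]]; exists x, y.
move=> [y [xD yD xy xyc]]; exists x.
by apply/existsP; exists y; rewrite xD yD xy xyc eqxx.
Qed.

Lemma coloursS D D' : D \subset D' -> colours D \subset colours D'.
Proof.
move=> /subsetP DD'; apply/subsetP => c /coloursP[x [y [xD yD xy xyc]]].
by apply/coloursP; exists x, y; rewrite !DD'.
Qed.

Hypothesis disjoint_edges : forall x y z w, x \in W -> y \in W -> z \in W ->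
  w \in W -> e x y -> e z w -> col x y = col z w ->
  [|| x == z, x == w, y == z | y == w].
Hypothesis adjacent_edges : forall x y z, x \in W -> y \in W -> z \in W ->
  e x y -> e x z -> y != z -> col x y = col x z ->
  e y z /\ col y z != col x y.
Hypothesis few_colours : forall D, D \subset W -> D != set0 -> #|colours D| < #|D|.
Hypothesis W_gt1 : 1 < #|W|.
Hypothesis many_colours : #|W| <= #|colours W|.+1.
Hypothesis many_colours1 : forall v, v \in W -> #|W :\ v| <= #|colours (W :\ v)|.+1.

(** With m vertices W spans m - 1 colours, and m - 2 without v. *)
Lemma private_colour_exists v : v \in W ->
  exists c, colours W :\: colours (W :\ v) = [set c].
Proof.
move=> vW; apply/cards1P; rewrite cardsDS; last exact/coloursS/subD1set.
have W0 : W != set0 by apply: contraTneq W_gt1 => ->; rewrite cards0.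
have Wv0 : W :\ v != set0.
  by move: W_gt1; rewrite (cardsD1 v) vW ltnS card_gt0.
have := few_colours (subxx _) W0; have := few_colours (subD1set W v) Wv0.
have := many_colours; have := many_colours1 vW; rewrite (cardsD1 v W) vW.
by move=> *; apply/eqP; lia.
Qed.

Definition private_colour v : option C := [pick c in colours W :\: colours (W :\ v)].

Lemma private_colourP v c : v \in W ->
  (private_colour v == Some c) = (c \in colours W) && (c \notin colours (W :\ v)).
Proof.
move=> vW; have [d dE] := private_colour_exists vW.
have -> : (c \in colours W) && (c \notin colours (W :\ v)) = (c == d).
  by rewrite andbC -in_setD dE in_set1.
rewrite /private_colour; case: pickP => [b|/(_ d)]; rewrite dE in_set1 ?eqxx // => /eqP->.
exact: eq_sym.
Qed.

Lemma private_colour_edge v x y : v \in W -> x \in W -> y \in W -> e x y ->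
  private_colour v = Some (col x y) -> v = x \/ v = y.
Proof.
move=> vW xW yW xy /eqP; rewrite private_colourP // => /andP[_ nc].
have [->|xv] := eqVneq x v; first by left.
have [->|yv] := eqVneq y v; first by right.
by case/coloursP: nc; exists x, y; rewrite !inE xv yv.
Qed.

(** A colour class is a star, and its centre is a vertex whose removal destroys
the colour. *)
Lemma edge_private_colour u w : u \in W -> w \in W -> e u w ->
  private_colour u = Some (col u w) \/ private_colour w = Some (col u w).
Proof.
move=> uW wW uw.
have cW : col u w \in colours W by apply/coloursP; exists u, w.
have [/eqP|nu] := boolP (private_colour u == Some (col u w)); first by left.
have [/eqP|nw] := boolP (private_colour w == Some (col u w)); first by right.
move: nu nw; rewrite !private_colourP // cW /= !negbK.
(* Two edges of the colour avoiding u and w respectively would form with uw a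
   monochromatic triangle. *)
move=> /coloursP[x [y [xW' yW' xy xyc]]] /coloursP[z [t [zW' tW' zt ztc]]].
have star v v' p q : v \in W -> v' \in W -> e v v' -> col v v' = col u w ->
    p \in W :\ v -> q \in W :\ v -> e p q -> col p q = col u w ->
    exists2 r, r != v & [/\ r \in W, e v' r & col v' r = col u w].
  move=> vW v'W vv' vc; rewrite !inE => /andP[pv pW] /andP[qv qW] pq pqc.
  have := disjoint_edges vW v'W pW qW vv' pq (etrans vc (esym pqc)).
  rewrite eq_sym (negPf pv) eq_sym (negPf qv) /= => /orP[]/eqP v'E.
    by exists q => //; rewrite v'E.
  by exists p => //; rewrite v'E e_sym col_sym.
have [r ru [rW wr rc]] := star u w x y uW wW uw erefl xW' yW' xy xyc.
have [||s sw [sW us sc]] := star w u z t wW uW _ _ zW' tW' zt ztc.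
- by rewrite e_sym.
- by rewrite col_sym.
have rw : r != w by apply: contraTneq wr => ->; rewrite e_irr.
have su : s != u by apply: contraTneq us => ->; rewrite e_irr.
have := disjoint_edges wW rW uW sW wr us (etrans rc (esym sc)).
have wu : w != u by apply: contraTneq uw => ->; rewrite e_irr.
rewrite (negPf wu) [w == s]eq_sym (negPf sw) (negPf ru) /= => /eqP rs.
have [|_] := adjacent_edges uW wW sW uw us _ (esym sc); first by rewrite eq_sym.
by rewrite -rs rc eqxx.
Qed.

(** An arc leaves u along the edges of its private colour; an edge that is
private to both its ends is directed by an arbitrary rank. Both directions would
make a cycle of length two. *)
Definition arc u w := [&& e u w, private_colour u == Some (col u w) &
  ~~ ((private_colour u == private_colour w) && (enum_rank w < enum_rank u))].

Lemma edge_arc u w : u \in W -> w \in W -> e u w -> arc u w || arc w u.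
Proof.
move=> uW wW uw; rewrite /arc [e w u]e_sym uw [col w u]col_sym /=.
have [->|->] := edge_private_colour uW wW uw; rewrite eqxx /= [Some _ == _]eq_sym;
  case: (_ == _) => //=; rewrite ?orbT // -!leqNgt; exact: leq_total.
Qed.

Lemma arc_col u w z : arc u w -> arc u z -> col u w = col u z.
Proof. by move=> /and3P[_ /eqP pu _] /and3P[_ /eqP]; rewrite pu => -[]. Qed.

(** If every vertex of D had an arc inside D, these arcs would carry pairwise
distinct colours, more than D can have. *)
Lemma arc_sinks D : D \subset W -> D != set0 ->
  exists2 x, x \in D & forall y, y \in D -> ~~ arc x y.
Proof.
move=> DW D0; apply: boolp.contrapT => nosink.
have out x : x \in D -> exists2 y, y \in D & arc x y.
  move=> xD; apply: boolp.contrapT => no; apply: nosink; exists x => // y yD.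
  by apply/negP => xy; apply: no; exists y.
have pinj : {in D &, injective private_colour}.
  move=> a b aD bD pab.
  have back c d : c \in D -> d \in D -> private_colour c = private_colour d ->
      arc c d \/ c = d.
    move=> cD dD pcd; have [f fD cf] := out _ cD.
    have [cf' /eqP pc _] := and3P cf; have W' := subsetP DW.
    have := @private_colour_edge d c f (W' _ dD) (W' _ cD) (W' _ fD) cf'.
    by rewrite -pcd => /(_ pc)[->|->]; [right|left].
  have [] := back a b aD bD pab; last by [].
  have [] := back b a bD aD (esym pab); last by [].
  rewrite /arc pab !eqxx /= -!leqNgt => /and3P[_ _ ba] /and3P[_ _ ab].
  by apply/enum_rank_inj/ord_inj/eqP; rewrite eqn_leq ba ab.
have := few_colours DW D0; rewrite ltnNge -(card_in_imset pinj) => /negP; apply.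
rewrite -(card_imset _ (Some_inj : injective (@Some C))); apply: subset_leq_card.
apply/subsetP => _ /imsetP[x xD ->]; have [y yD] := out _ xD.
move=> /and3P[xy /eqP-> _]; apply: imset_f; apply/coloursP.
by exists x, y.
Qed.

End Colouring.

(** When third edges have smaller colours, private colours do not increase along
arcs: if uw and ux have the private colour of u, then wx has a smaller colour,
which is private to w, or private to x and then a bound for that of w by
induction. *)
Lemma private_colour_monotone N (e : rel T) (col : T -> T -> 'I_N) (W : {set T}) :
  symmetric e -> irreflexive e -> (forall x y, col x y = col y x) ->
  (forall x y z w, x \in W -> y \in W -> z \in W ->
  w \in W -> e x y -> e z w -> col x y = col z w ->
  [|| x == z, x == w, y == z | y == w]) ->
  (forall x y z, x \in W -> y \in W -> z \in W ->
  e x y -> e x z -> y != z -> col x y = col x z ->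
  e y z /\ col y z < col x y) ->
  (forall D, D \subset W -> D != set0 -> #|colours e col D| < #|D|) ->
  1 < #|W| -> #|W| <= #|colours e col W|.+1 ->
  (forall v, v \in W -> #|W :\ v| <= #|colours e col (W :\ v)|.+1) ->
  forall u w, u \in W -> w \in W -> e u w ->
  private_colour e col W u = Some (col u w) ->
  exists2 c, private_colour e col W w = Some c & c <= col u w.
Proof.
move=> e_sym e_irr col_sym disj adj few W1 many many1.
have adj' x y z : x \in W -> y \in W -> z \in W ->
    e x y -> e x z -> y != z -> col x y = col x z ->
    e y z /\ col y z != col x y.
  move=> xW yW zW xy xz yz c; have [h l] := adj _ _ _ xW yW zW xy xz yz c.
  by split=> //; apply: contraTneq l => ->; rewrite ltnn.
have ep := edge_private_colour e_sym e_irr col_sym disj adj' few W1 many many1.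
have pP := private_colourP few W1 many many1.
have pE := private_colour_edge few W1 many many1.
move=> u w; have [n] := ubnP (col u w); elim: n u w => // n IH u w.
rewrite ltnS => cn uW wW uw pu.
have [pw|/eqP npw] := eqVneq (private_colour e col W w) (Some (col u w)).
  by exists (col u w).
have [x [xw xW ux xc]] : exists x, [/\ x != w, x \in W, e u x & col u x = col u w].
  have : col u w \in colours e col (W :\ w).
    have cW : col u w \in colours e col W by apply/coloursP; exists u, w.
    by apply/negPn/negP => nc; apply/npw/eqP; rewrite pP // cW.
  case/coloursP=> x [y [+ + xy xyc]]; rewrite !inE => /andP[xw xW] /andP[yw yW].
  have [|ux|uy] := pE u x y uW xW yW xy; first by rewrite xyc.
    by subst x; exists y.
  by subst y; exists x; rewrite e_sym col_sym.
have wx : w != x by rewrite eq_sym.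
have [wx' lt] := adj u w x uW wW xW uw ux wx (esym xc).
have [pw|px] := ep w x wW xW wx'; first by exists (col w x); rewrite // ltnW.
have [|||c pc cle] := IH x w _ xW wW; first by rewrite col_sym; apply: leq_trans lt cn.
- by rewrite e_sym.
- by rewrite [col x w]col_sym.
exists c => //; apply: leq_trans cle _; rewrite col_sym; exact: ltnW.
Qed.

End EliminationOrders.

(** * Blocks as vertex sets *)

Section Blocks.
Local Open Scope nat_scope.
Variables (T : finType) (G : graph T).
Implicit Types (B : graph T) (D : {set T}).

Definition inside D : rel T := [rel a b | [&& a \in D, b \in D & edge G a b]].

Definition outside D : rel T :=
  [rel a b | edge G a b && ~~ ((a \in D) && (b \in D))].

Definition connected_set D := forall x y, x \in D -> y \in D ->
  connect (inside D) x y.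

Definition nonseparable_set D :=
  [/\ D != set0, connected_set D & forall v, connected_set (D :\ v)].

(** Blocks are induced subgraphs, so that only their vertex sets matter. *)
Definition block_set D := nonseparable_set D /\
  forall D', nonseparable_set D' -> D \subset D' -> D' \subset D.

Lemma connect_const (U : Type) (f : T -> U) (e : rel T) x y :
  (forall a b, e a b -> f a = f b) -> connect e x y -> f x = f y.
Proof.
move=> ef /connectP[p + ->]; elim: p x => //= z p IH x /andP[/ef-> /IH].
exact.
Qed.

Lemma inside_sym D : symmetric (inside D).
Proof. by move=> x y; rewrite /inside /= edge_sym andbCA. Qed.

Lemma outside_sym D : symmetric (outside D).
Proof. by move=> x y; rewrite /outside /= edge_sym [(y \in D) && _]andbC. Qed.

Lemma inside_irr D : irreflexive (inside D).
Proof. by move=> x; rewrite /inside /= edge_irr !andbF. Qed.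

Lemma inside_vertices D x y : inside D x y -> x \in D.
Proof. by case/and3P. Qed.

Definition induced D : graph T :=
  Graph (@inside_sym D) (@inside_irr D) (@inside_vertices D).

Lemma connect_insideS D D' x y : D \subset D' -> connect (inside D) x y ->
  connect (inside D') x y.
Proof.
move=> /subsetP DD'; apply: connect_sub => a b /and3P[aD bD ab].
by apply: connect1; rewrite /inside /= !DD'.
Qed.

Lemma connected_setU D D' : connected_set D -> connected_set D' ->
  (D' != set0 -> exists2 z, z \in D & z \in D') -> connected_set (D :|: D').
Proof.
move=> cD cD' meet.
have [->|D'0] := eqVneq D' set0; first by rewrite setU0.
have [z zD zD'] := meet D'0.
suff toz x : x \in D :|: D' -> connect (inside (D :|: D')) x z.
  move=> x y /toz xz /toz yz; apply: connect_trans xz _.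
  by rewrite (sym_connect_sym (@inside_sym _)).
rewrite inE => /orP[xD|xD'].
  by apply: connect_insideS (subsetUl _ _) _; apply: cD.
by apply: connect_insideS (subsetUr _ _) _; apply: cD'.
Qed.

Lemma connected_set_sorted (s : seq T) : sorted (edge G) s ->
  connected_set [set z in s].
Proof.
case: s => [_ x y|x s /= xs]; first by rewrite inE.
set D := [set z in _].
have pth : path (inside D) x s.
  apply: (@sub_in_path _ (mem D) (edge G)) xs; last first.
    by apply/allP => y ys; change (y \in D); rewrite inE.
  by move=> a b aD bD ab; rewrite /inside /= ab andbT; apply/andP.
move=> y z; rewrite !inE => /(path_connect pth) xy /(path_connect pth).
by apply: connect_trans; rewrite (sym_connect_sym (@inside_sym _)).
Qed.

Lemma nonseparable_block_vertices B : subgraph B G -> nonseparable B ->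
  nonseparable_set (vertices B).
Proof.
move=> [_ BG] [[[x xB] Bconn] Bcut].
have sub D (e : rel T) : subrel e (inside D) -> subrel (connect e) (connect (inside D)).
  by move=> h; apply: connect_sub => a b /h; apply: connect1.
have Bin a b : edge B a b -> inside (vertices B) a b.
  move=> ab; rewrite /inside /= (edge_vertices ab) (BG _ _ ab) andbT.
  by move: ab; rewrite edge_sym; apply: edge_vertices.
split; first by apply/set0Pn; exists x.
  by move=> a b aB bB; apply: sub (Bconn _ _ aB bB).
move=> v a b; rewrite !inE => /andP[av aB] /andP[bv bB].
have [vB|vB] := boolP (v \in vertices B); last first.
  have -> : vertices B :\ v = vertices B.
    by apply/setP => z; rewrite !inE; case: eqVneq => // ->; rewrite (negPf vB).
  by apply: sub (Bconn _ _ aB bB).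
set e := [rel c d | [&& edge B c d, c != v & d != v]].
have [cab|ncab] := boolP (connect e a b).
  apply: sub cab => c d /and3P[cd cv dv]; rewrite /inside /= !inE cv dv /=.
  exact: Bin.
case: (Bcut v); split=> //; exists a, b; split=> //; split=> //.
exact: Bconn.
Qed.

Lemma nonseparable_induced D : nonseparable_set D -> nonseparable (induced D).
Proof.
move=> [/set0Pn[x xD] Dc Dv]; split; first by split; [exists x | exact: Dc].
move=> v [vD [a [b [aD bD av bv [_ /negP]]]]]; apply.
have := Dv v a b; rewrite !inE av bv => /(_ aD bD).
apply: connect_sub => c d; rewrite /inside /= !inE.
move=> /and3P[/andP[cv cD] /andP[dv dD] cd]; apply: connect1.
by rewrite /= /inside /= cD dD cd cv dv.
Qed.

Hypothesis GT : forall x, x \in vertices G.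

Lemma induced_subgraph D : subgraph (induced D) G.
Proof. by split=> [x _|x y /and3P[]]. Qed.

Lemma is_block_set B : is_block G B ->
  block_set (vertices B) /\ edge B =2 inside (vertices B).
Proof.
move=> [BG Bns Bmax].
have BD D : nonseparable_set D -> vertices B \subset D -> subgraph (induced D) B.
  move=> Dns /subsetP BD; apply: Bmax; first exact: induced_subgraph.
    exact: nonseparable_induced.
  split=> // x y xy; rewrite /= /inside /= (BG.2 _ _ xy) (BD _ (edge_vertices xy)) BD //.
  by move: xy; rewrite edge_sym; apply: edge_vertices.
have Bs := nonseparable_block_vertices BG Bns.
split; first by split=> // D Dns /(BD _ Dns)[h _]; apply/subsetP.
move=> x y; apply/idP/idP; last by have [_] := BD _ Bs (subxx _); apply.
move=> xy; rewrite /inside /= (edge_vertices xy) (BG.2 _ _ xy) andbT.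
by move: xy; rewrite edge_sym; apply: edge_vertices.
Qed.

Lemma block_set_induced D : block_set D -> is_block G (induced D).
Proof.
move=> [Dns Dmax]; split; [exact: induced_subgraph|exact: nonseparable_induced|].
move=> B BG Bns [/= DB _].
have BD : vertices B \subset D.
  by apply: Dmax; [apply: nonseparable_block_vertices | apply/subsetP].
split; first exact/subsetP.
move=> x y xy; rewrite /= /inside /= (subsetP BD _ (edge_vertices xy)).
rewrite (BG.2 _ _ xy) andbT.
by apply: (subsetP BD); move: xy; rewrite edge_sym; apply: edge_vertices.
Qed.

(** Whichever vertex is removed, one of the two common vertices remains. *)
Lemma nonseparable_setU D D' x y : nonseparable_set D -> nonseparable_set D' ->
  x != y -> x \in D -> y \in D -> x \in D' -> y \in D' ->
  nonseparable_set (D :|: D').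
Proof.
move=> [_ Dc Dv] [_ D'c D'v] xy xD yD xD' yD'; split.
- by apply/set0Pn; exists x; rewrite inE xD.
- by apply: connected_setU => // _; exists x.
move=> v; rewrite setDUl; apply: connected_setU => // _.
have [<-|xv] := eqVneq x v; [exists y|exists x]; by rewrite !inE ?xv 1?eq_sym ?xy.
Qed.

Lemma block_set_eq D D' x y : block_set D -> block_set D' ->
  x != y -> x \in D -> y \in D -> x \in D' -> y \in D' -> D = D'.
Proof.
move=> [Dns Dmax] [D'ns D'max] xy xD yD xD' yD'.
have U := nonseparable_setU Dns D'ns xy xD yD xD' yD'.
apply/eqP; rewrite eqEsubset; apply/andP; split.
  by apply: subset_trans (subsetUl _ _) (D'max _ U (subsetUr _ _)).
by apply: subset_trans (subsetUr _ _) (Dmax _ U (subsetUl _ _)).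
Qed.

Lemma edge_block x y : edge G x y ->
  exists D, [/\ block_set D, x \in D & y \in D].
Proof.
move=> xy; have xny : x != y by apply: contraTneq xy => ->; rewrite edge_irr.
have ns2 : nonseparable_set [set x; y].
  have c1 z : connected_set [set z].
    by move=> a b /set1P-> /set1P->; apply: connect0.
  split; first by apply/set0Pn; exists x; rewrite !inE eqxx.
    move=> a b aD bD; have [->|ab] := eqVneq a b; first exact: connect0.
    apply: connect1; rewrite /inside /= aD bD; move: aD bD ab; rewrite !inE.
    by move=> /orP[]/eqP-> /orP[]/eqP->; rewrite ?eqxx // edge_sym.
  move=> v a b; rewrite !inE => /andP[av aD] /andP[bv bD].
  have [->|ab] := eqVneq a b; first exact: connect0.
  apply: connect1; rewrite /inside /= !inE av bv aD bD /=; move: aD bD ab.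
  by move=> /orP[]/eqP-> /orP[]/eqP->; rewrite ?eqxx // edge_sym.
pose P D := boolp.asbool (nonseparable_set D).
have [D /maxsetP[/boolp.asboolP Dns Dmax] sub] :=
  maxset_exists (P := P) (introT (boolp.asboolP _) ns2).
exists D; split; last first.
- by apply: (subsetP sub); rewrite !inE eqxx orbT.
- by apply: (subsetP sub); rewrite !inE eqxx.
split=> // D' D'ns DD'; rewrite (Dmax D' _ DD') //.
exact/boolp.asboolP.
Qed.

(** A path joining two vertices of a block outside the block is an ear: adding
it would keep the block nonseparable. *)
Lemma block_separates D x y : block_set D -> x \in D -> y \in D -> x != y ->
  ~~ connect (outside D) x y.
Proof.
move=> [Dns Dmax] xD yD xy; apply/negP => /connectP[p0 p0p yE].
move: xy yD; rewrite {}yE {y}; case/shortenP: p0p => p xp up _ xy yD.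
set s := x :: p; set y := last x p in xy yD.
have sG : sorted (edge G) s by apply: sub_path xp => a b /andP[].
have nsU : nonseparable_set (D :|: [set z in s]).
  have [_ Dc Dv] := Dns; split.
  - by apply/set0Pn; exists x; rewrite inE xD.
  - apply: connected_setU; [exact: Dc | exact: connected_set_sorted|].
    by move=> _; exists x; rewrite // inE mem_head.
  move=> v; have [vs|vs] := boolP (v \in s); last first.
    have -> : (D :|: [set z in s]) :\ v = (D :\ v) :|: [set z in s].
      apply/setP => z; rewrite !inE; case: eqVneq => //= ->.
      by move: vs; rewrite inE => /negPf->.
    apply: connected_setU; [exact: Dv | exact: connected_set_sorted|].
    move=> _; exists x; last by rewrite inE mem_head.
    by rewrite !inE xD andbT; apply: contraNneq vs => <-; rewrite mem_head.
  have [s1 [s2 E]] : exists s1 s2, s = s1 ++ v :: s2.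
    by case/splitPr: vs => s1 s2; exists s1, s2.
  have [s1G vs2G] : sorted (edge G) s1 * sorted (edge G) (v :: s2).
    by apply: cat_sorted2; rewrite -E.
  have s2G := path_sorted vs2G.
  have us : uniq (s1 ++ v :: s2) by rewrite -E.
  move: us; rewrite cat_uniq /= negb_or => /and4P[_ /andP[vs1 _] vs2 _].
  have -> : (D :|: [set z in s]) :\ v =
      ((D :\ v) :|: [set z in s1]) :|: [set z in s2].
    apply/setP => z; rewrite E !inE mem_cat in_cons; case: eqVneq => /= [->|_].
      by rewrite (negPf vs1) (negPf vs2).
    by rewrite orbA.
  apply: connected_setU; last first.
  - case: s2 E vs2 {s2G vs2G} => [|a s2] E vs2 /set0Pn[w]; first by rewrite !inE.
    move=> _; have ys : y \in a :: s2.
      have -> : y = last x s by [].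
      by rewrite E last_cat /= mem_last.
    exists y; last by rewrite inE.
    rewrite !inE yD andbT; apply/orP; left.
    by apply: contraNneq vs2 => <-.
  - exact: connected_set_sorted.
  apply: connected_setU; [exact: Dv | exact: connected_set_sorted|].
  case: s1 E vs1 {s1G} => [|a s1] E vs1 /set0Pn[w]; first by rewrite !inE.
  move=> _; exists x; last by move: E => [-> _]; rewrite !inE eqxx.
  rewrite !inE xD andbT; apply: contraNneq vs1 => <-.
  by move: E => [-> _]; rewrite mem_head.
have sD := subsetP (Dmax _ nsU (subsetUl _ _)).
have sD' z : z \in s -> z \in D by move=> zs; apply: sD; rewrite !inE -in_cons zs orbT.
move: xp sD' xy; rewrite /y /s; case: (p) => [|z q]; first by rewrite eqxx.
by move=> /= /andP[/andP[_ /negP h] _] sD' _; case: h; rewrite !sD' // !inE eqxx ?orbT.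
Qed.

End Blocks.

From mathcomp Require Import finmap.

(** * Admissible orderings from colourings *)

Section Admissibility.
Local Open Scope nat_scope.
Variables (K : fieldType) (T : finType) (G : graph T) (S : T -> T -> {fset K}).
Hypothesis hS : gain_sets G S.
Implicit Types (B : graph T) (D W : {set T}).

(** The condition that an admissible ordering puts on a vertex x and the set D of
the later ones. *)
Definition gain_simplicial x D := forall y z, y \in D -> z \in D -> y != z ->
  forall a b : K, a \in S x z -> b \in S x y -> (a - b)%R \in S y z.

Lemma mem_gain_edge x y (a : K) : x != y -> a \in S x y -> edge G x y.
Proof. by move=> xy aS; rewrite -(hS xy).2; apply/fset0Pn; exists a. Qed.

Lemma elim_admissible B : edge B =2 inside G (vertices B) ->
  elim gain_simplicial set0 (vertices B) ->
  exists m (v : 'I_m -> T), admissible_ordering B (restrict_gains B S) v.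
Proof.
move=> BE /elim_seq[s [us sB Ps]].
exists (size s), (tnth (in_tuple s)); split.
- by apply/tuple_uniqP.
- move=> x; rewrite -sB; split=> [xs|[k ->]]; last exact: mem_tnth.
  have /tnthP[k ->] : x \in in_tuple s by [].
  by exists k.
move=> k i j ki kj ij; apply/fsubsetP => c /imfset2P[a aS [b bS ->]].
move: aS bS; rewrite /restrict_gains /=.
case: ifP => // kj' aS; case: ifP => // ki' bS.
have vE r : tnth (in_tuple s) r = nth (tnth (in_tuple s) k) s r.
  by rewrite (tnth_nth (tnth (in_tuple s) k)).
set x := tnth _ k in aS bS kj' ki' vE *.
set y := tnth _ i in bS ki' *; set z := tnth _ j in aS kj' *.
have later r : k < r -> r < size s -> nth x s r \in [set t in drop k.+1 s].
  move=> kr rs; rewrite inE -(subnKC kr) -nth_drop; apply: mem_nth.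
  by rewrite size_drop ltn_sub2r // (leq_ltn_trans kr).
have yz : y != z.
  by rewrite /y /z (inj_eq (tuple_uniqP (in_tuple s) us)).
have P : gain_simplicial x [set t in drop k.+1 s].
  have xE : nth x s k = x := esym (vE k).
  apply: (Ps (take k s)); rewrite -[LHS](cat_take_drop k s).
  by rewrite (drop_nth x (ltn_ord k)) xE.
have yzS : (a - b)%R \in S y z.
  by apply: P => //; rewrite /y /z vE; apply: later.
suff -> : edge B y z by [].
have inB r : tnth (in_tuple s) r \in vertices B by rewrite -sB mem_tnth.
by rewrite BE /inside /= !inB (mem_gain_edge yz yzS).
Qed.

Lemma elim_small P W : (forall x : T, P x set0) -> #|W| <= 1 -> elim P set0 W.
Proof.
move=> P0; rewrite leq_eqVlt ltnS leqn0 cards_eq0.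
move=> /orP[/cards1P[x ->]|/eqP->]; last exact: elim_refl.
rewrite -[[set x]]setU0; apply: elim_step; rewrite ?inE ?sub0set //.
exact: elim_refl.
Qed.

(** What a nice partition and a modular chain both provide: a colouring of the
edges in which every connected vertex set spans the right number of colours. *)
Definition rank_colouring (C : finType) (col : T -> T -> C) :=
  [/\ forall x y, col x y = col y x,
      forall x y z w, edge G x y -> edge G z w -> col x y = col z w ->
        [|| x == z, x == w, y == z | y == w],
      forall D, D != set0 -> #|colours (edge G) col D| < #|D| &
      forall D, D != set0 -> connected_set G D ->
        #|D| <= #|colours (edge G) col D|.+1].

Section Blocks.
Variables (C : finType) (col : T -> T -> C).
Hypothesis hcol : rank_colouring col.
Hypothesis third_edge : forall x y z, edge G x y -> edge G x z -> y != z ->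
  col x y = col x z -> edge G y z /\ col y z != col x y.
Variable W : {set T}.
Hypothesis Wns : nonseparable_set G W.
Hypothesis W1 : 1 < #|W|.

Let many : #|W| <= #|colours (edge G) col W|.+1.
Proof. by have [_ _ _ h] := hcol; have [? ? _] := Wns; apply: h. Qed.

Let many1 v : v \in W -> #|W :\ v| <= #|colours (edge G) col (W :\ v)|.+1.
Proof.
have [_ _ _ h] := hcol; have [? ? Wv] := Wns => vW; apply: h; last exact: Wv.
by move: W1; rewrite (cardsD1 v) vW ltnS card_gt0.
Qed.

Let few D : D \subset W -> D != set0 -> #|colours (edge G) col D| < #|D|.
Proof. by have [_ _ h _] := hcol => _; apply: h. Qed.

Let disj x y z w : x \in W -> y \in W -> z \in W ->
  w \in W -> edge G x y -> edge G z w -> col x y = col z w ->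
  [|| x == z, x == w, y == z | y == w].
Proof. by have [_ h _ _] := hcol => _ _ _ _; apply: h. Qed.

Let adj x y z : x \in W -> y \in W -> z \in W ->
  edge G x y -> edge G x z -> y != z -> col x y = col x z ->
  edge G y z /\ col y z != col x y.
Proof. by move=> _ _ _; apply: third_edge. Qed.

Let csym := let: And4 h _ _ _ := hcol in h.

Definition block_arc := arc (edge G) col W.

Lemma block_arc_sinks D : D \subset W -> D != set0 ->
  exists2 x, x \in D & forall y, y \in D -> ~~ block_arc x y.
Proof. exact: (arc_sinks few W1 many many1). Qed.

Lemma block_edge_arc x y : x \in W -> y \in W -> edge G x y ->
  block_arc x y || block_arc y x.
Proof.
exact: (edge_arc (@edge_sym _ G) (@edge_irr _ G) csym disj adj few W1 many many1).
Qed.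

Lemma block_later_arc x y D : x \in W -> D \subset W -> y \in D ->
  (forall y, y \in D -> ~~ block_arc y x) -> edge G x y -> block_arc x y.
Proof.
move=> xW DW yD no xy; have := block_edge_arc xW (subsetP DW _ yD) xy.
by rewrite (negPf (no _ yD)) orbF.
Qed.

Lemma block_elim : (forall x y z, edge G x y -> edge G x z -> y != z ->
    col x y = col x z -> forall a b : K, a \in S x z -> b \in S x y ->
    (a - b)%R \in S y z) ->
  elim gain_simplicial set0 W.
Proof.
move=> closed; rewrite -[W]setU0; apply: (elim_of_sinks block_arc_sinks).
- move=> x D xW DW xD no y z yD zD yz a b aS bS.
  have neq t : t \in D -> x != t by move=> tD; apply: contraNneq xD => ->.
  have xz := mem_gain_edge (neq _ zD) aS.
  have xy := mem_gain_edge (neq _ yD) bS.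
  apply: (closed x y z) => //.
  exact: arc_col (block_later_arc xW DW yD no xy) (block_later_arc xW DW zD no xz).
- exact: subxx.
- exact: sub0set.
- by apply/pred0P => x; rewrite /= inE andbF.
- by move=> x y; rewrite inE.
Qed.

End Blocks.

End Admissibility.

From mathcomp Require Import boolp classical_sets functions cardinality.

(** * Affine sets, hyperplanes and codimension *)

Section AffineSets.
Import GRing.Theory.
Local Open Scope classical_set_scope.
Local Open Scope ring_scope.
Variables (K : fieldType) (V : vectType K).
Implicit Types (X Y H e f g : set V) (B : set (set V)) (p u x y : V).

Definition affine_closed X :=
  forall a x y z, X x -> X y -> X z -> X (x + a *: (y - z)).

(** Affine subspaces described without a base point or a direction, which makes
intersections of arbitrary families immediate. *)
Definition affine X := X !=set0 /\ affine_closed X.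

Definition hyperplane H := exists (f : V -> K) (c : K),
  [/\ scalar f, exists u, f u != 0 & H = [set x | f x = c]].

Lemma vspace_comprehension (P : V -> Prop) :
  P 0 -> (forall a u v, P u -> P v -> P (a *: u + v)) ->
  exists U : {vspace V}, forall u, u \in U <-> P u.
Proof.
move=> P0 Plin.
pose Q (n : nat) :=
  `[< exists U : {vspace V}, (forall u, u \in U -> P u) /\ \dim U = n >].
have Q0 : exists n, Q n.
  exists 0%N; apply/asboolP; exists 0%VS; split; last exact: dimv0.
  by move=> u; rewrite memv0 => /eqP->.
have Qle n : Q n -> (n <= \dim {:V})%N.
  by move=> /asboolP[U [_ <-]]; apply: dimvS; apply: subvf.
case: (ex_maxnP Q0 Qle) => n /asboolP[U [UP Un]] nmax.
exists U => u; split; first exact: UP.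
move=> Pu; set W := (U + <[u]>)%VS.
have WP w : w \in W -> P w.
  move=> /memv_addP[v vU [w' /vlineP[k ->] ->]].
  by rewrite addrC; apply: Plin => //; apply: UP.
have UW : (U <= W)%VS by apply: addvSl.
have : (\dim W <= n)%N by apply: nmax; apply/asboolP; exists W.
rewrite -Un => dWU; have /eqP -> : U == W by rewrite eqEdim UW.
by rewrite -[u]add0r; apply: memv_add; [apply: mem0v|apply: memv_line].
Qed.

Lemma affineT : affine setT.
Proof. by split; [exists 0 | ]. Qed.

Lemma hyperplane_affine H : hyperplane H -> affine H.
Proof.
move=> [f [c [fl [u fu] ->]]].
have f0 : f 0 = 0 by move: (fl (-1) u u); rewrite scaleN1r addNr mulN1r addNr.
have fZ a v : f (a *: v) = a * f v by rewrite -[a *: v]addr0 fl f0 addr0.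
split; first by exists ((c / f u) *: u); rewrite /= fZ divfK.
move=> a x y z /= fx fy fz.
have -> : x + a *: (y - z) = a *: y + ((- a) *: z + x).
  by rewrite scalerBr scaleNr addrC addrA.
by rewrite !fl fx fy fz mulNr addrA subrr add0r.
Qed.

Lemma affine_setI X Y : affine X -> affine Y -> X `&` Y !=set0 ->
  affine (X `&` Y).
Proof.
by move=> [_ Xc] [_ Yc] XY; split=> // a x y z [? ?] [? ?] [? ?]; split;
  [apply: Xc | apply: Yc].
Qed.

Lemma affine_bigcap B : (forall H, B H -> affine H) ->
  \bigcap_(H in B) H !=set0 -> affine (\bigcap_(H in B) H).
Proof.
move=> Ba nz; split=> // a x y z Bx By Bz H BH.
by have [_ Hc] := Ba _ BH; apply: Hc; [apply: Bx|apply: By|apply: Bz].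
Qed.

Lemma affine_line X p u v a : affine X -> X p -> X (p + u) -> X (p + v) ->
  X (p + (a *: u + v)).
Proof.
move=> [_ Xc] Xp Xu Xv; have := Xc a (p + v) (p + u) p Xv Xu Xp.
by rewrite [p + u]addrC addrK -addrA [v + _]addrC.
Qed.

Lemma directionP X p u : affine X -> X p -> (u \in direction X) <-> X (p + u).
Proof.
move=> Xa Xp; have [U UP] := @vspace_comprehension (fun w => X (p + w))
  (eq_ind_r X Xp (addr0 p)) (fun a u v Xu Xv => affine_line a Xa Xp Xu Xv).
suff -> : direction X = U by exact: UP.
rewrite -[RHS](direction_translate p); congr direction.
apply/seteqP; split=> [x Xx|_ [w wU <-]]; last exact/UP.
by exists (x - p); rewrite ?subrKC //=; apply/UP; rewrite subrKC.
Qed.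

(** The codimension depends on the direction alone, so X need not lie in Y. *)
Lemma codim_le X Y p q : affine X -> affine Y -> X p -> Y q ->
  (forall u, X (p + u) -> Y (q + u)) -> (codim Y <= codim X)%N.
Proof.
move=> Xa Ya Xp Yq XY; apply: leq_sub2l; apply: dimvS; apply/subvP => u.
by move=> /(directionP _ Xa Xp) Xu; apply/(directionP _ Ya Yq)/XY.
Qed.

Lemma codimS X Y : affine X -> affine Y -> X `<=` Y ->
  (codim Y <= codim X)%N.
Proof.
move=> Xa Ya XY; have [p Xp] := Xa.1; apply: (codim_le Xa Ya Xp (XY _ Xp)).
by move=> u; apply: XY.
Qed.

Lemma codim_eq X Y : affine X -> affine Y -> X `<=` Y ->
  (codim X <= codim Y)%N -> X = Y.
Proof.
move=> Xa Ya XY cXY; have [p Xp] := Xa.1; have Yp := XY _ Xp.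
have dXY : (direction X <= direction Y)%VS.
  by apply/subvP => u /(directionP _ Xa Xp) Xu; apply/(directionP _ Ya Yp)/XY.
have dXE : direction X = direction Y.
  apply/eqP; rewrite eqEdim dXY /=; move: cXY; rewrite /codim.
  have := dimvS (subvf (direction X)); have := dimvS (subvf (direction Y)); lia.
apply/seteqP; split=> // y Yy; rewrite -(subrKC p y).
by apply/(directionP _ Xa Xp); rewrite dXE; apply/(directionP _ Ya Yp);
  rewrite subrKC.
Qed.

Lemma codimT : codim [set: V] = 0%N.
Proof.
rewrite /codim; apply/eqP; rewrite subn_eq0; apply: dimvS; apply/subvP => u _.
by apply/(directionP _ affineT (I : [set: V] 0)).
Qed.

Lemma codim_le_dim X : (codim X <= dim V)%N.
Proof. by rewrite /codim dimvf leq_subr. Qed.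

Lemma scalar0 (f : V -> K) : scalar f -> f 0 = 0.
Proof. by move=> fl; move: (fl (-1) 0 0); rewrite scaleN1r addNr mulN1r addNr. Qed.

Lemma scalarZ (f : V -> K) a v : scalar f -> f (a *: v) = a * f v.
Proof. by move=> fl; rewrite -[a *: v]addr0 fl (scalar0 fl) addr0. Qed.

Lemma scalarD (f : V -> K) u v : scalar f -> f (u + v) = f u + f v.
Proof. by move=> fl; rewrite -[u]scale1r fl mul1r scale1r. Qed.

Lemma codim_hyperplaneI X H : affine X -> hyperplane H -> X `&` H !=set0 ->
  ~ X `<=` H -> codim (X `&` H) = (codim X).+1.
Proof.
move=> Xa Hh XH nXH; have Ha := hyperplane_affine Hh.
have XHa := affine_setI Xa Ha XH; have [p [Xp Hp]] := XH.
case: Hh => f [c [fl _ HE]]; have [_ cX] := Xa.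
have fp : f p = c by move: Hp; rewrite HE.
have /existsNP[q /not_implyP[Xq nHq]] : ~ forall q, X q -> H q by [].
set U := direction X; set W := direction (X `&` H); set w := q - p.
have wU : w \in U by apply/(directionP _ Xa Xp); rewrite subrKC.
have fw : f w != 0.
  apply/eqP => fw0; apply: nHq; rewrite HE /= -(subrKC p q).
  by rewrite scalarD // -/w fw0 addr0.
have WP u : u \in W <-> u \in U /\ f u = 0.
  rewrite (directionP _ XHa (conj Xp Hp)) (directionP _ Xa Xp).
  split=> [[Xu]|[Xu fu]].
    rewrite HE /= scalarD // fp => h; split=> //.
    by apply: (addrI c); rewrite h addr0.
  by split=> //; rewrite HE /= scalarD // fu addr0.
have UE : U = (W + <[w]>)%VS.
  apply/eqP; rewrite eqEsubv; apply/andP; split; last first.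
    rewrite subv_add; apply/andP; split; last by rewrite -memvE.
    by apply/subvP => u /WP[].
  apply/subvP => u uU; rewrite -(subrK ((f u / f w) *: w) u).
  apply: memv_add; last by apply/vlineP; exists (f u / f w).
  apply/WP; split; first by rewrite rpredB // rpredZ.
  by rewrite -scaleNr addrC fl mulNr divfK // addNr.
have WI : (W :&: <[w]> = 0)%VS.
  apply/eqP; rewrite -subv0; apply/subvP => u.
  rewrite memv_cap memv0 => /andP[/WP[_ fu] /vlineP[k uE]].
  move: fu; rewrite uE scalarZ // => /eqP; rewrite mulf_eq0 (negPf fw) orbF.
  by move=> /eqP->; rewrite scale0r.
have := dimv_disjoint_sum WI; rewrite -UE dim_vline.
have -> : w != 0 by apply: contraNneq fw => ->; rewrite scalar0.
have := dimvS (subvf U); rewrite /codim -/U -/W; lia.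
Qed.

Lemma codim_hyperplane H : hyperplane H -> codim H = 1%N.
Proof.
move=> Hh; have [[p Hp] _] := hyperplane_affine Hh.
rewrite -[H]setTI codim_hyperplaneI ?codimT //; [exact: affineT|by exists p|].
case: Hh => f [c [fl [u fu] HE]] TH; have := TH (p + u) I.
move: Hp; rewrite HE /= scalarD // => -> /eqP.
by rewrite -subr_eq0 addrAC subrr add0r (negPf fu).
Qed.

Lemma hyperplane_neqT H : hyperplane H -> H <> setT.
Proof. by move=> /codim_hyperplane h HT; move: h; rewrite HT codimT. Qed.

Lemma hyperplane_sub_eq H H' : hyperplane H -> hyperplane H' -> H `<=` H' ->
  H = H'.
Proof.
move=> h h' HH'; apply: codim_eq => //; try exact: hyperplane_affine.
by rewrite !codim_hyperplane.
Qed.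

(** In the pencil of hyperplanes through e and f, any two members determine the
base of the pencil. *)
Lemma pencil e f g : hyperplane e -> hyperplane f -> hyperplane g ->
  e <> f -> e <> g -> e `&` f !=set0 -> e `&` f `<=` g -> e `&` g `<=` f.
Proof.
move=> he hf hg ef eg ef0 efg.
have [ae af ag] := And3 (hyperplane_affine he) (hyperplane_affine hf)
  (hyperplane_affine hg).
have eg0 : e `&` g !=set0 by case: ef0 => p [ep fp]; exists p; split=> //;
  apply: efg.
suff -> : e `&` g = e `&` f by exact: subIsetr.
apply/esym; apply: codim_eq; try exact: affine_setI.
  by move=> x [ex fx]; split=> //; apply: efg.
rewrite !codim_hyperplaneI //.
  by move=> /(hyperplane_sub_eq he hg).
by move=> /(hyperplane_sub_eq he hf).
Qed.

(** For a hyperplane: u lies in its direction. *)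
Definition stable u X := forall x, X x -> X (x + u).

Lemma hyperplane_stable_dir H u x : hyperplane H -> H x -> H (x + u) ->
  stable u H.
Proof.
move=> [f [c [fl _ ->]]] /= fx fxu y /= fy; move: fxu.
by rewrite !scalarD // fx fy.
Qed.

Lemma hyperplane_meets_line H u x : hyperplane H -> ~ stable u H ->
  exists a, H (x + a *: u).
Proof.
move=> [f [c [fl _ ->]]] nst.
have fu : f u != 0.
  by apply/eqP => fu; apply: nst => y /=; rewrite scalarD // fu addr0.
exists ((c - f x) / f u); by rewrite /= scalarD // scalarZ // divfK // subrKC.
Qed.

Lemma hyperplane_stableZ H u a : hyperplane H -> stable u H -> stable (a *: u) H.
Proof.
move=> Hh st; have [[x Hx] Hc] := hyperplane_affine Hh.
apply: (hyperplane_stable_dir Hh Hx).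
have := Hc a x (x + u) x Hx (st _ Hx) Hx.
by rewrite [x + u]addrC addrK.
Qed.

Definition occupied B (rho : set V -> nat) (i : nat) : bool :=
  `[< exists2 H, B H & rho H = i >].

Definition levels_below B (rho : set V -> nat) (j : nat) : set (set V) :=
  [set H | B H /\ (rho H < j)%N].

(** Going up one level cuts the intersection by a single hyperplane e: another one
f of that level is implied by e and the lower hyperplane through their
intersection. The vector u moves the previous intersection along itself and across
e, which gives both nonemptiness and the drop of dimension by one. *)
Lemma rank_levels B (rho : set V -> nat) (N : nat) :
  (forall H, B H -> hyperplane H) ->
  (forall H, B H -> (rho H < N)%N) ->
  (forall e f, B e -> B f -> e <> f -> rho e = rho f ->
     e `&` f !=set0 /\ exists g, [/\ B g, (rho g < rho e)%N & e `&` f `<=` g]) ->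
  (forall e, B e -> exists u,
     (forall g, B g -> (rho g < rho e)%N -> stable u g) /\ ~ stable u e) ->
  \bigcap_(H in B) H !=set0 /\
  codim (\bigcap_(H in B) H) = (\sum_(i < N) occupied B rho i)%N.
Proof.
move=> Bh BN BP BJ.
suff step j : \bigcap_(H in levels_below B rho j) H !=set0 /\
    codim (\bigcap_(H in levels_below B rho j) H) =
    (\sum_(i < j) occupied B rho i)%N.
  have -> : B = levels_below B rho N; last first.
    case: (step N) => h1 ->; split=> //; apply: eq_bigr => i _; congr (nat_of_bool _).
    by apply/idP/idP => /asboolP[H]; [move=> BH|case=> BH _];
      move=> rH; apply/asboolP; exists H => //; split=> //; rewrite rH.
  by apply/seteqP; split=> [H BH|H []//]; split=> //; apply: BN.
elim: j => [|j [nz IH]].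
  have -> : \bigcap_(H in levels_below B rho 0) H = setT.
    by apply/seteqP; split=> // x _ H [].
  by rewrite big_ord0 codimT; split=> //; exists 0.
set Xj := \bigcap_(H in levels_below B rho j) H in nz IH *.
have Xja : affine Xj.
  by apply: affine_bigcap nz => H [BH _]; apply/hyperplane_affine/Bh.
rewrite big_ord_recr /=; case: (boolP (occupied B rho j)) => [/asboolP|] occ.
  case: occ => e Be re; have he := Bh _ Be.
  have [u [ul une]] := BJ _ Be; case: (nz) => p Xp.
  have Xl a : Xj (p + a *: u).
    move=> H [BH rH]; apply: hyperplane_stableZ => //; first exact: Bh.
      by apply: ul => //; rewrite re.
    exact: Xp.
  have [a ea] := hyperplane_meets_line p he une.
  have XE : \bigcap_(H in levels_below B rho j.+1) H = Xj `&` e.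
    apply/seteqP; split=> [x Bx|x [Xx ex] H [BH]].
      split; last by apply: Bx; split; rewrite // re.
      by move=> H [BH rH]; apply: Bx; split=> //; apply: leqW.
    rewrite ltnS leq_eqVlt => /orP[/eqP rH|rH]; last by apply: Xx.
    have [<-//|eH] := EM (e = H).
    have [eH0 [g [Bg rg eHg]]] := BP _ _ Be BH eH (etrans re (esym rH)).
    have eg : e <> g by move=> eg; move: rg; rewrite -eg ltnn.
    apply: (pencil he (Bh _ BH) (Bh _ Bg) eH eg eH0 eHg); split=> //.
    by apply: Xx; split; rewrite // -re.
  have Xe : Xj `&` e !=set0 by exists (p + a *: u).
  rewrite XE; split=> //; rewrite codim_hyperplaneI // ?IH ?addn1 // => Xje.
  apply: une; apply: (hyperplane_stable_dir he (Xje _ Xp)).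
  by apply: Xje; rewrite -[u]scale1r.
have -> : levels_below B rho j.+1 = levels_below B rho j.
  apply/seteqP; split=> H [BH rH]; split=> //; last exact: leqW.
  move: rH; rewrite ltnS leq_eqVlt => /orP[/eqP rH|//].
  by move: occ; rewrite /occupied; move=> /asboolP[]; exists H.
by rewrite addn0.
Qed.

End AffineSets.

(** * Modular chains and level functions *)

Section LevelFunctions.
Import GRing.Theory.
Local Open Scope classical_set_scope.
Local Open Scope ring_scope.
Variables (K : fieldType) (V : vectType K).
Implicit Types (X Y H e f g : set V) (A B : set (set V)) (rho : set V -> nat).

(** The first half of a level function is asked of arbitrary subfamilies, as the
rank formula is used for localizations. *)
Definition level_closed B rho := forall e f, B e -> B f -> e <> f ->
  rho e = rho f -> exists g, [/\ B g, (rho g < rho e)%N & e `&` f `<=` g].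

(** The levels of hyperplanes along a maximal modular chain have these two
properties, and they characterize supersolvability. *)
Definition level_function A rho := level_closed A rho /\
  forall e, A e -> ~ \bigcap_(g in levels_below A rho (rho e)) g `<=` e.

Lemma rank_level_closed A rho N B p :
  (forall H, A H -> hyperplane H) -> (forall H, A H -> H p) ->
  (forall H, A H -> (rho H < N)%N) -> level_function A rho ->
  B `<=` A -> level_closed B rho ->
  codim (\bigcap_(H in B) H) = (\sum_(i < N) occupied B rho i)%N.
Proof.
move=> Ah Ap AN [_ AI] BA Bcl.
have [] // := @rank_levels _ _ B rho N.
- by move=> H /BA/Ah.
- by move=> H /BA/AN.
- by move=> e f Be Bf ef r; split; [exists p; split; apply: Ap; apply: BA | apply: Bcl].
move=> e Be; have /existsNP[q /not_implyP[lq nq]] := AI _ (BA _ Be).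
exists (q - p); split=> [g Bg rg|st].
  apply: (hyperplane_stable_dir (Ah _ (BA _ Bg)) (Ap _ (BA _ Bg))).
  by rewrite subrKC; apply: lq; split=> //; apply: BA.
by apply: nq; rewrite -(subrKC p q); apply: st; apply: Ap; apply: BA.
Qed.

Lemma flat_affine A X : (forall H, A H -> hyperplane H) -> flats A X -> affine X.
Proof.
move=> Ah [Xnz [B BA XE]]; rewrite XE; apply: affine_bigcap; last by rewrite -XE.
by move=> H /BA/Ah/hyperplane_affine.
Qed.

Lemma flat_localization A X : flats A X ->
  X = \bigcap_(H in localization A X) H.
Proof.
move=> [_ [B BA ->]]; apply/seteqP; split=> [x Bx H [_ XH]|x lx H BH]; first exact: XH.
by apply: lx; split; [apply: BA | move=> y; apply].
Qed.

Lemma localization_level_closed A rho X : level_closed A rho ->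
  level_closed (localization A X) rho.
Proof.
move=> cl e f [Ae Xe] [Af Xf] ef r; have [g [Ag rg efg]] := cl _ _ Ae Af ef r.
by exists g; split=> //; split=> // x Xx; apply: efg; split; [apply: Xe|apply: Xf].
Qed.

Section FromChain.
Variables (A : set (set V)) (r : nat) (C : nat -> set V).
Hypothesis Ah : forall H, A H -> hyperplane H.
Hypothesis AC : maximal_modular_chain A r C.

Definition chain_level H : nat :=
  find (fun i => `[< C i `<=` H >]) (iota 0 r.+1).

Let Cflat i : (i <= r)%N -> flats A (C i).
Proof. by case: AC => -[_ _ Cf _ _] _; apply: Cf. Qed.

Let Cdec i j : (i <= j)%N -> (j <= r)%N -> C j `<=` C i.
Proof.
elim: j => [|j IH]; first by rewrite leqn0 => /eqP-> _ x.
rewrite leq_eqVlt => /orP[/eqP-> _ x //|]; rewrite ltnS => ij jr.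
case: AC => -[_ _ _ /(_ j jr)[Cj _] _] _.
exact: subset_trans Cj (IH ij (ltnW jr)).
Qed.

Lemma chain_levelP H i : A H -> (i <= r)%N ->
  C i `<=` H <-> (chain_level H <= i)%N.
Proof.
move=> AH ir.
have hasH : has (fun i => `[< C i `<=` H >]) (iota 0 r.+1).
  apply/hasP; exists r; first by rewrite mem_iota add0n ltnS leqnn.
  by apply/asboolP; case: AC => -[_ -> _ _ _] _ x Cx; apply: Cx.
have lr : (chain_level H <= r)%N by move: hasH; rewrite has_find size_iota.
have CH : C (chain_level H) `<=` H.
  by have /asboolP := nth_find 0%N hasH; rewrite nth_iota.
split=> [CiH|li]; last by apply: subset_trans (Cdec li ir) CH.
rewrite leqNgt; apply/negP => il.
by have := before_find 0%N il; rewrite nth_iota // add0n; move/asboolP; apply.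
Qed.

Lemma chain_level_le H : A H -> (chain_level H <= r)%N.
Proof.
move=> AH; apply/chain_levelP => //.
by case: AC => -[_ -> _ _ _] _ x Cx; apply: Cx.
Qed.

Lemma chain_level_gt0 H : A H -> (0 < chain_level H)%N.
Proof.
move=> AH; rewrite ltnNge; apply/negP => /(chain_levelP AH (leq0n r)).
case: AC => -[-> _ _ _ _] _ TH; apply: (hyperplane_neqT (Ah AH)).
by apply/seteqP; split.
Qed.

(** The meet of a modular C_k with the codimension-two flat of two hyperplanes
added together at the next step has codimension one, hence lies in a hyperplane,
and that hyperplane was added before. *)
Lemma chain_level_function : level_function A chain_level.
Proof.
have [p Ap] : exists p, forall H, A H -> H p.
  have [p Cp] := (Cflat (leqnn r)).1; exists p => H AH; move: p Cp.
  by case: AC => -[_ -> _ _ _] _ p Cp; apply: Cp.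
have Caff i : (i <= r)%N -> affine (C i).
  by move=> /Cflat; apply: flat_affine.
have next k e : A e -> chain_level e = k.+1 -> (k < r)%N ->
    C k `&` e = C k.+1 /\ codim (C k.+1) = (codim (C k)).+1.
  move=> Ae le kr; have [[_ _ _ _ Cmax] _] := AC.
  have nCk : ~ C k `<=` e by move=> /(chain_levelP Ae (ltnW kr)); rewrite le ltnn.
  have Ck1 : C k.+1 `<=` e by apply/(chain_levelP Ae kr); rewrite le.
  have Cke : flats A (C k `&` e).
    have [Cknz [B BA CkE]] := Cflat (ltnW kr); split.
      exists p; split; last exact: Ap.
      by rewrite CkE => H /BA/Ap.
    exists (B `|` [set e]); first by rewrite subUset; split=> // _ ->.
    by rewrite bigcap_setU bigcap_set1 CkE.
  have E : C k `&` e = C k.+1.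
    have [i ir|i ir Ei] := Cmax _ Cke.
      have [ik|ki] := leqP i k; [left|right].
        exact: subset_trans (@subIsetl _ _ _) (Cdec ik (ltnW kr)).
      apply: subset_trans (Cdec ki ir) _; rewrite subsetI; split=> //.
      exact: Cdec.
    apply/seteqP; split; last by rewrite subsetI; split=> //; apply: Cdec.
    rewrite Ei; apply: Cdec => //; rewrite ltnNge; apply/negP => ik.
    by apply: nCk => x Cx; have := Cdec ik (ltnW kr) Cx; rewrite -Ei => -[].
  split=> //; rewrite -E codim_hyperplaneI //; [exact/Caff/ltnW|exact: Ah|].
  exact: Cke.1.
split=> [e f Ae Af ef lef|e Ae lsub].
  have le0 := chain_level_gt0 Ae; have ler := chain_level_le Ae.
  have lE : chain_level e = (chain_level e).-1.+1 by rewrite prednK.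
  set k := (chain_level e).-1 in lE; have kr : (k < r)%N by rewrite -lE.
  have [Ee ce] := next _ _ Ae lE kr.
  have [Ef _] := next _ _ Af (etrans (esym lef) lE) kr.
  have efnz : e `&` f !=set0 by exists p; split; apply: Ap.
  have Yflat : flats A (e `&` f).
    split=> //; exists [set e; f]; first by move=> H [] ->.
    by rewrite bigcap_setU !bigcap_set1.
  have [_ Cmod] := AC; have [_ /(_ _ Yflat)] := Cmod _ (ltnW kr).
  have -> : flat_join (C k) (e `&` f) = C k.+1.
    rewrite /flat_join setIA Ee -Ef -setIA setIid //.
  have -> : codim (e `&` f) = 2%N.
    rewrite codim_hyperplaneI ?codim_hyperplane //.
    - exact: Ah.
    - exact/hyperplane_affine/Ah.
    - exact: Ah.
    - by move=> /(hyperplane_sub_eq (Ah Ae) (Ah Af)).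
  rewrite ce.
  move=> cm; have [g [Ag gk]] : exists g, A g /\ C k `|` (e `&` f) `<=` g.
    apply: contrapT => ng; move: cm.
    have -> : flat_meet A (C k) (e `&` f) = setT.
      by apply/seteqP; split=> // x _ H hH; case: ng; exists H.
    rewrite codimT; lia.
  exists g; split=> //; last by move=> x h; apply: gk; right.
  rewrite lE ltnS; apply/(chain_levelP Ag (ltnW kr)) => x Cx; apply: gk; by left.
have le0 := chain_level_gt0 Ae; have ler := chain_level_le Ae.
have kr : ((chain_level e).-1 <= r)%N by lia.
suff : (chain_level e <= (chain_level e).-1)%N by lia.
apply/(chain_levelP Ae kr); apply: subset_trans lsub.
move=> x Cx g [Ag lg]; suff : C (chain_level e).-1 `<=` g by apply.
by apply/(chain_levelP Ag kr); lia.
Qed.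

End FromChain.

Section ToChain.
Variables (A : set (set V)) (p : V).
Hypothesis Ah : forall H, A H -> hyperplane H.
Hypothesis Ap : forall H, A H -> H p.

(** Modularity of C_k is a count of levels: C_k has the levels below k, the join
with Y has these and those of Y, and the meet has their common ones, because
a hyperplane contains C_k exactly when its level is below k. *)
Lemma chain_of_levels rho N : (forall H, A H -> (rho H < N)%N) ->
  (forall i, (i < N)%N -> occupied A rho i) -> level_function A rho ->
  maximal_modular_chain A N (fun k => \bigcap_(H in levels_below A rho k) H).
Proof.
move=> AN Aocc Alf; have [Acl AI] := Alf.
set C := fun k => _.
have sub k : levels_below A rho k `<=` A by move=> H [].
have Cp k : C k p by move=> H [/Ap].
have flatI B : B `<=` A -> flats A (\bigcap_(H in B) H).
  by move=> BA; split; [exists p => H /BA/Ap | exists B].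
have Cflat k : flats A (C k) by apply: flatI.
have Caff k : affine (C k) by apply: flat_affine (Cflat k).
have cl k : level_closed (levels_below A rho k) rho.
  move=> e f [Ae le] [Af lf] ef r; have [g [Ag rg h]] := Acl _ _ Ae Af ef r.
  by exists g; split=> //; split=> //; apply: ltn_trans le.
have occC k i : (k <= N)%N -> occupied (levels_below A rho k) rho i = (i < k)%N.
  move=> kN; apply/asboolP/idP => [[H [_ lH] <- //]|ik].
  have /asboolP[H AH rH] := Aocc _ (leq_trans ik kN).
  by exists H => //; split; rewrite // rH.
have rk := rank_level_closed Ah Ap AN Alf.
have cC k : (k <= N)%N -> codim (C k) = k.
  move=> kN; rewrite /C (rk _ (sub k) (cl k)).
  under eq_bigr => i _ do rewrite occC //.
  rewrite [RHS](_ : k = (\sum_(i < k) 1)%N); last by rewrite sum1_card card_ord.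
  rewrite (big_ord_widen N (fun=> 1%N)) // [RHS]big_mkcond /=.
  by apply: eq_bigr => i _; case: (_ < _)%N.
have CsubP k H : A H -> C k `<=` H <-> (rho H < k)%N.
  move=> AH; split=> [CH|lH x]; last by apply; split.
  rewrite ltnNge; apply/negP => kl; apply: (AI _ AH); apply: subset_trans CH.
  by move=> x lx g [Ag rg]; apply: lx; split=> //; apply: leq_trans rg kl.
have Cdec i j : (i <= j)%N -> C j `<=` C i.
  by move=> ij x Cx H [AH rH]; apply: Cx; split=> //; apply: leq_trans rH ij.
split.
  split.
  - by apply/seteqP; split=> // x _ H [].
  - by apply/seteqP; split=> x Cx H; [move=> AH; apply: Cx; split; last exact: AN
      | move=> [AH _]; apply: Cx].
  - by move=> i _; apply: Cflat.
  - move=> i iN; split; first exact: Cdec.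
    move=> h; have := codimS (Caff i) (Caff i.+1) h.
    by rewrite !cC ?ltnn // ltnW.
  - move=> Y Yf Ycmp.
    have Ya := flat_affine Ah Yf.
    pose P i := (i <= N)%N && `[< Y `<=` C i >].
    have P0 : exists i, P i.
      by exists 0%N; apply/andP; split=> //; apply/asboolP => x _ H [].
    have PN i : P i -> (i <= N)%N by case/andP.
    case: (ex_maxnP P0 PN) => i /andP[iN /asboolP YC] imax.
    exists i => //; have [iN'|Ni] := ltnP i N; last first.
      have -> : i = N by apply/eqP; rewrite eqn_leq iN.
      apply/seteqP; split; first by apply: subset_trans YC _; apply: Cdec.
      rewrite (flat_localization Yf) => x Cx H [AH _]; apply: Cx; split=> //.
      exact: AN.
    have nYC : ~ Y `<=` C i.+1.
      by move=> h; have := imax i.+1; rewrite /P iN' (introT (asboolP _) h) ltnn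
        => /(_ isT).
    have [//|CY] := Ycmp _ iN'.
    apply: codim_eq => //; rewrite cC //.
    have := codimS (Caff i.+1) Ya CY; rewrite cC // leq_eqVlt => /orP[/eqP cY|//].
    by case: nYC; rewrite (codim_eq (Caff i.+1) Ya CY) // cC // cY.
move=> k kN; split=> // Y Yf.
have YE := flat_localization Yf.
have locA : localization A Y `<=` A by move=> H [].
have Ycl := localization_level_closed (X := Y) Acl.
have -> : codim Y = (\sum_(i < N) occupied (localization A Y) rho i)%N.
  by rewrite {1}YE rk.
rewrite rk //; have -> : flat_join (C k) Y =
    \bigcap_(H in levels_below A rho k `|` localization A Y) H.
  by rewrite bigcap_setU -YE.
rewrite rk; first last.
- move=> e f [[Ae le]|[Ae Ye]] [[Af lf]|[Af Yf']] ef r;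
    have [g [Ag rg h]] := Acl _ _ Ae Af ef r; exists g; split=> //.
  + by left; split=> //; apply: ltn_trans le.
  + by left; split=> //; apply: ltn_trans le.
  + by left; split=> //; rewrite r in rg; apply: ltn_trans lf.
  + by right; split=> // x Yx; apply: h; split; [apply: Ye|apply: Yf'].
- by rewrite subUset; split=> // H [].
rewrite rk; first last.
- move=> e f [Ae he] [Af hf] ef r; have [g [Ag rg h]] := Acl _ _ Ae Af ef r.
  exists g; split=> //; split=> // x hx; apply: h; split; [exact: he|exact: hf].
- by move=> H [].
rewrite -!big_split /=; apply: eq_bigr => i _; rewrite occC //.
set o := occupied (localization A Y) rho i.
have -> : occupied (levels_below A rho k `|` localization A Y) rho i =
    (i < k)%N || o.
  apply/asboolP/orP => [[H [[AH lH]|lH] rH]|[ik|/asboolP[H AH rH]]].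
  - by left; rewrite -rH.
  - by right; apply/asboolP; exists H.
  - have := occC k i kN; rewrite ik => /asboolP[H AH rH].
    by exists H => //; left.
  - by exists H => //; right.
have -> : occupied [set H | A H /\ C k `|` Y `<=` H] rho i = (i < k)%N && o.
  apply/asboolP/andP => [[H [AH]]|[ik /asboolP[H [AH YH] rH]]].
  - rewrite subUset => -[CH YH] rH.
    by split; [rewrite -rH; apply/(CsubP _ _ AH)|apply/asboolP; exists H].
  - exists H => //; split=> //; rewrite subUset; split=> //.
    by apply/(CsubP _ _ AH); rewrite rH.
by case: (_ < _)%N; case: o.
Qed.

Lemma normalize_levels rho N : (forall H, A H -> (rho H < N)%N) ->
  level_function A rho -> exists r (rho' : set V -> nat),
  [/\ forall H, A H -> (rho' H < r)%N,
      forall i, (i < r)%N -> occupied A rho' i,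
      level_function A rho' &
      forall H H', A H -> A H' -> (rho' H < rho' H')%N = (rho H < rho H')%N].
Proof.
move=> AN [Acl AI]; pose nu j := (\sum_(i < j) occupied A rho i)%N.
have nuS j : nu j.+1 = (nu j + occupied A rho j)%N by rewrite /nu big_ord_recr.
have numono i j : (i <= j)%N -> (nu i <= nu j)%N.
  move=> ij; rewrite -(subnK ij); elim: (j - i)%N => // d IH.
  by rewrite addSn nuS; apply: leq_trans IH (leq_addr _ _).
have nult H j : A H -> (rho H < j)%N -> (nu (rho H) < nu j)%N.
  move=> AH rj; apply: leq_trans (numono _ _ rj); rewrite nuS.
  by have -> : occupied A rho (rho H) by [apply/asboolP; exists H]; rewrite addn1.
have cmp H H' : A H -> A H' -> (nu (rho H) < nu (rho H'))%N = (rho H < rho H')%N.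
  move=> AH AH'; apply/idP/idP; last exact: nult.
  by rewrite !ltnNge; apply: contra; apply: numono.
exists (nu N), (fun H => nu (rho H)); split=> //.
- by move=> H AH; apply: nult => //; apply: AN.
- have surj j i : (i < nu j)%N -> exists2 H, A H & nu (rho H) = i.
    elim: j => [|j IH]; first by rewrite /nu big_ord0.
    rewrite nuS; case: (boolP (occupied A rho j)) => [/asboolP[H AH rH]|_].
      rewrite addn1 ltnS leq_eqVlt => /orP[/eqP->|/IH//].
      by exists H; rewrite ?rH.
    by rewrite addn0 => /IH.
  by move=> i /surj h; apply/asboolP.
split=> [e f Ae Af ef r|e Ae].
  have re : rho e = rho f.
    have := cmp e f Ae Af; have := cmp f e Af Ae; rewrite r ltnn.
    by move=> /esym/negbT + /esym/negbT; rewrite -!leqNgt; lia.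
  have [g [Ag rg h]] := Acl _ _ Ae Af ef re.
  by exists g; split=> //; rewrite cmp.
have -> : levels_below A (fun H => nu (rho H)) (nu (rho e)) =
    levels_below A rho (rho e).
  by apply/seteqP; split=> H [AH h]; split=> //; move: h; rewrite cmp.
exact: AI.
Qed.

Lemma level_function_chain_through rho N H0 :
  (forall H, A H -> (rho H < N)%N) -> level_function A rho -> A H0 ->
  (forall H, A H -> H <> H0 -> (rho H0 < rho H)%N) ->
  has_maximal_modular_chain_through A H0.
Proof.
move=> AN Alf AH0 min0.
have [r [rho' [Ar occ Alf' cmp]]] := normalize_levels AN Alf.
have r0 : (0 < r)%N by apply: leq_trans (Ar _ AH0).
have /asboolP[H AH rH] := occ _ r0.
have H0E : rho' H0 = 0%N.
  have [<-//|nH] := EM (H = H0).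
  by have := min0 _ AH nH; rewrite -cmp // rH.
exists r, (fun k => \bigcap_(H in levels_below A rho' k) H); split=> //.
  exact: chain_of_levels.
apply/seteqP; split=> [x|x Hx H' [AH' rH']]; first by apply; split; rewrite ?H0E.
have [->//|nH'] := EM (H' = H0).
by have := min0 _ AH' nH'; rewrite -cmp // H0E lt0n; move: rH'; rewrite ltnS leqn0 => ->.
Qed.

End ToChain.

End LevelFunctions.

(** * Lines spanned by gain hyperplanes *)

Section GainGeometry.
Import GRing.Theory.
Local Open Scope classical_set_scope.
Local Open Scope ring_scope.
Variables (K : fieldType) (n : nat).
Implicit Types (i j k l p q : 'I_n) (a b c : K) (x u : 'rV[K]_n) (Z : {set 'I_n}).

Definition indicator Z : 'rV[K]_n := \row_i (i \in Z)%:R.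

Lemma indicator_eq Z i j :
  (indicator Z 0 i == indicator Z 0 j) = ((i \in Z) == (j \in Z)).
Proof.
rewrite !mxE; case: (i \in Z); case: (j \in Z); rewrite ?eqxx ?oner_eq0 //=.
by rewrite eq_sym oner_eq0.
Qed.

Definition coordinate_form i j : 'rV[K]_n -> K := fun x => x 0 i - x 0 j.

Lemma coordinate_form_scalar i j : scalar (coordinate_form i j).
Proof.
by move=> a u v; rewrite /coordinate_form !mxE mulrBr opprD addrACA.
Qed.

Lemma gain_hyperplaneP i j a : i != j -> hyperplane (gain_hyperplane i j a).
Proof.
move=> ij; exists (coordinate_form i j), a; split=> //.
  exact: coordinate_form_scalar.
exists (indicator [set i]); rewrite /coordinate_form subr_eq0 indicator_eq.
by rewrite !inE eqxx [j == i]eq_sym (negPf ij).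
Qed.

Lemma gain_hyperplane_sym i j a :
  gain_hyperplane i j a = gain_hyperplane j i (- a).
Proof.
apply/seteqP; split=> x /=; rewrite /gain_hyperplane /=.
  by move=> <-; rewrite opprB.
by move=> h; rewrite -opprB h opprK.
Qed.

Lemma stable_gain_hyperplane i j a u :
  u 0 i = u 0 j -> stable u (gain_hyperplane i j a).
Proof.
move=> uij x; rewrite /gain_hyperplane /= !mxE => <-.
by rewrite uij opprD addrACA subrr addr0.
Qed.

Lemma stable_gain_hyperplane_inv i j a u x : gain_hyperplane i j a x ->
  gain_hyperplane i j a (x + u) -> u 0 i = u 0 j.
Proof.
rewrite /gain_hyperplane /= !mxE => <-.
by rewrite opprD addrACA -[RHS]addr0 => /addrI/eqP; rewrite subr_eq0 => /eqP.
Qed.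

(** A gain hyperplane on pq that contains X is invariant under the translations
that preserve X. Indicator vectors suffice to determine the pair pq. *)
Definition linked (P : {set 'I_n} -> bool) p q :=
  forall Z, P Z -> (p \in Z) = (q \in Z).

Lemma gain_hyperplane_link (X : set 'rV[K]_n) p q c (P : {set 'I_n} -> bool) x :
  X x -> (forall Z, P Z -> X (x + indicator Z)) -> X `<=` gain_hyperplane p q c ->
  linked P p q.
Proof.
move=> Xx XZ Xpq Z PZ; apply/eqP; rewrite -indicator_eq; apply/eqP.
exact: (stable_gain_hyperplane_inv (Xpq _ Xx) (Xpq _ (XZ _ PZ))).
Qed.

Lemma indicator_const D Z i j : (Z \subset ~: D) || (D \subset Z) ->
  i \in D -> j \in D -> indicator Z 0 i = indicator Z 0 j.
Proof.
move=> DZ iD jD; apply/eqP; rewrite indicator_eq.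
case/orP: DZ => /fintype.subsetP DZ; last by rewrite !DZ.
have nZ r : r \in D -> r \in Z = false.
  by move=> rD; apply/negP => /DZ; rewrite inE rD.
by rewrite !nZ.
Qed.

Lemma linked_disjoint i j k l p q : [/\ i != k, i != l, j != k & j != l] ->
  p != q ->
  linked (fun Z => ((i \in Z) == (j \in Z)) && ((k \in Z) == (l \in Z))) p q ->
  [\/ p = i /\ q = j, p = j /\ q = i, p = k /\ q = l | p = l /\ q = k].
Proof.
move=> [ik il jk jl] pq L.
have := L [set i; j]%SET; have := L [set k; l]%SET; have := L [set p]%SET.
rewrite !inE !eqxx !orbT.
rewrite ![k == _]eq_sym ![l == _]eq_sym.
rewrite !(negPf ik) !(negPf il) !(negPf jk) !(negPf jl) !eqxx /=.
rewrite [q == p]eq_sym (negPf pq) => L1 /(_ isT) L2 /(_ isT) L3.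
have [pi|npi] := eqVneq p i.
  subst p; move: L3; rewrite eqxx [q == i]eq_sym (negPf pq) /= => /esym/eqP ->.
  by constructor 1.
have [pj|npj] := eqVneq p j.
  subst p; move: L3; rewrite eqxx orbT [q == j]eq_sym (negPf pq) orbF.
  by move=> /esym/eqP ->; constructor 2.
have [pk|npk] := eqVneq p k.
  subst p; move: L2; rewrite eqxx [q == k]eq_sym (negPf pq) /= => /esym/eqP ->.
  by constructor 3.
have [pl|npl] := eqVneq p l.
  subst p; move: L2; rewrite eqxx orbT [q == l]eq_sym (negPf pq) orbF.
  by move=> /esym/eqP ->; constructor 4.
move: L1; rewrite ![_ == p]eq_sym (negPf npi) (negPf npj) (negPf npk) (negPf npl).
by move=> /(_ isT).
Qed.

(** The condition on Z says that its indicator is constant on D. *)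
Lemma linked_within D p q : p != q ->
  linked (fun Z => (Z \subset ~: D) || (D \subset Z)) p q -> p \in D /\ q \in D.
Proof.
move=> pq L; split.
  apply/negPn/negP => pD; have := L [set p]%SET; rewrite !inE eqxx [q == p]eq_sym.
  by rewrite (negPf pq) finset.sub1set inE pD => /(_ isT).
apply/negPn/negP => qD; have := L [set q]%SET; rewrite !inE eqxx.
by rewrite (negPf pq) finset.sub1set inE qD => /(_ isT).
Qed.

Lemma gain_hyperplane_inj i j p q a c : i != j -> p != q ->
  gain_hyperplane i j a `<=` gain_hyperplane p q c ->
  p = i /\ q = j /\ c = a \/ p = j /\ q = i /\ c = - a.
Proof.
move=> ij pq sub; have [[x Xx] _] := hyperplane_affine (gain_hyperplaneP a ij).
have cE : x 0 p - x 0 q = c by apply: sub Xx.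
have aE : x 0 i - x 0 j = a by exact: Xx.
have [] := @linked_within [set i; j]%SET p q pq.
  apply: gain_hyperplane_link (Xx) _ sub => Z DZ; apply: stable_gain_hyperplane => //.
  by apply: (indicator_const DZ); rewrite !inE eqxx ?orbT.
rewrite !inE => /orP[]/eqP pE /orP[]/eqP qE; subst p q;
  move: pq cE; rewrite ?eqxx // => _ cE.
  by left; rewrite -cE aE.
by right; rewrite -cE -aE opprB.
Qed.

Lemma gain_line_disjoint i j k l a b : i != j -> k != l ->
  [/\ i != k, i != l, j != k & j != l] ->
  let X := gain_hyperplane i j a `&` gain_hyperplane k l b in
  X !=set0 /\ forall p q c, p != q -> X `<=` gain_hyperplane p q c ->
  gain_hyperplane p q c = gain_hyperplane i j a \/
  gain_hyperplane p q c = gain_hyperplane k l b.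
Proof.
move=> ij kl dis; have [ik il jk jl] := dis; move=> X.
pose x : 'rV[K]_n := \row_r (if r == i then a else if r == k then b else 0).
have Xx : X x.
  split; rewrite /gain_hyperplane /= !mxE eqxx.
    by rewrite [j == i]eq_sym (negPf ij) (negPf jk) subr0.
  rewrite [k == i]eq_sym (negPf ik) [l == i]eq_sym (negPf il).
  by rewrite [l == k]eq_sym (negPf kl) subr0.
split; first by exists x.
move=> p q c pq Xpq; have cE : x 0 p - x 0 q = c by apply: Xpq Xx.
have aE : x 0 i - x 0 j = a by case: Xx.
have bE : x 0 k - x 0 l = b by case: Xx.
have L : linked (fun Z => ((i \in Z) == (j \in Z)) && ((k \in Z) == (l \in Z))) p q.
  apply: gain_hyperplane_link (Xx) _ Xpq => Z.
  rewrite -!indicator_eq => /andP[/eqP zij /eqP zkl].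
  by case: Xx => ? ?; split; apply: stable_gain_hyperplane.
have [[pE qE]|[pE qE]|[pE qE]|[pE qE]] := linked_disjoint dis pq L; subst p q.
- by left; rewrite -cE aE.
- by left; rewrite gain_hyperplane_sym -cE opprB aE.
- by right; rewrite -cE bE.
- by right; rewrite gain_hyperplane_sym -cE opprB bE.
Qed.

(** If x_j - x_i = a and x_j - x_k = b then x_i - x_k = b - a, and this is the only
other gain equation that follows. *)
Lemma gain_line_adjacent i j k a b : i != j -> j != k -> i != k ->
  let X := gain_hyperplane j i a `&` gain_hyperplane j k b in
  X !=set0 /\ forall p q c, p != q -> X `<=` gain_hyperplane p q c ->
  [\/ gain_hyperplane p q c = gain_hyperplane j i a,
      gain_hyperplane p q c = gain_hyperplane j k b |
      gain_hyperplane p q c = gain_hyperplane i k (b - a) /\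
      (p = i /\ q = k /\ c = b - a \/ p = k /\ q = i /\ c = a - b)].
Proof.
move=> ij jk ik X.
pose x : 'rV[K]_n := \row_r (if r == i then - a else if r == k then - b else 0).
have Xx : X x.
  split; rewrite /gain_hyperplane /= !mxE eqxx.
    by rewrite [j == i]eq_sym (negPf ij) (negPf jk) add0r opprK.
  rewrite [j == i]eq_sym (negPf ij) (negPf jk) [k == i]eq_sym (negPf ik).
  by rewrite add0r opprK.
split; first by exists x.
move=> p q c pq Xpq; have cE : x 0 p - x 0 q = c by apply: Xpq Xx.
have aE : x 0 j - x 0 i = a by case: Xx.
have bE : x 0 j - x 0 k = b by case: Xx.
have dE : x 0 i - x 0 k = b - a by rewrite -aE -bE opprB [RHS]addrC addrA subrK.
have [] := @linked_within [set i; j; k]%SET p q pq.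
  apply: gain_hyperplane_link (Xx) _ Xpq => Z DZ.
  have zD r s : r \in [set i; j; k]%SET -> s \in [set i; j; k]%SET ->
    indicator Z 0 r = indicator Z 0 s by apply: indicator_const.
  case: Xx => ? ?; split; apply: stable_gain_hyperplane => //;
    by apply: zD; rewrite !inE eqxx ?orbT.
have dE' : x 0 k - x 0 i = a - b by rewrite -opprB dE opprB.
rewrite !inE -!orbA => /or3P[]/eqP pE /or3P[]/eqP qE; subst p q;
  move: pq cE; rewrite ?eqxx // => _ cE.
- by constructor 1; rewrite gain_hyperplane_sym -cE opprB aE.
- by constructor 3; rewrite -cE dE; split=> //; left.
- by constructor 1; rewrite -cE aE.
- by constructor 2; rewrite -cE bE.
- constructor 3; rewrite -cE dE'; split; last by right.
  by rewrite gain_hyperplane_sym opprB.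
- by constructor 2; rewrite gain_hyperplane_sym -cE opprB bE.
Qed.

Section Arrangement.
Variables (G : graph 'I_n) (S : 'I_n -> 'I_n -> {fset K}).
Hypothesis hS : gain_sets G S.

Lemma edge_gain i j : edge G i j -> i != j /\ exists a, a \in S i j.
Proof.
move=> eij; have ij : i != j by apply: contraTneq eij => ->; rewrite edge_irr.
by split=> //; have [_ h] := hS ij; apply/fset0Pn; rewrite h.
Qed.

Lemma gain_opp i j a : i != j -> a \in S i j -> - a \in S j i.
Proof.
move=> ij aS; have [-> _] := hS ij; apply/imfsetP; by exists a.
Qed.

Lemma gain_arrangementP H : gain_arrangement S H <->
  exists i j a, [/\ i != j, a \in S i j & H = gain_hyperplane i j a].
Proof.
split=> [[i [j [a [ij aS HE]]]]|[i [j [a [ij aS HE]]]]].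
  by exists i, j, a; split=> //; move: ij; rewrite ltn_neqAle => /andP[].
have := ij; rewrite -val_eqE /= neq_ltn => /orP[lt|lt].
  by exists i, j, a.
exists j, i, (- a); split=> //; first exact: gain_opp.
by rewrite HE gain_hyperplane_sym.
Qed.

Lemma gain_arrangement_hyperplane H : gain_arrangement S H -> hyperplane H.
Proof. by move=> /gain_arrangementP[i [j [a [ij _ ->]]]]; apply: gain_hyperplaneP. Qed.

Lemma gain_in_arrangement i j a : i != j -> a \in S i j ->
  gain_arrangement S (gain_hyperplane i j a).
Proof. by move=> ij aS; apply/gain_arrangementP; exists i, j, a. Qed.

End Arrangement.

End GainGeometry.

Section ConstantOn.
Import GRing.Theory.
Local Open Scope classical_set_scope.
Local Open Scope ring_scope.
Variables (K : fieldType) (N : nat).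

Definition identified (d : 'I_N) (s : seq 'I_N) : set 'rV[K]_N :=
  [set x | forall i, i \in s -> x 0 i = x 0 d].

(** Identifying the coordinates of a list, one after the other, with a given one
lowers the dimension each time. *)
Lemma codim_identify (X : set 'rV[K]_N) (d : 'I_N) (s : seq 'I_N) :
  affine X -> X 0 -> uniq (d :: s) ->
  (forall i, i \in s -> stable (indicator K [set i]) X) ->
  affine (X `&` identified d s) /\
  codim (X `&` identified d s) = (codim X + size s)%N.
Proof.
move=> Xa X0; elim: s => [_ _|i s IH] /=.
  have -> : identified d [::] = setT by apply/seteqP; split.
  by rewrite setIT addn0.
rewrite inE negb_or -andbA => /and4P[di ds si us] st.
have [Ya cY] : affine (X `&` identified d s) /\
    codim (X `&` identified d s) =
    (codim X + size s)%N.
  by apply: IH; [rewrite /= ds us | move=> j js; apply: st; rewrite inE js orbT].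
set Y := X `&` _ in Ya cY.
have -> : X `&` identified d (i :: s) =
    Y `&` gain_hyperplane i d 0.
  apply/seteqP; split=> [x [Xx h]|x [[Xx h] /eqP]].
    split; first by split=> // j js; apply: h; rewrite inE js orbT.
    by rewrite /gain_hyperplane /= h ?mem_head // subrr.
  rewrite subr_eq0 => /eqP xid; split=> // j; rewrite inE => /orP[/eqP->//|js].
  exact: h.
have Hh : hyperplane (gain_hyperplane i d (0 : K)).
  by apply: gain_hyperplaneP; rewrite eq_sym.
have Y0 : Y 0 by split=> // j _; rewrite !mxE.
have YH : Y `&` gain_hyperplane i d 0 !=set0.
  by exists 0; split=> //; rewrite /gain_hyperplane /= !mxE subrr.
split; first by apply: affine_setI => //; apply: hyperplane_affine.
rewrite codim_hyperplaneI // ?cY ?addnS // => YHs.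
have : Y (indicator K [set i]).
  split; first by rewrite -[indicator K _]add0r; apply: st; rewrite ?mem_head.
  move=> j js; apply/eqP; rewrite indicator_eq !inE (negPf di).
  by apply/eqP/negbTE; apply: contraNneq si => <-.
move/YHs; rewrite /gain_hyperplane /= => /eqP; rewrite subr_eq0 indicator_eq.
by rewrite !inE eqxx (negPf di).
Qed.

End ConstantOn.

(** * From nice partitions to admissible orderings *)

Section NicePartitions.
Import GRing.Theory.
Local Open Scope classical_set_scope.
Local Open Scope card_scope.
Local Open Scope ring_scope.

Lemma card_indexed (I : finType) (U : Type) (E : {set I}) (F : I -> U) :
  {in E &, injective F} -> F @` [set i | i \in E] #= `I_#|E|.
Proof.
move=> Finj; have [->|/finset.set0Pn[x0 x0E]] := eqVneq E finset.set0.
  have -> : [set i : I | i \in finset.set0] = set0.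
    by apply/seteqP; split=> // x; rewrite /= finset.in_set0.
  by rewrite image_set0 cards0; apply/card_eqP; rewrite II0; apply/card_eqP.
have -> : F @` [set i | i \in E] =
    (fun k => F (nth x0 (enum E) k)) @` `I_#|E|.
  apply/seteqP; split=> [_ [i /= iE <-]|_ [k /= kE <-]].
    by exists (index i (enum E)); rewrite /= ?nth_index ?mem_enum // cardE
      index_mem mem_enum.
  by exists (nth x0 (enum E) k) => //=; rewrite -mem_enum mem_nth // -cardE.
apply: inj_card_eq => k l; rewrite !inE /= => kE lE.
have mem j : (j < #|E|)%N -> nth x0 (enum E) j \in E.
  by move=> jE; rewrite -mem_enum mem_nth // -cardE.
move=> /(Finj _ _ (mem _ kE) (mem _ lE))/eqP.
by rewrite nth_uniq ?enum_uniq -?cardE // => /eqP.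
Qed.

Section Rank.
Variables (K : fieldType) (V : vectType K).
Variables (A : set (set V)) (s : nat) (pi : 'I_s -> set (set V)).
Hypothesis Ah : forall H, A H -> hyperplane H.
Hypothesis nice : nice_partition A pi.

Definition met_parts (X : set V) : {set 'I_s} :=
  [set i | `[< pi i `&` localization A X !=set0 >]]%SET.

Lemma met_partsP X i : reflect (exists H, [/\ pi i H, A H & X `<=` H])
  (i \in met_parts X).
Proof.
rewrite finset.inE; apply: (iffP (asboolP _)) => -[H]; last by case=> *; exists H.
by case=> piH [AH XH]; exists H.
Qed.

(** By induction on the codimension. Niceness gives a hyperplane H through X alone
in its part. A minimal flat Y among those containing X but not contained in H has
codimension one less than X, and the part of H does not meet the localization at
Y. *)
Lemma codim_le_met_parts X : flats A X -> (codim X <= #|met_parts X|)%N.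
Proof.
have [m] := ubnP (codim X); elim: m X => // m IH X; rewrite ltnS => cX Xf.
have [->|XT] := EM (X = setT); first by rewrite codimT.
have [_ _ /(_ _ Xf XT)[i [H piE]]] := nice.
have [piH [AH XH]] : (pi i `&` localization A X) H by rewrite piE.
have Xa := flat_affine Ah Xf.
pose P k := `[< exists Y, [/\ flats A Y, X `<=` Y, ~ Y `<=` H & codim Y = k] >].
have P0 : exists k, P k.
  exists 0%N; apply/asboolP; exists setT; split=> //; last exact: codimT.
    by split; [exists 0 | exists set0 => //; rewrite bigcap_set0].
  by move=> TH; apply: (hyperplane_neqT (Ah AH)); apply/seteqP; split.
have Pn k : P k -> (k <= dim V)%N.
  by move=> /asboolP[Y [_ _ _ <-]]; apply: codim_le_dim.
case: (ex_maxnP P0 Pn) => k /asboolP[Y [Yf XY nYH cY]] kmax.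
have Ya := flat_affine Ah Yf.
have [x Xx] := Xf.1.
have flatI Z L : flats A Z -> A L -> X `<=` Z -> X `<=` L -> flats A (Z `&` L).
  move=> [_ [B BA ->]] AL XZ XL; split; first by exists x; split; [apply: XZ|apply: XL].
  exists (B `|` [set L]); first by rewrite subUset; split=> // _ ->.
  by rewrite bigcap_setU bigcap_set1.
have YHf := flatI _ _ Yf AH XY XH; have YHa := flat_affine Ah YHf.
have cYH : codim (Y `&` H) = k.+1.
  by rewrite codim_hyperplaneI // ?cY //; [apply: Ah | exact: YHf.1].
have YHX : Y `&` H = X.
  apply/seteqP; split; last by move=> z Xz; split; [apply: XY|apply: XH].
  rewrite (flat_localization Xf) => z [Yz Hz] L [AL XL].
  apply: contrapT => nLz.
  have nYL : ~ Y `<=` L by move=> YL; apply/nLz/YL.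
  have YLf := flatI _ _ Yf AL XY XL; have YLa := flat_affine Ah YLf.
  have cYL : codim (Y `&` L) = k.+1.
    by rewrite codim_hyperplaneI // ?cY //; [apply: Ah | exact: YLf.1].
  have YLH : Y `&` L `<=` H.
    apply: contrapT => nYLH.
    have : (k.+1 <= k)%N; last by rewrite ltnn.
    apply: kmax; apply/asboolP; exists (Y `&` L); split=> //.
    by move=> y Xy; split; [apply: XY|apply: XL].
  have E : Y `&` L = Y `&` H.
    apply: codim_eq => //; last by rewrite cYL cYH.
    by move=> y YLy; split; [case: YLy | apply: YLH].
  by have : (Y `&` H) z by []; rewrite -E => -[].
have cXY : codim X = (codim Y).+1 by rewrite -YHX cYH cY.
rewrite cXY in cX *; apply: leq_ltn_trans (IH _ cX Yf) _; apply: proper_card.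
apply/properP; split.
  apply/fintype.subsetP => j /met_partsP[L [pL AL YL]]; apply/met_partsP.
  by exists L; split=> // y Xy; apply/YL/XY.
exists i; first by apply/met_partsP; exists H.
apply/met_partsP => -[L [pL AL YL]].
have : (pi i `&` localization A X) L by split=> //; split=> // y Xy; apply/YL/XY.
by rewrite piE => LH; apply: nYH; rewrite -LH.
Qed.

Lemma section_independent (E : {set 'I_s}) (F : 'I_s -> set V) :
  (forall i, i \in E -> pi i (F i)) ->
  \bigcap_(i in [set i | i \in E]) F i !=set0 /\
  codim (\bigcap_(i in [set i | i \in E]) F i) = #|E|.
Proof.
move=> piF; have [[_ pid piA] ind _] := nice.
have part i j H : pi i H -> pi j H -> i = j.
  move=> piH pjH; apply/eqP; apply: contrapT => /negP ij.
  by have : (pi i `&` pi j) H by []; rewrite pid.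
have := ind #|E| (F @` [set i | i \in E]).
rewrite /independent_section bigcap_image; apply.
split.
- by move=> _ [i /= iE <-]; rewrite -piA; exists i => //; apply: piF.
- apply: card_indexed => i j iE jE Fij.
  by apply: part (piF _ iE) _; rewrite Fij; apply: piF.
- move=> i _ _ [j /= jE <-] [k /= kE <-] h h'.
  by rewrite (part _ _ _ (piF _ jE) h) (part _ _ _ (piF _ kE) h').
Qed.

End Rank.

Section Colouring.
Variables (K : fieldType) (n : nat) (G : graph 'I_n).
Variable S : 'I_n -> 'I_n -> {fset K}.
Hypothesis hS : gain_sets G S.
Variables (s : nat) (pi : 'I_s -> set (set 'rV[K]_n)).
Hypothesis nice : nice_partition (gain_arrangement S) pi.

Let Ah := gain_arrangement_hyperplane hS.
Let Ain := gain_in_arrangement hS.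

Lemma part_unique i j H : pi i H -> pi j H -> i = j.
Proof.
have [[_ pid _] _ _] := nice.
move=> piH pjH; apply/eqP; apply: contrapT => /negP ij.
by have : (pi i `&` pi j) H by []; rewrite pid.
Qed.

Lemma part_exists H : gain_arrangement S H -> exists i, pi i H.
Proof. by have [[_ _ <-] _ _] := nice => -[i _]; exists i. Qed.

(** Parallel hyperplanes have empty intersection, so they lie in the same part. *)
Lemma parallel_same_part i j a b k l : i != j -> a \in S i j -> b \in S i j ->
  pi k (gain_hyperplane i j a) -> pi l (gain_hyperplane i j b) -> k = l.
Proof.
move=> ij aS bS ka lb; apply/eqP; apply: contrapT => /negP kl.
pose F r := gain_hyperplane i j (if r == k then a else b).
have Fk : F k = gain_hyperplane i j a by rewrite /F eqxx.
have Fl : F l = gain_hyperplane i j b by rewrite /F eq_sym (negPf kl).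
have piF r : r \in [set k; l]%SET -> pi r (F r).
  by rewrite !finset.inE => /orP[]/eqP->; rewrite ?Fk ?Fl.
have [[x Fx] _] := section_independent nice piF.
have ax : gain_hyperplane i j a x.
  by rewrite -Fk; apply: Fx; rewrite /= !finset.inE eqxx.
have bx : gain_hyperplane i j b x.
  by rewrite -Fl; apply: Fx; rewrite /= !finset.inE eqxx orbT.
have ab : a = b by rewrite -ax -bx.
by move/eqP: kl; apply; apply: part_unique lb; rewrite -ab.
Qed.

Definition part_colour i j : option 'I_s :=
  [pick k | `[< exists2 a, a \in S i j & pi k (gain_hyperplane i j a) >]].

Lemma part_colourE i j a k : i != j -> a \in S i j ->
  pi k (gain_hyperplane i j a) <-> part_colour i j = Some k.
Proof.
move=> ij aS; rewrite /part_colour; case: pickP => [l /asboolP[b bS lb]|no].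
  split=> [ka|[<-]]; first by rewrite (parallel_same_part ij aS bS ka lb).
  have [m ma] := part_exists (Ain ij aS).
  by rewrite (parallel_same_part ij bS aS lb ma).
split=> // ka; have := no k; have -> //: `[< exists2 a, a \in S i j &
  pi k (gain_hyperplane i j a) >] by apply/asboolP; exists a.
Qed.

Lemma part_colour_edge i j : edge G i j -> exists k a, [/\ i != j, a \in S i j,
  pi k (gain_hyperplane i j a) & part_colour i j = Some k].
Proof.
move=> /(edge_gain hS)[ij [a aS]]; have [k ka] := part_exists (Ain ij aS).
by exists k, a; split=> //; apply/(part_colourE _ ij aS).
Qed.

Lemma part_colour_sym i j : part_colour i j = part_colour j i.
Proof.
have [->//|ij] := eqVneq i j.
case: (boolP (edge G i j)) => [eij|neij].
  have [k [a [_ aS ka ->]]] := part_colour_edge eij.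
  apply/esym/(part_colourE _ _ (gain_opp hS ij aS)); first by rewrite eq_sym.
  by rewrite -gain_hyperplane_sym.
have noS x y : x != y -> ~~ edge G x y -> part_colour x y = None.
  move=> xy nxy; rewrite /part_colour; case: pickP => // k /asboolP[a aS].
  by rewrite (mem_gain_edge hS xy aS) in nxy.
by rewrite !noS // 1?eq_sym // edge_sym.
Qed.

Lemma flat_pair e f : gain_arrangement S e -> gain_arrangement S f -> e <> f ->
  e `&` f !=set0 -> flats (gain_arrangement S) (e `&` f) /\ codim (e `&` f) = 2%N.
Proof.
move=> Ae Af ef nz; split.
  split=> //; exists [set e; f]; first by move=> H [] ->.
  by rewrite bigcap_setU !bigcap_set1.
rewrite codim_hyperplaneI ?codim_hyperplane //; try exact: Ah.
  by apply/hyperplane_affine/Ah.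
by move=> /(hyperplane_sub_eq (Ah Ae) (Ah Af)).
Qed.

(** The localization at the intersection consists of the two hyperplanes, and it
meets two parts. *)
Lemma part_disjoint i j k l : edge G i j -> edge G k l ->
  part_colour i j = part_colour k l -> [|| i == k, i == l, j == k | j == l].
Proof.
move=> eij ekl cE; apply: contrapT => /negP; rewrite !negb_or => /and4P[ik il jk jl].
have [c [a [ij aS ca pc]]] := part_colour_edge eij.
have [d [b [kl bS db pd]]] := part_colour_edge ekl.
have cd : c = d by move: cE; rewrite pc pd => -[].
have [nz third] := gain_line_disjoint a b ij kl (And4 ik il jk jl).
set e := gain_hyperplane i j a in ca nz third.
set f := gain_hyperplane k l b in db nz third.
have ef : e <> f.
  move=> ef; have := @gain_hyperplane_inj _ _ i j k l a b ij kl.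
  rewrite -/e -/f ef => /(_ (@subset_refl _ _)).
  by case=> -[kE _]; move: ik jk; rewrite kE eqxx.
have [Xf cX] := flat_pair (Ain ij aS) (Ain kl bS) ef nz.
have := codim_le_met_parts Ah nice Xf; rewrite cX leqNgt => /negP; apply.
rewrite ltnS; apply: (@leq_trans #|[set c]%SET|); last by rewrite cards1.
apply: subset_leq_card; apply/fintype.subsetP => r.
case/met_partsP => H [rH AH XH]; rewrite finset.inE; apply/eqP.
have /(gain_arrangementP hS)[p [q [g [pq gS HE]]]] := AH; rewrite HE in rH XH.
have [E|E] := third p q g pq XH; rewrite E in rH.
  exact: part_unique rH ca.
by rewrite cd; apply: part_unique rH db.
Qed.

(** The localization at the intersection meets two parts, so it has a hyperplane
in another part than that of the two edges; only the third side is left. *)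
Lemma part_adjacent x y z : edge G x y -> edge G x z -> y != z ->
  part_colour x y = part_colour x z ->
  (edge G y z /\ part_colour y z != part_colour x y) /\
  forall a b, a \in S x z -> b \in S x y -> a - b \in S y z.
Proof.
move=> exy exz yz cE.
suff main a b : a \in S x z -> b \in S x y ->
    a - b \in S y z /\ part_colour y z != part_colour x y.
  have [_ [a aS]] := edge_gain hS exz; have [_ [b bS]] := edge_gain hS exy.
  have [abS neq] := main a b aS bS.
  split; first by split=> //; apply: (mem_gain_edge hS yz abS).
  by move=> a' b' a'S b'S; have [] := main a' b' a'S b'S.
move=> aS bS.
have [c [_ [xy _ _ pc]]] := part_colour_edge exy.
have [d [_ [xz _ _ pd]]] := part_colour_edge exz.
have cd : c = d by move: cE; rewrite pc pd => -[].
have cb : pi c (gain_hyperplane x y b) by apply/(part_colourE _ xy bS).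
have ca : pi c (gain_hyperplane x z a) by rewrite cd; apply/(part_colourE _ xz aS).
have yx : y != x by rewrite eq_sym.
have [nz third] := gain_line_adjacent b a yx xz yz.
have ef : gain_hyperplane x y b <> gain_hyperplane x z a.
  move=> ef; have := @gain_hyperplane_inj _ _ x y x z b a xy xz.
  rewrite ef => /(_ (@subset_refl _ _)).
  by case=> -[+ [+ _]] => [_ zy|xy']; [move: yz; rewrite zy | move: xy; rewrite xy'];
    rewrite eqxx.
have [Xf cX] := flat_pair (Ain xy bS) (Ain xz aS) ef nz.
have [r rc] : exists2 r, r \in met_parts (gain_arrangement S) pi
   (gain_hyperplane x y b `&` gain_hyperplane x z a) & r != c.
  apply: contrapT => no.
  have := codim_le_met_parts Ah nice Xf; rewrite cX leqNgt => /negP; apply.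
  rewrite ltnS; apply: (@leq_trans #|[set c]%SET|); last by rewrite cards1.
  apply: subset_leq_card; apply/fintype.subsetP => r rm.
  by rewrite finset.inE; apply/negPn/negP => nrc; apply: no; exists r.
move=> nrc; case/met_partsP: rc => H [rH AH XH].
have /(gain_arrangementP hS)[p [q [g [pq gS HE]]]] := AH; rewrite HE in rH XH.
have [E|E|[E pqE]] := third p q g pq XH; rewrite E in rH.
- by rewrite (part_unique rH cb) eqxx in nrc.
- by rewrite (part_unique rH ca) eqxx in nrc.
have abS : a - b \in S y z.
  case: pqE => -[pE [qE gE]]; subst p q g => //.
  by rewrite -opprB; apply: (gain_opp hS) => //; rewrite eq_sym.
split=> //; rewrite pc; have -> : part_colour y z = Some r.
  exact/(part_colourE _ yz abS).
by apply: contra nrc => /eqP[->].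
Qed.

Lemma codim_constant (D : {set 'I_n}) d : d \in D ->
  affine (@identified K n d (enum (D :\ d)%SET)) /\
  codim (@identified K n d (enum (D :\ d)%SET)) = #|D|.-1.
Proof.
move=> dD; have [] := @codim_identify K n setT d (enum (D :\ d)%SET).
- exact: affineT.
- by [].
- by rewrite /= enum_uniq mem_enum finset.setD11.
- by [].
by rewrite setTI codimT add0n -cardE (cardsD1 d D) dD.
Qed.

Lemma identifiedP (D : {set 'I_n}) d (x : 'rV[K]_n) : d \in D ->
  @identified K n d (enum (D :\ d)%SET) x <->
  (forall i j, i \in D -> j \in D -> x 0 i = x 0 j).
Proof.
move=> dD; split=> [h|h i]; last first.
  by rewrite mem_enum finset.inE => /andP[_ iD]; apply: h.
suff hd i : i \in D -> x 0 i = x 0 d by move=> i j /hd-> /hd->.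
move=> iD; have [->//|id] := eqVneq i d.
by apply: h; rewrite mem_enum !finset.inE id.
Qed.

(** One hyperplane of each colour on D makes a section, whose intersection contains
a translate of the space of points constant on D. *)
Lemma few_part_colours (D : {set 'I_n}) : D != finset.set0 ->
  (#|colours (edge G) part_colour D| < #|D|)%N.
Proof.
move=> /finset.set0Pn[d dD].
pose E := [set k | Some k \in colours (edge G) part_colour D]%SET.
have -> : #|colours (edge G) part_colour D| = #|E|.
  rewrite -(card_imset E (Some_inj : injective (@Some 'I_s))).
  apply: eq_card => -[k|]; last first.
    apply/coloursP/imsetP => [[x [y [_ _ exy]]]|[k _]//].
    by have [k [a [_ _ _ ->]]] := part_colour_edge exy; discriminate.
  by rewrite (mem_imset _ _ Some_inj) [RHS]finset.inE.
have /choice[F FP] : forall k, exists H, k \in E -> pi k H /\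
    exists i j a, [/\ i \in D, j \in D & H = gain_hyperplane i j a].
  move=> k; case: (boolP (k \in E)) => [|_]; last by exists setT.
  rewrite finset.inE => /coloursP[i [j [iD jD eij ck]]].
  have [k' [a [_ _ pk ck']]] := part_colour_edge eij.
  exists (gain_hyperplane i j a) => _; split; last by exists i, j, a.
  by move: ck; rewrite ck' => -[<-].
have [[q Fq] <-] := section_independent nice (fun k kE => (FP k kE).1).
have [Da cD] := codim_constant dD.
have Fa : affine (\bigcap_(i in [set i | i \in E]) F i).
  split; first by exists q.
  move=> a x y z Fx Fy Fz k kE; have [_ [i [j [b [_ _ FE]]]]] := FP k kE.
  have [_ [[_ _ piA] _ _]] := (I, nice).
  have /Ah/hyperplane_affine[_ Fk] : gain_arrangement S (F k).
    by rewrite -piA; exists k => //; have [] := FP k kE.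
  by apply: Fk; [apply: Fx | apply: Fy | apply: Fz].
apply: (@leq_trans (codim (@identified K n d (enum (D :\ d)%SET))).+1); last first.
  by rewrite cD prednK //; apply/card_gt0P; exists d.
rewrite ltnS; apply: (codim_le Da Fa (p := 0) (q := q)) => //.
  by apply/identifiedP => // i j; rewrite !mxE.
move=> u; rewrite add0r => /(identifiedP _ dD) uD k kE.
have [_ [i [j [b [iD jD FE]]]]] := FP k kE; have := Fq k kE; rewrite FE.
by apply: stable_gain_hyperplane; apply: uD.
Qed.

(** A minimal flat X cut out by hyperplanes on edges within D: every such edge has
constant difference on X, since otherwise X could be cut further. By connectedness
all coordinates in D differ by constants on X, so X has codimension at least
#|D| - 1, and the localization at X lies over D. *)
Lemma many_part_colours (D : {set 'I_n}) : D != finset.set0 ->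
  connected_set G D -> (#|D| <= #|colours (edge G) part_colour D|.+1)%N.
Proof.
move=> /finset.set0Pn[d dD] Dc.
pose AD : set (set 'rV[K]_n) := [set H | exists i j a,
  [/\ i \in D, j \in D, i != j, a \in S i j & H = gain_hyperplane i j a]].
have ADA : AD `<=` gain_arrangement S.
  by move=> _ [i [j [a [_ _ ij aS ->]]]]; apply: Ain.
pose P k := `[< exists X, flats AD X /\ codim X = k >].
have P0 : exists k, P k.
  exists 0%N; apply/asboolP; exists setT; split; last exact: codimT.
  by split; [exists 0 | exists set0 => //; rewrite bigcap_set0].
have Pn k : P k -> (k <= dim 'rV[K]_n)%N.
  by move=> /asboolP[Y [_ <-]]; apply: codim_le_dim.
case: (ex_maxnP P0 Pn) => k /asboolP[X [XD cX]] kmax.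
have XAD : flats (gain_arrangement S) X.
  have [nz [B BD XE]] := XD; split=> //; exists B => // H /BD; exact: ADA.
have Xa := flat_affine Ah XAD; have [x Xx] := Xa.1.
have edge_const u i j : X (x + u) -> inside G D i j -> u 0 i = u 0 j.
  move=> Xu /and3P[iD jD /(edge_gain hS)[ij [a aS]]].
  set H := gain_hyperplane i j a; have AH : AD H by exists i, j, a.
  have Hh := Ah (ADA _ AH).
  have [XH|nXH] := EM (X `<=` H).
    exact: (stable_gain_hyperplane_inv (XH _ Xx) (XH _ Xu)).
  have [st|nst] := EM (stable u H).
    have [[h Hh'] _] := hyperplane_affine Hh.
    exact: stable_gain_hyperplane_inv Hh' (st _ Hh').
  have [t Ht] := hyperplane_meets_line x Hh nst.
  have XHnz : X `&` H !=set0.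
    exists (x + t *: u); split=> //.
    have [_ Xc] := Xa; have := Xc t x (x + u) x Xx Xu Xx.
    by rewrite [x + u]addrC addrK.
  have : (k.+1 <= k)%N; last by rewrite ltnn.
  apply: kmax; apply/asboolP; exists (X `&` H); split.
    have [_ [B BD XE]] := XD; split=> //; exists (B `|` [set H]).
      by rewrite subUset; split=> // _ ->.
    by rewrite bigcap_setU bigcap_set1 -XE.
  by rewrite codim_hyperplaneI // cX.
have [Da cD] := codim_constant dD.
have cDX : (#|D|.-1 <= codim X)%N.
  rewrite -cD; apply: (codim_le Xa Da Xx (q := 0)).
    by apply/identifiedP => // i j; rewrite !mxE.
  move=> u Xu; rewrite add0r; apply/identifiedP => // i j iD jD.
  by apply: (connect_const (e := inside G D)) (Dc _ _ iD jD) => a b; apply: edge_const.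
have D0 : (0 < #|D|)%N by apply/card_gt0P; exists d.
rewrite -(prednK D0) ltnS; apply: leq_trans cDX _.
apply: leq_trans (codim_le_met_parts Ah nice XAD) _.
rewrite -(card_imset _ (Some_inj : injective (@Some 'I_s))).
apply: subset_leq_card; apply/fintype.subsetP => c.
move=> /imsetP[r /met_partsP[H [rH AH XH]] ->].
have /(gain_arrangementP hS)[p [q [g [pq gS HE]]]] := AH; rewrite HE in rH XH.
have [pD qD] : p \in D /\ q \in D.
  apply: (linked_within pq); apply: gain_hyperplane_link (Xx) _ XH => Z DZ.
  have [_ [B BD XE]] := XD; rewrite XE => L BL.
  have [i [j [b [iD jD _ _ LE]]]] := BD _ BL; rewrite LE.
  apply: stable_gain_hyperplane; last by rewrite -LE; move: Xx; rewrite XE; apply.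
  exact: (indicator_const _ DZ).
apply/coloursP; exists p, q; split=> //; first exact: (mem_gain_edge hS pq gS).
exact/(part_colourE _ pq gS).
Qed.

Lemma part_rank_colouring : rank_colouring G part_colour.
Proof.
split; [exact: part_colour_sym|by move=> *; apply: part_disjoint| |].
  exact: few_part_colours.
exact: many_part_colours.
Qed.

End Colouring.

Lemma blockwise_admissible_of_elim (K : fieldType) (n : nat) (G : graph 'I_n)
    (S : 'I_n -> 'I_n -> {fset K}) :
  (forall i, i \in vertices G) -> gain_sets G S ->
  (forall W, block_set G W -> (1 < #|W|)%N ->
    elim (gain_simplicial S) finset.set0 W) -> blockwise_admissible G S.
Proof.
move=> hG hS h B /(is_block_set hG)[Bb BE].
apply: (elim_admissible hS BE).
have [W1|W1] := leqP #|vertices B| 1; last exact: h.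
by apply: elim_small W1 => x y z; rewrite finset.inE.
Qed.

Lemma nice_blockwise_admissible (K : fieldType) (n : nat) (G : graph 'I_n)
    (S : 'I_n -> 'I_n -> {fset K}) :
  (forall i, i \in vertices G) -> gain_sets G S ->
  has_nice_partition (gain_arrangement S) -> blockwise_admissible G S.
Proof.
move=> hG hS [s [pi nice]]; apply: blockwise_admissible_of_elim => // W [Wns _] W1.
apply: (block_elim hS (part_rank_colouring hS nice)) => //.
  by move=> x y z xy xz yz c; have [] := part_adjacent hS nice xy xz yz c.
by move=> x y z xy xz yz c; have [] := part_adjacent hS nice xy xz yz c.
Qed.

End NicePartitions.

(** * The cone *)

Section ConeGeometry.
Import GRing.Theory.
Local Open Scope classical_set_scope.
Local Open Scope ring_scope.
Variables (K : fieldType) (n : nat).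
Implicit Types (i j k l p q : 'I_n) (a b c : K) (x u : 'rV[K]_n).
Implicit Types (z : 'rV[K]_(n + 1)).

Local Notation cgh := (@cone_gain_hyperplane K n).
Local Notation Hinf := (hyperplane_at_infinity K n).

(** Statements on the affine arrangement transfer to the cone through the slice at
height one, and the hyperplane at infinity is the slice at height zero. *)
Definition at_height (y : K) x : 'rV[K]_(n + 1) := row_mx x (const_mx y).

Lemma at_heightl y x i : at_height y x 0 (lshift 1 i) = x 0 i.
Proof. by rewrite /at_height row_mxEl. Qed.

Lemma at_heightr y x : at_height y x 0 (rshift n ord0) = y.
Proof. by rewrite /at_height row_mxEr mxE. Qed.

Lemma cone_gain_slice i j a x : cgh i j a (at_height 1 x) <-> gain_hyperplane i j a x.
Proof.
by rewrite /cone_gain_hyperplane /gain_hyperplane /= !at_heightl at_heightr mulr1.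
Qed.

Lemma cone_gain_bottom i j a x : cgh i j a (at_height 0 x) <-> x 0 i = x 0 j.
Proof.
rewrite /cone_gain_hyperplane /= !at_heightl at_heightr mulr0.
by split=> [/eqP|->]; rewrite ?subrr // subr_eq0 => /eqP.
Qed.

Lemma infinity_at_height y x : Hinf (at_height y x) <-> y = 0.
Proof. by rewrite /hyperplane_at_infinity /= at_heightr. Qed.

Lemma cone_gain_hyperplaneP i j a : i != j -> hyperplane (cgh i j a).
Proof.
move=> ij.
exists (fun z => z 0 (lshift 1 i) - z 0 (lshift 1 j) - a * z 0 (rshift n ord0)), 0.
split.
- move=> b u v; rewrite !mxE !mulrBr mulrDr !opprD [b * (a * _)]mulrCA.
  rewrite [X in X + _ = _]addrACA; exact: addrACA.
- exists (at_height 0 (indicator K [set i]%SET)).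
  rewrite !at_heightl at_heightr mulr0 subr0 subr_eq0 indicator_eq !inE eqxx.
  by rewrite eq_sym [j == i]eq_sym (negPf ij).
- apply/seteqP; split=> z; rewrite /cone_gain_hyperplane /=.
    by move=> ->; rewrite subrr.
  by move=> /eqP; rewrite subr_eq0 => /eqP.
Qed.

Lemma infinity_hyperplane : hyperplane Hinf.
Proof.
exists (fun z => z 0 (rshift n ord0)), 0; split=> //.
- by move=> b u v; rewrite /= !mxE.
- by exists (at_height 1 0); rewrite at_heightr oner_eq0.
Qed.

Lemma cone_gain_sym i j a : cgh i j a = cgh j i (- a).
Proof.
apply/seteqP; split=> z; rewrite /cone_gain_hyperplane /= mulNr => h.
  by rewrite -h opprB.
by rewrite -[RHS]opprK -h opprB.
Qed.

Lemma cone_gain_zero i j a : cgh i j a 0.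
Proof. by rewrite /cone_gain_hyperplane /= !mxE subrr mulr0. Qed.

Lemma cone_gain_neq_infinity i j a : i != j -> cgh i j a <> Hinf.
Proof.
move=> ij E; have [[x gx] _] := hyperplane_affine (gain_hyperplaneP a ij).
have : Hinf (at_height 1 x) by rewrite -E; apply/cone_gain_slice.
by move/infinity_at_height/eqP; rewrite oner_eq0.
Qed.

Lemma cone_gain_sub_gain i j a p q c : cgh i j a `<=` cgh p q c ->
  gain_hyperplane i j a `<=` gain_hyperplane p q c.
Proof. by move=> sub x /cone_gain_slice/sub/cone_gain_slice. Qed.

Lemma cone_gain_subI i j a k l b p q c : cgh i j a `&` cgh k l b `<=` cgh p q c ->
  gain_hyperplane i j a `&` gain_hyperplane k l b `<=` gain_hyperplane p q c.
Proof.
by move=> sub x [/cone_gain_slice h /cone_gain_slice h']; apply/cone_gain_slice/sub.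
Qed.

Lemma cone_gain_inj i j p q a c : i != j -> p != q -> cgh i j a = cgh p q c ->
  p = i /\ q = j /\ c = a \/ p = j /\ q = i /\ c = - a.
Proof.
move=> ij pq E; apply: gain_hyperplane_inj => //; apply: cone_gain_sub_gain.
by rewrite E.
Qed.

Lemma gain_hyperplane_cone i j p q a c : i != j -> p != q ->
  gain_hyperplane i j a = gain_hyperplane p q c -> cgh i j a = cgh p q c.
Proof.
move=> ij pq E.
have [|[-> [-> ->]]|[-> [-> ->]]] // := @gain_hyperplane_inj _ _ i j p q a c ij pq.
  by rewrite E.
exact: cone_gain_sym.
Qed.

Lemma cone_gain_parallel_infinity i j a b : a != b -> cgh i j a `&` cgh i j b `<=` Hinf.
Proof.
move=> ab z [za zb]; apply/eqP; move: za; rewrite /cone_gain_hyperplane /= zb.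
by move/eqP; rewrite -subr_eq0 -mulrBl mulf_eq0 subr_eq0 eq_sym (negPf ab).
Qed.

Lemma cone_gain_infinity_parallel i j a b : cgh i j a `&` Hinf `<=` cgh i j b.
Proof.
by move=> z [+ z0]; rewrite /cone_gain_hyperplane /= z0 !mulr0.
Qed.

Lemma cone_gain_triangle i j k a b : cgh j i a `&` cgh j k b `<=` cgh i k (b - a).
Proof.
move=> z []; rewrite /cone_gain_hyperplane /= mulrBl => <- <-.
by rewrite opprB [RHS]addrC addrA subrK.
Qed.

Lemma cone_gain_infinity_sub i j a p q c : i != j -> p != q ->
  cgh i j a `&` Hinf `<=` cgh p q c -> p = i /\ q = j \/ p = j /\ q = i.
Proof.
move=> ij pq sub.
have [] := @linked_within n [set i; j]%SET p q pq.
  move=> Z DZ; apply/eqP; rewrite -(@indicator_eq K); apply/eqP.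
  apply/(cone_gain_bottom _ _ c)/sub; split; last exact/infinity_at_height.
  by apply/cone_gain_bottom/(indicator_const _ DZ); rewrite !inE eqxx ?orbT.
rewrite !inE => /orP[]/eqP pE /orP[]/eqP qE; subst p q; move: pq;
  rewrite ?eqxx // => _; first [by left | by right].
Qed.

Section Arrangement.
Variables (G : graph 'I_n) (S : 'I_n -> 'I_n -> {fset K}).
Hypothesis hS : gain_sets G S.

Lemma cone_arrangementP H : cone_arrangement S H <->
  H = Hinf \/ exists i j a, [/\ i != j, a \in S i j & H = cgh i j a].
Proof.
split=> [[[i [j [a [ij aS HE]]]]|->]|[->|[i [j [a [ij aS HE]]]]]].
- by right; exists i, j, a; split=> //; move: ij; rewrite ltn_neqAle => /andP[].
- by left.
- by right.
have := ij; rewrite -val_eqE /= neq_ltn => /orP[lt|lt]; left.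
  by exists i, j, a.
exists j, i, (- a); split=> //; first exact: (gain_opp hS).
by rewrite HE cone_gain_sym.
Qed.

Lemma cone_arrangement_hyperplane H : cone_arrangement S H -> hyperplane H.
Proof.
move=> /cone_arrangementP[->|[i [j [a [ij _ ->]]]]]; first exact: infinity_hyperplane.
exact: cone_gain_hyperplaneP.
Qed.

Lemma cone_arrangement_zero H : cone_arrangement S H -> H 0.
Proof.
move=> /cone_arrangementP[->|[i [j [a [ij _ ->]]]]]; last exact: cone_gain_zero.
by rewrite /hyperplane_at_infinity /= mxE.
Qed.

Lemma cone_gain_in_cone i j a : i != j -> a \in S i j -> cone_arrangement S (cgh i j a).
Proof. by move=> ij aS; apply/cone_arrangementP; right; exists i, j, a. Qed.

Lemma infinity_in_cone : cone_arrangement S Hinf.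
Proof. by apply/cone_arrangementP; left. Qed.

Lemma cone_line_disjoint i j k l a b g : i != j -> k != l ->
  [/\ i != k, i != l, j != k & j != l] -> cone_arrangement S g ->
  cgh i j a `&` cgh k l b `<=` g -> g = cgh i j a \/ g = cgh k l b.
Proof.
move=> ij kl dis /cone_arrangementP Ag sub.
have [[x [xa xb]] third] := gain_line_disjoint a b ij kl dis.
case: Ag => [gE|[p [q [c [pq cS gE]]]]]; subst g.
  have : Hinf (at_height 1 x) by apply: sub; split; apply/cone_gain_slice.
  by move=> /infinity_at_height/eqP; rewrite oner_eq0.
have [E|E] := third p q c pq (cone_gain_subI sub); [left|right];
  exact: gain_hyperplane_cone E.
Qed.

Lemma cone_line_adjacent i j k a b g : i != j -> j != k -> i != k ->
  cone_arrangement S g -> cgh j i a `&` cgh j k b `<=` g ->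
  [\/ g = cgh j i a, g = cgh j k b |
      g = cgh i k (b - a) /\ b - a \in S i k].
Proof.
move=> ij jk ik /cone_arrangementP Ag sub.
have ji : j != i by rewrite eq_sym.
have [[x [xa xb]] third] := gain_line_adjacent a b ij jk ik.
case: Ag => [gE|[p [q [c [pq cS gE]]]]]; subst g.
  have : Hinf (at_height 1 x) by apply: sub; split; apply/cone_gain_slice.
  by move=> /infinity_at_height/eqP; rewrite oner_eq0.
have [E|E|[E pqc]] := third p q c pq (cone_gain_subI sub).
- by constructor 1; apply: gain_hyperplane_cone E.
- by constructor 2; apply: gain_hyperplane_cone E.
constructor 3; split; first exact: gain_hyperplane_cone E.
case: pqc => -[pE [qE cE]]; subst p q c => //.
by rewrite -opprB; apply: (gain_opp hS) => //; rewrite eq_sym.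
Qed.

End Arrangement.

(** The trace at infinity of the points constant on D. *)
Definition bottom_constant (D : {set 'I_n}) : set 'rV[K]_(n + 1) :=
  [set z | Hinf z /\ forall i j, i \in D -> j \in D ->
     z 0 (lshift 1 i) = z 0 (lshift 1 j)].

Lemma codim_bottom_constant (D : {set 'I_n}) : D != finset.set0 ->
  affine (bottom_constant D) /\ codim (bottom_constant D) = #|D|.
Proof.
move=> /finset.set0Pn[d dD].
pose s := [seq lshift 1 i | i <- enum (D :\ d)%SET].
have -> : bottom_constant D = Hinf `&` identified (lshift 1 d) s.
  apply/seteqP; split=> z [z0 h]; split=> //.
    move=> _ /mapP[i + ->]; rewrite mem_enum finset.inE => /andP[_ iD].
    exact: h.
  suff hd i : i \in D -> z 0 (lshift 1 i) = z 0 (lshift 1 d).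
    by move=> i j /hd-> /hd->.
  move=> iD; have [->//|id] := eqVneq i d.
  by apply: h; apply: map_f; rewrite mem_enum !finset.inE id.
have [||||Da cD] := @codim_identify K _ Hinf (lshift 1 d) s.
- exact/hyperplane_affine/infinity_hyperplane.
- by rewrite /hyperplane_at_infinity /= mxE.
- rewrite /= (map_inj_uniq (@lshift_inj _ _)) enum_uniq andbT.
  apply/mapP => -[i + /lshift_inj iE]; rewrite mem_enum -iE.
  by rewrite finset.setD11.
- move=> _ /mapP[i _ ->] z; rewrite /hyperplane_at_infinity /= !mxE => ->.
  rewrite add0r !inE; case: eqP => // /eqP.
  by rewrite eq_rlshift.
split=> //; rewrite cD (codim_hyperplane infinity_hyperplane) size_map -cardE.
by rewrite [RHS](cardsD1 d D) dD.
Qed.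

Lemma bottom_constant_sub (D : {set 'I_n}) p q c : p != q ->
  bottom_constant D `<=` cgh p q c <-> p \in D /\ q \in D.
Proof.
move=> pq; split=> [sub|[pD qD] z [z0 h]]; last first.
  by rewrite /cone_gain_hyperplane /= z0 mulr0 (h p q) // subrr.
apply: (linked_within pq) => Z DZ; apply/eqP; rewrite -(@indicator_eq K); apply/eqP.
apply/(cone_gain_bottom _ _ c)/sub; split; first exact/infinity_at_height.
by move=> i j iD jD; rewrite !at_heightl; apply: (indicator_const _ DZ).
Qed.

End ConeGeometry.

(** * From modular chains to admissible orderings *)

Section ConeLevels.
Import GRing.Theory.
Local Open Scope classical_set_scope.
Local Open Scope ring_scope.
Variables (K : fieldType) (n : nat) (G : graph 'I_n).
Variable S : 'I_n -> 'I_n -> {fset K}.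
Hypothesis hS : gain_sets G S.
Implicit Types (D W : {set 'I_n}).
Local Notation cgh := (@cone_gain_hyperplane K n).
Local Notation Hinf := (hyperplane_at_infinity K n).
Variables (rho : set 'rV[K]_(n + 1) -> nat) (N : nat).
Hypothesis rhoN : forall H, cone_arrangement S H -> (rho H < N.+1)%N.
Hypothesis rho_level : level_function (cone_arrangement S) rho.

Let t := rho Hinf.
Let lev i j a := rho (cgh i j a).
Let Ain := cone_gain_in_cone hS.
Let Ah := cone_arrangement_hyperplane hS.
Let Ainf := infinity_in_cone hS.

Lemma lev_sym i j a : lev i j a = lev j i (- a).
Proof. by rewrite /lev cone_gain_sym. Qed.

Lemma level_span e f g : cone_arrangement S e -> cone_arrangement S f ->
  cone_arrangement S g -> e `&` f `<=` g -> (rho e < rho g)%N ->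
  (rho f < rho g)%N -> False.
Proof.
move=> Ae Af Ag sub re rf; apply: (rho_level.2 _ Ag) => x lx.
by apply: sub; split; apply: lx.
Qed.

(** The flat spanned by the hyperplanes below H_infinity has a point of height
one; switching by its coordinates makes all of these have gain zero. *)
Lemma potential_exists : exists phi : 'I_n -> K, forall i j a, i != j ->
  a \in S i j -> (lev i j a < t)%N -> a = phi i - phi j.
Proof.
have /existsNP[z /not_implyP[lz nz]] := rho_level.2 _ Ainf.
have z0 : z 0 (rshift n ord0) != 0 by apply/eqP.
exists (fun i => z 0 (lshift 1 i) / z 0 (rshift n ord0)) => i j a ij aS lt.
have : cgh i j a z by apply: lz; split=> //; apply: Ain.
by rewrite /cone_gain_hyperplane /= -mulrBl => ->; rewrite mulfK.
Qed.

Variable phi : 'I_n -> K.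
Hypothesis phiP : forall i j a, i != j -> a \in S i j -> (lev i j a < t)%N ->
  a = phi i - phi j.

Definition tau i j := phi i - phi j.

Lemma tau_sym i j : tau i j = - tau j i.
Proof. by rewrite /tau opprB. Qed.

Lemma tau_sub x y z : tau x z - tau x y = tau y z.
Proof. by rewrite /tau opprB addrC addrA subrK. Qed.

(** Edges with a hyperplane below H_infinity; all their other hyperplanes are at
the level of H_infinity. The hyperplanes of the other edges are above it. *)
Definition low i j := (tau i j \in S i j) && (lev i j (tau i j) < t)%N.

Lemma low_sym i j : i != j -> low i j = low j i.
Proof.
move=> ij; rewrite /low lev_sym -tau_sym; congr (_ && _).
have ji : j != i by rewrite eq_sym.
by apply/idP/idP => h; rewrite tau_sym; apply: (gain_opp hS).
Qed.

Lemma low_other_gain i j a : i != j -> low i j -> a \in S i j -> a != tau i j ->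
  lev i j a = t.
Proof.
move=> ij /andP[tS lt] aS nat; apply/eqP; rewrite eqn_leq; apply/andP; split.
  rewrite leqNgt; apply/negP => ta.
  apply: (@level_span (cgh i j (tau i j)) Hinf (cgh i j a)) => //; try exact: Ain.
    exact: cone_gain_infinity_parallel.
  exact: ltn_trans lt ta.
rewrite leqNgt; apply/negP => /(phiP ij aS) E.
by move: nat; rewrite E eqxx.
Qed.

Lemma high_gain_gt i j a : i != j -> ~~ low i j -> a \in S i j -> (t < lev i j a)%N.
Proof.
move=> ij nlow aS; have nlt b : b \in S i j -> ~~ (lev i j b < t)%N.
  move=> bS; apply/negP => lt; have bE := phiP ij bS lt.
  by move: nlow; rewrite /low /tau -bE bS lt.
rewrite ltn_neqAle leqNgt nlt // andbT; apply/negP => /eqP E.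
have [g [/(cone_arrangementP hS) Ag rg sub]] :=
  rho_level.1 _ _ (Ain ij aS) Ainf (cone_gain_neq_infinity ij) (esym E).
case: Ag => [gE|[p [q [c [pq cS gE]]]]]; subst g.
  by move: rg; rewrite -/(lev i j a) -E ltnn.
have lt : (lev p q c < t)%N by rewrite E.
have [[pE qE]|[pE qE]] := cone_gain_infinity_sub ij pq sub; subst p q.
  by move: lt; apply/negP/nlt.
move: lt; rewrite lev_sym; apply/negP/nlt.
by apply: (gain_opp hS).
Qed.

Lemma high_gain_eq i j a b : i != j -> ~~ low i j -> a \in S i j ->
  b \in S i j -> lev i j a = lev i j b.
Proof.
move=> ij nlow; suff le c d : c \in S i j -> d \in S i j -> (lev i j c <= lev i j d)%N.
  by move=> aS bS; apply/eqP; rewrite eqn_leq !le.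
move=> cS dS; rewrite leqNgt; apply/negP => lt.
apply: (@level_span (cgh i j d) Hinf (cgh i j c)) => //; try exact: Ain.
  exact: cone_gain_infinity_parallel.
exact: high_gain_gt.
Qed.

(** All hyperplanes of the edge have this level, apart from those at the level of
H_infinity on a low edge. The head of the list of gains is an arbitrary gain, as
the others have the same level. *)
Definition edge_level i j : nat :=
  if low i j then lev i j (tau i j) else lev i j (head 0 (enum_fset (S i j))).

Lemma edge_level_gain i j : edge G i j -> exists a,
  [/\ i != j, a \in S i j, lev i j a = edge_level i j & low i j -> a = tau i j].
Proof.
move=> /(edge_gain hS)[ij [b bS]]; rewrite /edge_level.
case: ifP => lowij; first by exists (tau i j); split=> //; case/andP: lowij.
exists (head 0 (enum_fset (S i j))); split=> //.
have headP (r : seq K) : b \in r -> head 0 r \in r.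
  by case: r => //= c r _; rewrite mem_head.
exact: (headP (enum_fset (S i j))).
Qed.

Lemma gain_edge_level i j a : i != j -> a \in S i j ->
  lev i j a = edge_level i j \/ low i j /\ lev i j a = t.
Proof.
move=> ij aS; have [b [_ bS <- bt]] := edge_level_gain (mem_gain_edge hS ij aS).
case: (boolP (low i j)) => lowij; last by left; apply: high_gain_eq.
have [aE|/low_other_gain E] := eqVneq a (tau i j).
  by left; rewrite aE -(bt lowij).
by right; split=> //; apply: E.
Qed.

Lemma high_gain_level i j a : i != j -> ~~ low i j -> a \in S i j ->
  lev i j a = edge_level i j.
Proof.
by move=> ij nlow aS; have [//|[]] := gain_edge_level ij aS; rewrite (negPf nlow).
Qed.

Lemma low_level i j : edge G i j -> low i j = (edge_level i j < t)%N.
Proof.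
move=> eij; have [a [ij aS <- at_]] := edge_level_gain eij.
case: (boolP (low i j)) => lowij; first by rewrite at_ //; case/andP: lowij => _ ->.
by have := high_gain_gt ij lowij aS; rewrite ltnNge => /negP h; apply/esym/negP =>
  /ltnW.
Qed.

Lemma edge_level_neq i j : edge G i j -> edge_level i j != t.
Proof.
move=> eij; case: (boolP (low i j)) => lowij.
  by move: lowij; rewrite low_level // neq_ltn => ->.
have [a [ij aS <- _]] := edge_level_gain eij.
by rewrite neq_ltn (high_gain_gt ij lowij aS) orbT.
Qed.

Lemma edge_level_sym i j : edge_level i j = edge_level j i.
Proof.
have [->//|ij] := eqVneq i j; have ji : j != i by rewrite eq_sym.
have [eij|neij] := boolP (edge G i j); last first.
  have S0 x y : x != y -> ~~ edge G x y -> S x y = fset0.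
    by move=> xy; rewrite -(hS xy).2 negbK => /eqP.
  rewrite /edge_level /low !S0 // 1?edge_sym // /lev.
  have -> : enum_fset (fset0 : {fset K}) = [::] by [].
  by rewrite /= cone_gain_sym oppr0.
case: (boolP (low i j)) => lowij.
  by rewrite /edge_level -(low_sym ij) lowij lev_sym -tau_sym.
have [a [_ aS <- _]] := edge_level_gain eij.
rewrite lev_sym high_gain_level //; last exact: (gain_opp hS).
by rewrite -low_sym.
Qed.

Lemma same_level_disjoint i j k l a b : i != j -> k != l -> a \in S i j ->
  b \in S k l -> lev i j a = lev k l b -> [|| i == k, i == l, j == k | j == l].
Proof.
move=> ij kl aS bS E; apply: contrapT => /negP; rewrite !negb_or => /and4P[ik il jk jl].
have ef : cgh i j a <> cgh k l b.
  by move=> /(cone_gain_inj ij kl)[[kE _]|[kE _]]; move: ik jk; rewrite kE eqxx.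
have [g [Ag rg sub]] := rho_level.1 _ _ (Ain ij aS) (Ain kl bS) ef E.
by have [gE|gE] := cone_line_disjoint hS ij kl (And4 ik il jk jl) Ag sub;
  move: rg; rewrite gE -?[rho (cgh k l b)]/(lev k l b) -?E ltnn.
Qed.

(** The lower hyperplane through the intersection can only be the third side. *)
Lemma same_level_adjacent x y z a b : x != y -> x != z -> y != z ->
  b \in S x y -> a \in S x z -> lev x y b = lev x z a ->
  a - b \in S y z /\ (lev y z (a - b) < lev x y b)%N.
Proof.
move=> xy xz yz bS aS E; have yx : y != x by rewrite eq_sym.
have ef : cgh x y b <> cgh x z a.
  move=> /(cone_gain_inj xy xz)[[_ [zy _]]|[xy' _]]; first by rewrite zy eqxx in yz.
  by rewrite xy' eqxx in xy.
have [g [Ag rg sub]] := rho_level.1 _ _ (Ain xy bS) (Ain xz aS) ef E.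
have [gE|gE|[gE abS]] := cone_line_adjacent hS yx xz yz Ag sub; last by rewrite /lev -gE.
  by move: rg; rewrite gE ltnn.
by move: rg; rewrite gE -/(lev x z a) -E ltnn.
Qed.

Lemma edge_level_third x y z : edge G x y -> edge G x z -> y != z ->
  edge_level x y = edge_level x z ->
  edge G y z /\ (edge_level y z < edge_level x y)%N.
Proof.
move=> exy exz yz; have [b [xy bS <- _]] := edge_level_gain exy.
have [a [xz aS <- _]] := edge_level_gain exz => E.
have [abS lt] := same_level_adjacent xy xz yz bS aS E.
split; first exact: (mem_gain_edge hS yz abS).
have [<-//|[lowyz ltt]] := gain_edge_level yz abS; apply: ltn_trans lt.
by rewrite ltt -low_level // (mem_gain_edge hS yz abS).
Qed.

Lemma high_third_gain x y z a b : edge G x y -> edge G x z -> y != z ->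
  edge_level x y = edge_level x z -> ~~ low x y -> a \in S x z -> b \in S x y ->
  a - b \in S y z.
Proof.
move=> exy exz yz E nlow aS bS.
have [_ [xy _ _ _]] := edge_level_gain exy.
have [_ [xz _ _ _]] := edge_level_gain exz.
have nlow' : ~~ low x z by rewrite low_level // -E -low_level.
have lE : lev x y b = lev x z a by rewrite !high_gain_level.
by have [] := same_level_adjacent xy xz yz bS aS lE.
Qed.

Lemma edge_level_lt i j : edge G i j -> (edge_level i j < N.+1)%N.
Proof.
move=> eij; have [a [ij aS <- _]] := edge_level_gain eij.
exact/rhoN/Ain.
Qed.

Definition level_colour i j : 'I_N.+1 := inord (edge_level i j).

Lemma level_colourE i j : edge G i j -> level_colour i j = edge_level i j :> nat.
Proof. by move=> eij; rewrite inordK // edge_level_lt. Qed.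

Lemma level_colour_eq i j k l : edge G i j -> edge G k l ->
  level_colour i j = level_colour k l -> edge_level i j = edge_level k l.
Proof. by move=> eij ekl E; rewrite -!level_colourE // E. Qed.

(** The levels in this localization are that of H_infinity and the colours on D. *)
Lemma codim_localization_bottom (D : {set 'I_n}) : D != finset.set0 ->
  codim (\bigcap_(H in localization (cone_arrangement S) (bottom_constant D)) H) =
  #|colours (edge G) level_colour D|.+1.
Proof.
move=> D0.
rewrite (rank_level_closed Ah (cone_arrangement_zero hS) rhoN rho_level); last first.
- exact/localization_level_closed/(rho_level.1).
- by move=> H [].
have tN : (t < N.+1)%N by apply: rhoN.
pose c := inord t : 'I_N.+1.
have cE : c = t :> nat by rewrite inordK.
have -> : #|colours (edge G) level_colour D|.+1 =
    #|c |: colours (edge G) level_colour D|%SET.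
  rewrite cardsU1; suff -> : c \notin colours (edge G) level_colour D by [].
  apply/coloursP => -[x [y [_ _ exy /(congr1 val)/=]]].
  by rewrite level_colourE // cE => /eqP; rewrite (negPf (edge_level_neq exy)).
rewrite -sum1_card [RHS]big_mkcond /=; apply: eq_bigr => i _.
suff -> : occupied (localization (cone_arrangement S) (bottom_constant D)) rho i =
  (i \in (c |: colours (edge G) level_colour D)%SET) by case: ifP.
apply/asboolP/finset.setU1P => [[H [AH DH] rH]|[->|]].
- have := AH => /(cone_arrangementP hS)[HE|[p [q [a [pq aS HE]]]]]; subst H.
    by left; apply: val_inj; rewrite /= cE -rH.
  have [pD qD] : p \in D /\ q \in D by apply/(bottom_constant_sub _ _ pq)/DH.
  have epq := mem_gain_edge hS pq aS.
  have [E|[_ E]] := gain_edge_level pq aS; [right|left].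
    apply/coloursP; exists p, q; split=> //; apply: val_inj.
    by rewrite /= level_colourE // -E.
  by apply: val_inj; rewrite /= cE -E.
- by exists Hinf => //; split=> // z [].
case/coloursP=> p [q [pD qD epq <-]].
have [a [pq aS aE _]] := edge_level_gain epq.
exists (cgh p q a); last by rewrite level_colourE.
by split; [apply: Ain | apply/bottom_constant_sub].
Qed.

Lemma few_level_colours (D : {set 'I_n}) : D != finset.set0 ->
  (#|colours (edge G) level_colour D| < #|D|)%N.
Proof.
move=> D0; rewrite -codim_localization_bottom //.
have [Da <-] := @codim_bottom_constant K n D D0.
have sub : bottom_constant D `<=`
    \bigcap_(H in localization (cone_arrangement S) (bottom_constant D)) H.
  by move=> z Dz H [_]; apply.
apply: codimS => //; apply: affine_bigcap; first by move=> H [/Ah/hyperplane_affine].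
by have [z Dz] := Da.1; exists z; apply: sub.
Qed.

Lemma many_level_colours (D : {set 'I_n}) : D != finset.set0 ->
  connected_set G D -> (#|D| <= #|colours (edge G) level_colour D|.+1)%N.
Proof.
move=> D0 Dc; rewrite -codim_localization_bottom //.
have [Da <-] := @codim_bottom_constant K n D D0.
have sub : bottom_constant D `<=`
    \bigcap_(H in localization (cone_arrangement S) (bottom_constant D)) H.
  by move=> z Dz H [_]; apply.
apply: codimS => //.
  apply: affine_bigcap; first by move=> H [/Ah/hyperplane_affine].
  by have [z Dz] := Da.1; exists z; apply: sub.
move=> z lz; have z0 : Hinf z by apply: lz; split=> // w [].
split=> // i j iD jD.
apply: (connect_const (f := fun i => z 0 (lshift 1 i)) _ (Dc _ _ iD jD)) => p q.
move=> /and3P[pD qD /edge_level_gain[a [pq aS _ _]]].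
have : cgh p q a z.
  by apply: lz; split; [apply: Ain|apply/bottom_constant_sub].
rewrite /cone_gain_hyperplane /= z0 mulr0 => /eqP.
by rewrite subr_eq0 => /eqP.
Qed.

Lemma level_rank_colouring : rank_colouring G level_colour.
Proof.
split.
- by move=> x y; rewrite /level_colour edge_level_sym.
- move=> x y z w exy ezw /(level_colour_eq exy ezw).
  have [a [xy aS <- _]] := edge_level_gain exy.
  have [b [zw bS <- _]] := edge_level_gain ezw.
  exact: same_level_disjoint.
- exact: few_level_colours.
- exact: many_level_colours.
Qed.

Lemma level_colour_third x y z : edge G x y -> edge G x z -> y != z ->
  level_colour x y = level_colour x z ->
  edge G y z /\ (level_colour y z < level_colour x y)%N.
Proof.
move=> exy exz yz /(level_colour_eq exy exz) E.
have [eyz lt] := edge_level_third exy exz yz E.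
by rewrite !level_colourE.
Qed.

(** Gains of a low edge that do not vanish after switching. *)
Definition extra x y a := [&& x != y, a \in S x y, low x y & a != tau x y].

Lemma extra_opp x y a : extra x y a -> extra y x (- a).
Proof.
move=> /and4P[xy aS lowxy nat]; apply/and4P; split.
- by rewrite eq_sym.
- exact: (gain_opp hS).
- by rewrite -low_sym.
- by rewrite tau_sym eqr_opp.
Qed.

Lemma extra_level x y a : extra x y a -> lev x y a = t.
Proof. by move=> /and4P[xy aS lowxy nat]; apply: low_other_gain. Qed.

Lemma extra_meet i j k l a b : extra i j a -> extra k l b ->
  [|| i == k, i == l, j == k | j == l].
Proof.
move=> ea eb; have := extra_level ea; have := extra_level eb.
move: ea eb => /and4P[ij aS _ _] /and4P[kl bS _ _] Eb Ea.
by apply: (same_level_disjoint ij kl aS bS); rewrite Ea.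
Qed.

(** Both hyperplanes lie at the level of H_infinity, so the third side is below it
and has gain zero after switching: up to switching the two gains are equal. *)
Lemma extra_adjacent x y z a b : y != z -> extra x y b -> extra x z a ->
  [/\ edge G y z, low y z & a - b = tau y z].
Proof.
move=> yz eb ea; have := extra_level ea; have := extra_level eb.
move: ea eb => /and4P[xz aS _ _] /and4P[xy bS _ _] Eb Ea.
have [abS lt] := same_level_adjacent xy xz yz bS aS (etrans Eb (esym Ea)).
rewrite Eb in lt; have E := phiP yz abS lt.
by split; [apply: (mem_gain_edge hS yz abS) | rewrite /low /tau -E abS | ].
Qed.

Definition extra_edge (W : {set 'I_n}) x y :=
  [&& x \in W, y \in W & `[< exists a, extra x y a >]].

Lemma extra_edgeP W x y : reflect
  [/\ x \in W, y \in W & exists a, extra x y a] (extra_edge W x y).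
Proof.
apply: (iffP and3P) => -[xW yW]; first by move/asboolP.
by move=> h; split=> //; apply/asboolP.
Qed.

Lemma extra_edge_sym W x y : extra_edge W x y = extra_edge W y x.
Proof.
by apply/extra_edgeP/extra_edgeP => -[xW yW [a /extra_opp ea]]; split=> //;
  exists (- a).
Qed.

Lemma extra_edge_meet W i j k l : extra_edge W i j -> extra_edge W k l ->
  [|| i == k, i == l, j == k | j == l].
Proof.
by move=> /extra_edgeP[_ _ [a ea]] /extra_edgeP[_ _ [b eb]]; apply: extra_meet ea eb.
Qed.

Definition extra_ends (W : {set 'I_n}) : {set 'I_n} :=
  [set x | [exists y, extra_edge W x y]]%SET.

Lemma extra_endsP W x : reflect (exists y, extra_edge W x y) (x \in extra_ends W).
Proof. by rewrite finset.inE; apply: existsP. Qed.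

Lemma extra_edge_edge W x y : extra_edge W x y -> edge G x y /\ low x y.
Proof.
move=> /extra_edgeP[_ _ [a /and4P[xy aS lowxy _]]].
by split=> //; apply: (mem_gain_edge hS xy aS).
Qed.

(** Two ends that are not joined by an extra edge are joined to a common vertex. *)
Lemma extra_ends_clique W : clique (edge G) (extra_ends W).
Proof.
move=> j k /extra_endsP[j' jj'] /extra_endsP[k' kk'] jk.
have := extra_edge_meet jj' kk'; rewrite (negPf jk) /= => /or3P[]/eqP E.
- by rewrite E edge_sym; have [] := extra_edge_edge kk'.
- by rewrite -E; have [] := extra_edge_edge jj'.
- subst k'; move: jj' kk'; rewrite ![extra_edge _ _ j']extra_edge_sym.
  move=> /extra_edgeP[_ _ [a ea]] /extra_edgeP[_ _ [b eb]].
  by have [] := extra_adjacent jk ea eb.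
Qed.

(** The centre of a star of at least two extra edges that are not two sides of a
triangle of extra edges. *)
Definition centre W x := exists y z,
  [/\ y != z, extra_edge W x y, extra_edge W x z & ~~ extra_edge W y z].

Lemma centre_unique W x x' : centre W x -> centre W x' -> x = x'.
Proof.
move=> [y [z [yz xy xz nyz]]] [y' [z' [yz' xy' xz' nyz']]].
apply/eqP/negPn/negP => xx'.
have h1 := extra_edge_meet xy xy'; have h2 := extra_edge_meet xz xy'.
have h3 := extra_edge_meet xy xz'; have h4 := extra_edge_meet xz xz'.
move: h1 h2 h3 h4; rewrite (negPf xx') /=.
have [xy'E|nxy'] := eqVneq x y'.
  subst y'; rewrite (negPf yz') /=.
  move=> _ _ /orP[]/eqP E /orP[]/eqP E'.
  - by rewrite E E' eqxx in yz.
  - by move: nyz; rewrite E E' xz'.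
  - by move: nyz; rewrite E E' extra_edge_sym xz'.
  - by rewrite E E' eqxx in yz.
move=> /= /orP[]/eqP E /orP[]/eqP E' _ _.
- by rewrite E E' eqxx in yz.
- by move: nyz; rewrite E E' xy'.
- by move: nyz; rewrite E E' extra_edge_sym xy'.
- by rewrite E E' eqxx in yz.
Qed.

(** Within the clique of the ends of the extra edges, the only obstruction to
eliminating x is a pair of extra edges at x whose third side is not extra. *)
Lemma extra_ends_simplicial (W : {set 'I_n}) x D :
  (forall u v, u \in W -> v \in W -> edge G u v -> low u v) ->
  x \in extra_ends W -> ~ centre W x -> x \notin D -> D \subset extra_ends W ->
  gain_simplicial S x D.
Proof.
move=> Wlow xQ ncx xD DQ y z yD zD yz a b aS bS.
have QW u : u \in extra_ends W -> u \in W.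
  by move=> /extra_endsP[v /extra_edgeP[]].
have yQ : y \in extra_ends W by apply: (fintype.subsetP DQ).
have zQ : z \in extra_ends W by apply: (fintype.subsetP DQ).
have [xW yW zW] := And3 (QW _ xQ) (QW _ yQ) (QW _ zQ).
have xy : x != y by apply: contraNneq xD => ->.
have xz : x != z by apply: contraNneq xD => ->.
have cl u v : u \in extra_ends W -> v \in extra_ends W -> u != v -> low u v.
  move=> uQ vQ uv; apply: Wlow; [exact: QW|exact: QW|].
  exact: extra_ends_clique uQ vQ uv.
have lowxy := cl _ _ xQ yQ xy; have lowxz := cl _ _ xQ zQ xz.
have /andP[tyz _] := cl _ _ yQ zQ yz.
have eE u v c : u \in W -> v \in W -> extra u v c -> extra_edge W u v.
  by move=> uW vW ec; apply/extra_edgeP; split=> //; exists c.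
have extraP u v c : u != v -> c \in S u v -> low u v -> c = tau u v \/ extra u v c.
  move=> uv cS lowuv; have [|nc] := eqVneq c (tau u v); first by left.
  by right; apply/and4P.
have [aE|ea] := extraP _ _ _ xz aS lowxz; have [bE|eb] := extraP _ _ _ xy bS lowxy.
- by rewrite aE bE tau_sub.
- have Exy := eE _ _ _ xW yW eb.
  have [/extra_edgeP[_ _ [c ec]]|nyz] := boolP (extra_edge W y z).
    have [_ _ E] := extra_adjacent xz (extra_opp eb) ec.
    have -> : a - b = c by rewrite aE -E opprK addrK.
    by case/and4P: ec.
  case: ncx; exists y, z; split=> //; have /extra_endsP[z' zz'] := zQ.
  have := extra_edge_meet Exy zz'; rewrite (negPf xz) (negPf yz) /= => /orP[]/eqP E.
    by rewrite E extra_edge_sym.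
  by move: nyz; rewrite E extra_edge_sym zz'.
- have Exz := eE _ _ _ xW zW ea.
  have [/extra_edgeP[_ _ [c ec]]|nyz] := boolP (extra_edge W y z).
    have [_ _ E] := extra_adjacent xy (extra_opp ea) (extra_opp ec).
    have -> : a - b = c by rewrite bE -E opprK opprD opprK addrC subrK.
    by case/and4P: ec.
  case: ncx; exists y, z; split=> //; have /extra_endsP[y' yy'] := yQ.
  have := extra_edge_meet Exz yy'; rewrite (negPf xy) [z == y]eq_sym (negPf yz) /=.
  move=> /orP[]/eqP E; first by rewrite E extra_edge_sym.
  by move: nyz; rewrite E yy'.
- by have [_ _ ->] := extra_adjacent yz eb ea.
Qed.

(** Edges at a vertex outside the clique have their switched gain only, so being
simplicial in the graph is enough there. *)
Lemma elim_low (W : {set 'I_n}) :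
  (forall u v, u \in W -> v \in W -> edge G u v -> low u v) ->
  elim (simplicial (edge G)) finset.set0 W ->
  elim (gain_simplicial S) finset.set0 W.
Proof.
move=> Wlow Wel; set Q := extra_ends W.
have QW : Q \subset W by apply/fintype.subsetP => u /extra_endsP[v /extra_edgeP[]].
have WQ : elim (gain_simplicial S) Q W.
  apply: elim_impl (simplicial_elim_to_clique (@edge_sym _ G) Wel QW
    (extra_ends_clique (W := W))).
  move=> x D xQ xD; rewrite finset.subUset finset.sub1set => /andP[xW DW] xs.
  have DW' := fintype.subsetP DW.
  have neq y : y \in D -> x != y by move=> yD; apply: contraNneq xD => ->.
  have notau y c : y \in D -> c \in S x y -> c = tau x y.
    move=> yD cS; apply: contrapT => /eqP nc; move/negP: xQ; apply.
    apply/extra_endsP; exists y; apply/extra_edgeP; split=> //; first exact: DW'.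
    exists c; apply/and4P; split=> //; first exact: neq.
    apply: Wlow => //; first exact: DW'.
    exact: (mem_gain_edge hS (neq _ yD) cS).
  move=> y z yD zD yz a b aS bS.
  rewrite (notau _ _ zD aS) (notau _ _ yD bS) tau_sub.
  suff /(Wlow _ _ (DW' _ yD) (DW' _ zD))/andP[] : edge G y z by [].
  have exz := mem_gain_edge hS (neq _ zD) aS; have exy := mem_gain_edge hS (neq _ yD) bS.
  by apply: xs; rewrite // inE ?yD ?zD.
apply: elim_trans WQ _.
have [Q0|/finset.set0Pn[d dQ]] := eqVneq Q finset.set0.
  by rewrite Q0; apply: elim_refl.
have [c cQ hc] : exists2 c, c \in Q & forall x, centre W x -> x = c.
  have [[c cc]|nc] := EM (exists c, centre W c).
    exists c; last by move=> x /centre_unique; apply.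
    by have [y [z [_ cy _ _]]] := cc; apply/extra_endsP; exists y.
  by exists d => // x cx; case: nc; exists x.
apply: (@elim_trans _ _ [set c]%SET); last first.
  by apply: elim_small; rewrite ?cards1 // => x y z; rewrite finset.inE.
apply: elim_any; first by rewrite finset.sub1set.
move=> x D xQ; rewrite finset.inE => /eqP xc DQ xD.
by apply: extra_ends_simplicial xD DQ => // /hc.
Qed.

(** The vertices whose private colour lies below H_infinity are the last ones: arcs
from them stay among them, and all edges between them are low. *)
Lemma levels_block_elim W : nonseparable_set G W -> (1 < #|W|)%N ->
  elim (gain_simplicial S) finset.set0 W.
Proof.
move=> Wns W1; have hcol := level_rank_colouring; have [csym disj few many] := hcol.
have third x y z : edge G x y -> edge G x z -> y != z ->
    level_colour x y = level_colour x z ->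
    edge G y z /\ level_colour y z != level_colour x y.
  move=> exy exz yz E; have [eyz lt] := level_colour_third exy exz yz E.
  by split=> //; apply: contraTneq lt => ->; rewrite ltnn.
have [W0 Wc Wv] := Wns.
have many1 v : v \in W ->
    (#|(W :\ v)%SET| <= #|colours (edge G) level_colour (W :\ v)%SET|.+1)%N.
  move=> vW; apply: many; last exact: Wv.
  by move: W1; rewrite (cardsD1 v) vW ltnS card_gt0.
have mono := @private_colour_monotone _ _ (edge G) level_colour W (@edge_sym _ G)
  (@edge_irr _ G) csym (fun x y z w _ _ _ _ => @disj x y z w)
  (fun x y z _ _ _ => @level_colour_third x y z) (fun D _ => @few D) W1
  (many _ W0 Wc) many1.
pose R := block_arc G level_colour W.
have sinks := block_arc_sinks hcol Wns W1.
have later := block_later_arc hcol third Wns W1.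
pose pc := private_colour (edge G) level_colour W.
pose W2 : {set 'I_n} := [set v in W | if pc v is Some c then (c < t)%N else false]%SET.
have W2W : W2 \subset W by apply/fintype.subsetP => v; rewrite finset.inE => /andP[].
have W2P v : v \in W2 -> exists2 c, pc v = Some c & (c < t)%N.
  by rewrite finset.inE; case: (pc v) => [c|]; rewrite ?andbF // => /andP[_]; exists c.
have arcW2 u w : u \in W2 -> w \in W -> R u w -> w \in W2 /\ low u w.
  move=> uW2 wW /and3P[euw /eqP pu _]; have [c puc ct] := W2P _ uW2.
  have uW := fintype.subsetP W2W _ uW2.
  move: puc ct; rewrite /pc pu => -[<-] ct.
  have [d pw dle] := mono u w uW wW euw pu.
  split; last by rewrite low_level // -level_colourE.
  by rewrite finset.inE wW /pc pw; apply: leq_ltn_trans ct.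
have W2low u v : u \in W2 -> v \in W2 -> edge G u v -> low u v.
  move=> uW2 vW2 euv.
  have uW := fintype.subsetP W2W _ uW2; have vW := fintype.subsetP W2W _ vW2.
  have /orP[/(arcW2 _ _ uW2 vW)[]//|/(arcW2 _ _ vW2 uW)[_]] :=
    block_edge_arc hcol third Wns W1 uW vW euv.
  by rewrite low_sym //; apply: contraTneq euv => ->; rewrite edge_irr.
have arcs x y z D : x \in W -> D \subset W -> y \in D -> z \in D ->
    (forall y, y \in D -> ~~ R y x) -> edge G x y -> edge G x z ->
    level_colour x y = level_colour x z /\ R x y.
  move=> xW DW yD zD no exy exz.
  have Rxy := later x y D xW DW yD no exy; have Rxz := later x z D xW DW zD no exz.
  by split=> //; apply: arc_col Rxy Rxz.
have neqD (x y : 'I_n) (D : {set 'I_n}) : x \notin D -> y \in D -> x != y.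
  by move=> xD yD; apply: contraNneq xD => ->.
apply: (@elim_trans _ _ W2).
  have WE : W = ((W :\: W2) :|: W2)%SET.
    apply/setP => x; rewrite !finset.inE.
    by case: (boolP (x \in W)); case: (pc x) => //= c; case: (_ < _)%N.
  (* P is vacuous on W2, which allows the order of all of W to be built. *)
  pose P x D := x \notin W2 -> gain_simplicial S x D.
  apply: (@elim_impl _ P); first by move=> x D xW2 _ _; apply.
  rewrite [X in elim _ _ X]WE; apply: (elim_of_sinks sinks).
  - move=> x D xW DW xD no xW2 y z yD zD yz a b aS bS.
    have exz := mem_gain_edge hS (neqD _ _ _ xD zD) aS.
    have exy := mem_gain_edge hS (neqD _ _ _ xD yD) bS.
    have [E /and3P[_ /eqP px _]] := arcs x y z D xW DW yD zD no exy exz.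
    apply: (high_third_gain exy exz) => //; first exact: level_colour_eq E.
    apply: contra xW2; rewrite finset.inE xW /pc px level_colourE // low_level //.
  - exact: finset.subsetDl.
  - exact: W2W.
  - by apply/pred0P => x; rewrite /= finset.inE andbAC andNb.
  - move=> x y xW2; rewrite finset.inE => /andP[yW2 yW]; apply: contra yW2.
    by move=> /(arcW2 _ _ xW2 yW)[].
apply: elim_low => //; rewrite -[X in elim _ _ X]finset.setU0.
apply: (elim_of_sinks (W := W) sinks).
- move=> x D xW DW xD no y z; rewrite !inE => /andP[yD exy] /andP[zD exz] yz.
  have [E _] := arcs x y z D xW DW yD zD no exy exz.
  by have [] := third _ _ _ exy exz yz E.
- exact: W2W.
- exact: finset.sub0set.
- by rewrite -finset.setI_eq0 finset.setI0.
- by move=> x y; rewrite finset.inE.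
Qed.

End ConeLevels.

Lemma supersolvable_blockwise_admissible (K : fieldType) (n : nat)
    (G : graph 'I_n) (S : 'I_n -> 'I_n -> {fset K}) :
  (forall i, i \in vertices G) -> gain_sets G S ->
  supersolvable (cone_arrangement S) -> blockwise_admissible G S.
Proof.
move=> hG hS [r [C AC]]; apply: blockwise_admissible_of_elim => // W [Wns _] W1.
have Ah := cone_arrangement_hyperplane hS.
have rho_level := chain_level_function Ah AC.
have rhoN H : cone_arrangement S H -> (chain_level r C H < r.+1)%N.
  by move=> AH; rewrite ltnS; apply: chain_level_le AH.
have [phi phiP] := potential_exists hS rho_level.
exact: (levels_block_elim hS rhoN rho_level phiP).
Qed.

(** * From admissible orderings to chains and nice partitions *)

Section BlockLevels.
Import GRing.Theory.
Local Open Scope classical_set_scope.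
Local Open Scope card_scope.
Local Open Scope ring_scope.
Variables (K : fieldType) (n : nat) (G : graph 'I_n).
Variable S : 'I_n -> 'I_n -> {fset K}.
Hypothesis hS : gain_sets G S.
Implicit Types (D W Z : {set 'I_n}) (x y z w : 'I_n).
Local Notation cgh := (@cone_gain_hyperplane K n).
Local Notation gh := (@gain_hyperplane K n).
Local Notation Hinf := (hyperplane_at_infinity K n).

Definition position_function D (idx : 'I_n -> nat) :=
  [/\ {in D &, injective idx}, forall x, (idx x <= n)%N &
      forall x y z, x \in D -> y \in D -> z \in D -> (idx x < idx y)%N ->
        (idx x < idx z)%N -> y != z ->
        forall a b, a \in S x z -> b \in S x y -> a - b \in S y z].

Lemma position_of_ordering D m (v : 'I_m -> 'I_n) :
  admissible_ordering (induced G D) (restrict_gains (induced G D) S) v ->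
  exists idx, position_function D idx.
Proof.
move=> [vinj vD vadm].
pose idx x := if [pick k | v k == x] is Some k then val k else 0%N.
have idxv k : idx (v k) = k.
  rewrite /idx; case: pickP => [l /eqP/vinj->//|/(_ k)]; by rewrite eqxx.
have mn : (m <= n)%N by have := leq_card v vinj; rewrite !card_ord.
exists idx; split.
- by move=> x y /vD[k ->] /vD[l ->]; rewrite !idxv => /ord_inj->.
- move=> x; rewrite /idx; case: pickP => // k _.
  exact: leq_trans (ltnW (ltn_ord k)) mn.
move=> x y z xD yD zD + + yz a b aS bS.
have xin := xD; have yin := yD; have zin := zD.
move: xD yD zD => /vD[k xE] /vD[i yE] /vD[j zE].
rewrite {1 2}xE yE zE !idxv => ki kj.
have ij : i != j by apply: contraNneq yz => ij; rewrite yE zE ij.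
have vn (r : 'I_m) : (k < r)%N -> v k != v r.
  by move=> kr; apply: contraTneq kr => /vinj->; rewrite ltnn.
have xy : edge (induced G D) x y.
  have xny : x != y by rewrite xE yE vn.
  by rewrite /= /inside /= xin yin (mem_gain_edge hS xny bS).
have xz : edge (induced G D) x z.
  have xnz : x != z by rewrite xE zE vn.
  by rewrite /= /inside /= xin zin (mem_gain_edge hS xnz aS).
have /fsubsetP sub := vadm k i j ki kj ij.
have aR : a \in restrict_gains (induced G D) S (v k) (v j).
  by rewrite -xE -zE /restrict_gains xz.
have bR : b \in restrict_gains (induced G D) S (v k) (v i).
  by rewrite -xE -yE /restrict_gains xy.
have : a - b \in restrict_gains (induced G D) S (v i) (v j).
  by apply: sub; apply/imfset2P; exists a => //; exists b.
rewrite /restrict_gains -yE -zE; by case: ifP.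
Qed.

Variables (idx : {set 'I_n} -> 'I_n -> nat) (block_of : 'I_n -> 'I_n -> {set 'I_n}).
Hypothesis idxP : forall D, block_set G D -> position_function D (idx D).
Hypothesis block_ofP : forall x y, edge G x y ->
  [/\ block_set G (block_of x y), x \in block_of x y & y \in block_of x y].

Lemma edge_neq x y : edge G x y -> x != y.
Proof. by move=> exy; apply: contraTneq exy => ->; rewrite edge_irr. Qed.

Lemma block_ofE D x y : edge G x y -> block_set G D -> x \in D -> y \in D ->
  block_of x y = D.
Proof.
move=> exy Db xD yD; have [Bb xB yB] := block_ofP exy.
exact: block_set_eq Bb Db (edge_neq exy) xB yB xD yD.
Qed.

(** Lexicographic in the block and the position of the earlier end, a later
position being lower. Positions are at most n, hence the base n.+1. *)
Definition block_level x y : nat := (enum_rank (block_of x y) * n.+1 +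
  (n - minn (idx (block_of x y) x) (idx (block_of x y) y)))%N.

Lemma block_level_sym x y : edge G x y -> block_level x y = block_level y x.
Proof.
move=> exy; have [Bb xB yB] := block_ofP exy.
by rewrite /block_level (@block_ofE (block_of x y) y x) 1?edge_sym // minnC.
Qed.

(** The edge xy leaves x, the earlier of its ends. *)
Definition tail x y := (idx (block_of x y) x < idx (block_of x y) y)%N.

Lemma edge_tail x y : edge G x y -> tail x y || tail y x.
Proof.
move=> exy; have [Bb xB yB] := block_ofP exy; have [idxinj _ _] := idxP Bb.
rewrite /tail (@block_ofE (block_of x y) y x) 1?edge_sym // -neq_ltn.
by apply: contra (edge_neq exy) => /eqP/idxinj->.
Qed.

Lemma block_level_tail x y : edge G x y -> tail x y ->
  block_level x y = (enum_rank (block_of x y) * n.+1 + (n - idx (block_of x y) x))%N.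
Proof. by move=> exy /ltnW xy; rewrite /block_level (minn_idPl xy). Qed.

Lemma divmod_eq a b m k l : (k <= m)%N -> (l <= m)%N ->
  (a * m.+1 + k = b * m.+1 + l)%N -> a = b /\ k = l.
Proof.
move=> km lm E; have : ((a * m.+1 + k) %/ m.+1 = (b * m.+1 + l) %/ m.+1)%N by rewrite E.
by rewrite !divnMDl // !divn_small // !addn0 => ab; move: E; rewrite ab => /addnI.
Qed.

Lemma same_block_level x y z w : edge G x y -> edge G z w -> tail x y ->
  tail z w -> block_level x y = block_level z w -> block_of z w = block_of x y /\ z = x.
Proof.
move=> exy ezw txy tzw; rewrite !block_level_tail //.
move=> /(divmod_eq (leq_subr _ _) (leq_subr _ _))[/ord_inj/enum_rank_inj block_ofE' idxE].
split=> //; have [Bb xB yB] := block_ofP exy; have [_ zB wB] := block_ofP ezw.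
have [idxinj idxn _] := idxP Bb; rewrite -block_ofE' in zB wB idxE.
apply: idxinj => //; have := idxn x; have := idxn z; lia.
Qed.

(** Two edges of one level leave the same vertex x of the same block for later
vertices, so the admissibility condition at x applies to them. *)
Lemma same_block_level_third x y w a b : edge G x y -> edge G x w -> tail x y ->
  tail x w -> block_level x y = block_level x w -> y != w ->
  a \in S x w -> b \in S x y ->
  a - b \in S y w /\ (block_level y w < block_level x y)%N.
Proof.
move=> exy exw txy txw E yw aS bS.
have [block_ofE' _] := same_block_level exy exw txy txw E.
have [Bb xB yB] := block_ofP exy.
have [_ _ wB] := block_ofP exw; rewrite block_ofE' in wB.
have [idxinj idxn idxadm] := idxP Bb.
have txw' : (idx (block_of x y) x < idx (block_of x y) w)%N by rewrite -block_ofE'.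
have abS : a - b \in S y w by apply: (idxadm x).
split=> //; have eyw := mem_gain_edge hS yw abS.
rewrite (block_level_tail exy txy) /block_level (block_ofE eyw Bb) // ltn_add2l.
have := idxn y; have := idxn w; have := txy; rewrite /tail; lia.
Qed.

(** Removing the edges of a block that leave x or earlier vertices separates x
from the later vertices of the block: inside the block x is isolated, and no two
vertices of a block are joined outside it. *)
Lemma level_separator x y : edge G x y -> tail x y -> exists Z,
  [/\ x \in Z, y \notin Z & forall z w, edge G z w ->
      (block_level z w < block_level x y)%N -> (z \in Z) = (w \in Z)].
Proof.
move=> exy txy; have [Bb xB yB] := block_ofP exy; set D := block_of x y in Bb xB yB.
pose R : rel 'I_n := [rel a b | outside G D a b ||
  [&& inside G D a b, (idx D x < idx D a)%N & (idx D x < idx D b)%N]].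
have Rsym : symmetric R.
  move=> a b; rewrite /R /= outside_sym inside_sym.
  by congr (_ || (_ && _)); rewrite andbC.
pose Z := [set z | connect R x z]%SET; exists Z; split.
- by rewrite finset.inE connect0.
- rewrite finset.inE; apply/negP => /connectP[p pR yE].
  have sep z : z \in D -> z != x -> ~~ connect (outside G D) x z.
    by move=> zD zx; apply: block_separates => //; rewrite eq_sym.
  have : connect (outside G D) x y.
    rewrite yE; elim/last_ind: p pR {yE} => [//|p z IH].
    rewrite rcons_path last_rcons => /andP[/IH xl].
    move=> /orP[lz|/and3P[/and3P[lD _ _] lx _]].
      exact: connect_trans xl (connect1 lz).
    have := sep _ lD; rewrite xl => h; have [lE|/h//] := eqVneq (last x p) x.
    by rewrite lE ltnn in lx.
  by apply/negP/sep; rewrite // eq_sym edge_neq.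
move=> z w ezw lt.
have Rzw : R z w.
  rewrite /R /= /outside /inside /= ezw /=.
  have [zD|//] := boolP (z \in D); have [wD|//] := boolP (w \in D).
  have blzw := block_ofE ezw Bb zD wD; have [_ idxn _] := idxP Bb.
  move: lt; rewrite (block_level_tail exy txy) /block_level blzw ltn_add2l /=.
  have := idxn z; have := idxn w; rewrite -/D; lia.
rewrite !finset.inE; apply/idP/idP => /connect_trans; apply; apply: connect1 => //.
by rewrite Rsym.
Qed.

Definition level_bound := (#|{set 'I_n}| * n.+1)%N.

Lemma block_level_lt x y : (block_level x y < level_bound)%N.
Proof.
rewrite /block_level /level_bound; have := ltn_ord (enum_rank (block_of x y)).
set r := nat_of_ord _; move=> h.
apply: (@leq_trans (r.+1 * n.+1)); last by rewrite leq_mul2r h orbT.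
by rewrite mulSn addnC -addSn leq_add2r ltnS leq_subr.
Qed.

Lemma tail_gain x y a : x != y -> a \in S x y -> exists u v b,
  [/\ tail u v, u != v, b \in S u v, edge G u v &
      [/\ block_level u v = block_level x y, gh u v b = gh x y a &
          cgh u v b = cgh x y a]].
Proof.
move=> xy aS; have exy := mem_gain_edge hS xy aS.
have /orP[t|t] := edge_tail exy; first by exists x, y, a.
exists y, x, (- a); split=> //.
- by rewrite eq_sym.
- exact: (gain_opp hS).
- by rewrite edge_sym.
split; first by apply: block_level_sym; rewrite edge_sym.
  by rewrite gain_hyperplane_sym opprK.
by rewrite cone_gain_sym opprK.
Qed.

Definition cone_level H : nat := if `[< H = Hinf >] then 0%N else
  xget 0%N [set k | exists x y a,
    [/\ x != y, a \in S x y, H = cgh x y a & k = (block_level x y).+1]].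

Lemma cone_level_infinity : cone_level Hinf = 0%N.
Proof. by rewrite /cone_level; case: asboolP. Qed.

Lemma cone_levelE x y a : x != y -> a \in S x y ->
  cone_level (cgh x y a) = (block_level x y).+1.
Proof.
move=> xy aS; rewrite /cone_level; case: asboolP => [E|_].
  by case: (cone_gain_neq_infinity xy E).
case: xgetP => [_ -> [z [w [b [zw bS E ->]]]]|/(_ (block_level x y).+1)[]].
  have [[-> [-> _]]//|[-> [-> _]]] := cone_gain_inj xy zw E.
  by rewrite block_level_sym // edge_sym (mem_gain_edge hS xy aS).
by exists x, y, a.
Qed.

(** Two parallel hyperplanes meet in H_infinity, which lies below everything; the
separator of an edge is a point at infinity lying on all lower hyperplanes but not
on those of the edge. *)
Lemma cone_level_function : level_function (cone_arrangement S) cone_level.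
Proof.
split=> [e f /(cone_arrangementP hS) Ae /(cone_arrangementP hS) Af ef|e].
  case: Ae => [->|[x0 [y0 [a0 [xy0 aS0 ->]]]]] in ef *.
    case: Af => [fE|[z [w [b [zw bS ->]]]]]; first by rewrite fE in ef.
    by rewrite cone_level_infinity cone_levelE //.
  case: Af => [->|[z0 [w0 [b0 [zw0 bS0 fE]]]]] in ef *.
    by rewrite cone_level_infinity cone_levelE //.
  rewrite {}fE in ef *.
  have [x [y [a [txy xy aS exy [_ _ eE]]]]] := tail_gain xy0 aS0.
  have [z [w [b [tzw zw bS ezw [_ _ fE]]]]] := tail_gain zw0 bS0.
  rewrite -{}eE -{}fE {x0 y0 a0 xy0 aS0 z0 w0 b0 zw0 bS0} in ef *.
  rewrite !cone_levelE // => -[lE].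
  have [_ zx] := same_block_level exy ezw txy tzw lE; subst z.
  have [wy|wy] := eqVneq w y.
    subst w; exists Hinf; split; first exact: (infinity_in_cone hS).
      by rewrite cone_level_infinity.
    by apply: cone_gain_parallel_infinity; apply: contra_notN ef => /eqP->.
  have yw : y != w by rewrite eq_sym.
  have [baS lt] := same_block_level_third exy ezw txy tzw lE yw bS aS.
  exists (cgh y w (b - a)); split; first exact: (cone_gain_in_cone hS).
    by rewrite cone_levelE.
  exact: cone_gain_triangle.
move=> Ae sub.
have /(cone_arrangementP hS)[eE|[x0 [y0 [a0 [xy0 aS0 eE]]]]] := Ae; subst e.
  have : Hinf (at_height 1 0).
    by apply: sub => g [_]; rewrite cone_level_infinity.
  by move/infinity_at_height/eqP; rewrite oner_eq0.
have [x [y [a [txy xy aS exy [_ _ eE]]]]] := tail_gain xy0 aS0.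
rewrite -{}eE in Ae sub.
have [Z [xZ yZ Zlow]] := level_separator exy txy.
have : cgh x y a (at_height 0 (indicator K Z)).
  apply: sub => g [/(cone_arrangementP hS)[->|[z [w [b [zw bS ->]]]]]].
    by move=> _; apply/infinity_at_height.
  rewrite !cone_levelE // ltnS => lt; apply/cone_gain_bottom/eqP; rewrite indicator_eq.
  by apply/eqP/Zlow => //; apply: (mem_gain_edge hS zw bS).
by move/cone_gain_bottom/eqP; rewrite indicator_eq xZ (negPf yZ).
Qed.

Lemma cone_chain_through : has_maximal_modular_chain_through (cone_arrangement S) Hinf.
Proof.
apply: (@level_function_chain_through _ _ _ 0 (cone_arrangement_hyperplane hS)
  (cone_arrangement_zero hS) cone_level level_bound.+1).
- move=> H /(cone_arrangementP hS)[->|[x [y [a [xy aS ->]]]]].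
    by rewrite cone_level_infinity.
  by rewrite cone_levelE // ltnS block_level_lt.
- exact: cone_level_function.
- exact: (infinity_in_cone hS).
move=> H /(cone_arrangementP hS)[->//|[x [y [a [xy aS ->]]]]] _.
by rewrite cone_level_infinity cone_levelE.
Qed.

Definition gain_level H : nat := xget 0%N [set k | exists x y a,
  [/\ x != y, a \in S x y, H = gh x y a & k = block_level x y]].

Lemma gain_levelE x y a : x != y -> a \in S x y ->
  gain_level (gh x y a) = block_level x y.
Proof.
move=> xy aS; rewrite /gain_level.
case: xgetP => [_ -> [z [w [b [zw bS E ->]]]]|/(_ (block_level x y))[]].
  have [|[-> [-> _]]//|[-> [-> _]]] := gain_hyperplane_inj xy zw (c := b) (a := a).
    by rewrite E.
  by rewrite block_level_sym // edge_sym (mem_gain_edge hS xy aS).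
by exists x, y, a.
Qed.

Lemma gain_level_lt H : gain_arrangement S H -> (gain_level H < level_bound)%N.
Proof.
move=> /(gain_arrangementP hS)[x [y [a [xy aS ->]]]].
by rewrite gain_levelE // block_level_lt.
Qed.

Lemma gain_same_level e f : gain_arrangement S e -> gain_arrangement S f ->
  e <> f -> gain_level e = gain_level f -> e `&` f !=set0 ->
  exists g, [/\ gain_arrangement S g, (gain_level g < gain_level e)%N &
    e `&` f `<=` g].
Proof.
move=> /(gain_arrangementP hS)[x0 [y0 [a0 [xy0 aS0 ->]]]].
move=> /(gain_arrangementP hS)[z0 [w0 [b0 [zw0 bS0 ->]]]].
have [x [y [a [txy xy aS exy [_ <- _]]]]] := tail_gain xy0 aS0.
have [z [w [b [tzw zw bS ezw [_ <- _]]]]] := tail_gain zw0 bS0.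
move=> ef; rewrite !gain_levelE // => lE [p [pe pf]].
have [_ zx] := same_block_level exy ezw txy tzw lE; subst z.
have [wy|wy] := eqVneq w y.
  by subst w; case: ef; congr (gh _ _ _); rewrite -pe -pf.
have yw : y != w by rewrite eq_sym.
have [baS lt] := same_block_level_third exy ezw txy tzw lE yw bS aS.
exists (gh y w (b - a)); split; first exact: (gain_in_arrangement hS).
  by rewrite gain_levelE.
move=> q [qe qf]; apply/cone_gain_slice; apply: (@cone_gain_triangle _ _ y x w a b).
by split; apply/cone_gain_slice.
Qed.

Lemma gain_separator e : gain_arrangement S e -> exists u,
  (forall g, gain_arrangement S g -> (gain_level g < gain_level e)%N ->
     stable u g) /\ ~ stable u e.
Proof.
move=> /(gain_arrangementP hS)[x0 [y0 [a0 [xy0 aS0 ->]]]].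
have [x [y [a [txy xy aS exy [_ <- _]]]]] := tail_gain xy0 aS0.
have [Z [xZ yZ Zlow]] := level_separator exy txy.
exists (indicator K Z); split.
  move=> g /(gain_arrangementP hS)[z [w [b [zw bS ->]]]].
  rewrite !gain_levelE // => lt.
  apply: stable_gain_hyperplane; apply/eqP; rewrite indicator_eq.
  by apply/eqP/Zlow => //; apply: (mem_gain_edge hS zw bS).
have [[p gp] _] := hyperplane_affine (gain_hyperplaneP a xy).
move=> /(_ p gp)/(stable_gain_hyperplane_inv gp)/eqP.
by rewrite indicator_eq xZ (negPf yZ).
Qed.

Definition occurring_levels : seq nat :=
  [seq i <- iota 0 level_bound |
    `[< exists2 H, gain_arrangement S H & gain_level H = i >]].

Lemma occurring_levelP H : gain_arrangement S H -> gain_level H \in occurring_levels.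
Proof.
move=> AH; rewrite mem_filter mem_iota add0n gain_level_lt // !andbT.
by apply/asboolP; exists H.
Qed.

Definition level_part (i : 'I_(size occurring_levels)) : set (set 'rV[K]_n) :=
  [set H | gain_arrangement S H /\ gain_level H = tnth (in_tuple occurring_levels) i].

Lemma level_part_exists H : gain_arrangement S H -> exists i, level_part i H.
Proof.
move=> AH; have /tnthP[i iE] : gain_level H \in in_tuple occurring_levels.
  exact: occurring_levelP.
by exists i.
Qed.

(** A section has its hyperplanes on distinct levels, so the rank formula applies
to it. On the least level of a localization there is only one hyperplane, as two
would meet inside a lower one. *)
Lemma level_nice_partition : nice_partition (gain_arrangement S) level_part.
Proof.
have Ah := gain_arrangement_hyperplane hS.
split.
- split.
  + move=> i; have : tnth (in_tuple occurring_levels) i \in occurring_levels.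
      exact: mem_tnth.
    by rewrite mem_filter => /andP[/asboolP[H AH HE] _]; exists H.
  + move=> i j ij; apply/seteqP; split=> // H [[_ iE] [_ jE]].
    move/negP: ij; apply; apply/eqP.
    have := tuple_uniqP (in_tuple occurring_levels).
    move=> /(_ (filter_uniq _ (iota_uniq _ _))); apply.
    by rewrite -iE -jE.
  + apply/seteqP; split=> [H [i _ []]//|H AH].
    by have [i iH] := level_part_exists AH; exists i.
- move=> p B [BA Bp Bsec].
  have Binj H H' : B H -> B H' -> gain_level H = gain_level H' -> H = H'.
    move=> BH BH' E; have [i [AH iH]] := level_part_exists (BA _ BH).
    by apply: (Bsec i) => //; split=> //; [apply: BA | rewrite -E].
  have [] := @rank_levels _ _ B gain_level level_bound.
  + by move=> H /BA/Ah.
  + by move=> H /BA/gain_level_lt.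
  + by move=> e f Be Bf ef /(Binj _ _ Be Bf).
  + move=> e Be; have [u [ul ue]] := gain_separator (BA _ Be).
    by exists u; split=> // g /BA; apply: ul.
  move=> nz cB; split=> //; rewrite cB.
  pose E := [set i : 'I_level_bound | occupied B gain_level i]%SET.
  have -> : (\sum_(i < level_bound) occupied B gain_level i)%N = #|E|.
    rewrite -sum1_card [RHS]big_mkcond /=; apply: eq_bigr => i _.
    by rewrite finset.inE; case: ifP.
  have /choice[F FP] : forall i : 'I_level_bound, exists H, i \in E ->
      B H /\ gain_level H = i.
    move=> i; case: (boolP (i \in E)) => [|_]; last by exists setT.
    by rewrite finset.inE => /asboolP[H BH HE]; exists H.
  have FB : F @` [set i | i \in E] = B.
    apply/seteqP; split=> [_ [i /= /FP[BF _] <-]//|H BH].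
    have iE : Ordinal (gain_level_lt (BA _ BH)) \in E.
      by rewrite finset.inE; apply/asboolP; exists H.
    exists (Ordinal (gain_level_lt (BA _ BH))) => //=.
    by have [BF FE] := FP _ iE; apply: Binj.
  have := @card_indexed _ _ E F; rewrite FB => /(_ _)/card_esym h.
  have Finj : {in E &, injective F}.
    move=> i j iE jE ij; apply: val_inj; rewrite /= -(FP _ iE).2 -(FP _ jE).2.
    by rewrite ij.
  by apply/card_eq_II; apply: card_eq_trans (h Finj) Bp.
move=> X Xf XT.
have [x Xx] := Xf.1.
have Q0 : exists k, `[< exists2 H, localization (gain_arrangement S) X H &
    gain_level H = k >].
  have [H XH] : exists H, localization (gain_arrangement S) X H.
    apply: contrapT => no; apply: XT; rewrite (flat_localization Xf).
    by apply/seteqP; split=> // y _ H XH; case: no; exists H.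
  by exists (gain_level H); apply/asboolP; exists H.
case: (ex_minnP Q0) => k /asboolP[H [AH XH] kE] kmin.
have [i [_ iH]] := level_part_exists AH.
exists i, H; apply/seteqP; split=> [H' [[_ iH'] [AH' XH']]|_ ->]; last by split.
apply: contrapT => HH'.
have [|||g [Ag lt sub]] := gain_same_level AH' AH.
- by [].
- by rewrite iH iH'.
- by exists x; split; [apply: XH'|apply: XH].
have : (k <= gain_level g)%N.
  apply: kmin; apply/asboolP; exists g => //; split=> // y Xy.
  by apply: sub; split; [apply: XH'|apply: XH].
by rewrite leqNgt -kE iH -iH' lt.
Qed.

End BlockLevels.

Section FromBlocks.
Local Open Scope classical_set_scope.
Variables (K : fieldType) (n : nat) (G : graph 'I_n).
Variable S : 'I_n -> 'I_n -> {fset K}.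
Hypothesis hG : forall i, i \in vertices G.
Hypothesis hS : gain_sets G S.

Lemma blockwise_positions : blockwise_admissible G S ->
  exists (idx : {set 'I_n} -> 'I_n -> nat) (block_of : 'I_n -> 'I_n -> {set 'I_n}),
  (forall D, block_set G D -> position_function S D (idx D)) /\
  (forall x y, edge G x y ->
    [/\ block_set G (block_of x y), x \in block_of x y & y \in block_of x y]).
Proof.
move=> adm.
have /choice[idx idxP] : forall D, exists idx, block_set G D ->
    position_function S D idx.
  move=> D; have [Db|] := EM (block_set G D); last by exists (fun=> 0%N).
  have [m [v vadm]] := adm _ (block_set_induced hG Db).
  by have [idx h] := position_of_ordering hS vadm; exists idx.
have /choice[block_of block_ofP] : forall xy : 'I_n * 'I_n, exists D, edge G xy.1 xy.2 ->
    [/\ block_set G D, xy.1 \in D & xy.2 \in D].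
  move=> [x y] /=; have [/edge_block[D h]|_] := boolP (edge G x y).
    by exists D.
  by exists finset.set0.
by exists idx, (fun x y => block_of (x, y)); split=> // x y; apply: (block_ofP (x, y)).
Qed.

Lemma blockwise_chain_through : blockwise_admissible G S ->
  has_maximal_modular_chain_through (cone_arrangement S)
    (hyperplane_at_infinity K n).
Proof.
move=> /blockwise_positions[idx [block_of [idxP block_ofP]]].
exact: (cone_chain_through hS idxP block_ofP).
Qed.

Lemma blockwise_nice_partition : blockwise_admissible G S ->
  has_nice_partition (gain_arrangement S).
Proof.
move=> /blockwise_positions[idx [block_of [idxP block_ofP]]].
exact: (ex_intro _ _ (ex_intro _ _ (level_nice_partition hS idxP block_ofP))).
Qed.

End FromBlocks.

Theorem corollary4p8 (K : fieldType) (n : nat) (G : graph 'I_n)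
    (hG : forall i : 'I_n, i \in vertices G)
    (S : 'I_n -> 'I_n -> {fset K}) (hS : gain_sets G S) :
  [<-> supersolvable (cone_arrangement S);
       has_maximal_modular_chain_through (cone_arrangement S)
         (hyperplane_at_infinity K n);
       has_nice_partition (gain_arrangement S);
       blockwise_admissible G S].
Proof.
tfae.
- by move=> /(supersolvable_blockwise_admissible hG hS)/(blockwise_chain_through hG hS).
- move=> [r [C [AC _ _]]]; apply: (blockwise_nice_partition hG hS).
  by apply: (supersolvable_blockwise_admissible hG hS); exists r, C.
- exact: nice_blockwise_admissible.
- by move=> /(blockwise_chain_through hG hS)[r [C [AC _ _]]]; exists r, C.
Qed.
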